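(* Suppose that $\mu$ is a Borel probability measure on $\Gamma_X$ with the following properties: (a) $\gamma(\{x\})\in\{0,1\}$ for all $x\in X$ and $\mu$-a.e. $\gamma$; (c) for any $n\in\mathbb{N}=\{0,1,2,\dots\}$: $\mu(\{\gamma\mid\gamma(X)=n\})>0$ if $X$ is compact, and $\mu(\{\gamma\mid\gamma(X)\ge n\})>0$ if $X$ is non-compact; (d') for every smooth compactly supported vector field $V$ on $X$ with flow $(\psi_t)_{t\in\mathbb{R}}$ and every $t\in\mathbb{R}$, the measures $\mu\circ(\psi_t^* )^{-1}$ and $\mu$ are mutually absolutely continuous. Then $\mu$ has full topological support on $\Gamma_X$ (every non-empty open subset of $\Gamma_X$ has positive $\mu$-measure).
   Context: $(X,g)$ is a smooth, connected, complete Riemannian manifold; if $X$ is one-dimensional, then $X=\mathbb{R}$ with its Euclidean metric. $\Gamma_X$ is the space of all (nonnegative) integer-valued Radon measures on $X$ with the topology of vague convergence and its Borel $\sigma$-field. For a diffeomorphism $\psi$ of $X$ and $\gamma\in\Gamma_X$, $\psi^*\gamma:=\gamma\circ\psi^{-1}$. *)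

(* Defs.v *)
From HB Require Import structures.
From mathcomp Require Import all_boot all_order all_algebra.
From mathcomp Require Import all_classical all_reals all_analysis.
Import Order.TTheory GRing.Theory Num.Theory.
Import numFieldNormedType.Exports.

Set Implicit Arguments.
Unset Strict Implicit.
Unset Printing Implicit Defensive.

Local Open Scope classical_set_scope.
Local Open Scope ring_scope.

(* [U] is meant to be open: [derivable] and [continuous] at a point of [U] then
   depend only on the values of [f] on [U]. *)
Fixpoint Ck_on (R : realType) (n k : nat) (U : set 'rV[R]_n)
    (f : 'rV[R]_n -> R) : Prop :=
  (forall x, U x -> {for x, continuous f}) /\
  if k is k'.+1 then
    forall i : 'I_n,
      (forall x, U x -> derivable f x (delta_mx 0 i)) /\
      Ck_on k' U (fun x => 'D_(delta_mx 0 i) f x)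
  else True.

Definition smooth_on (R : realType) (n : nat) (U : set 'rV[R]_n)
    (f : 'rV[R]_n -> R) : Prop := forall k, Ck_on k U f.

Definition smooth_map_on (R : realType) (n m : nat) (U : set 'rV[R]_n)
    (F : 'rV[R]_n -> 'rV[R]_m) : Prop :=
  forall j, smooth_on U (fun x => F x 0 j).

(* [cmap] and [cinv] are total functions, only relevant on [cdom] and
   [cimg], respectively. *)
Record chart (R : realType) (n : nat) (X : topologicalType) := Chart {
  cdom : set X;
  cmap :> X -> 'rV[R]_n;
  cinv : 'rV[R]_n -> X;
  cdom_open : open cdom;
  cimg_open : open (cmap @` cdom);
  cmapK : forall x, cdom x -> cinv (cmap x) = x;
  cmap_continuous : forall x, cdom x -> {for x, continuous cmap};
  cinv_continuous : forall y, (cmap @` cdom) y -> {for y, continuous cinv} }.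

Definition cimg (R : realType) (n : nat) (X : topologicalType)
  (c : chart R n X) : set 'rV[R]_n := c @` cdom c.

Definition transition (R : realType) (n : nat) (X : topologicalType)
  (c c' : chart R n X) : 'rV[R]_n -> 'rV[R]_n := c' \o cinv c.

Definition smooth_transition (R : realType) (n : nat) (X : topologicalType)
    (c c' : chart R n X) : Prop :=
  smooth_map_on (c @` (cdom c `&` cdom c')) (transition c c').

Record smooth_manifold (R : realType) (n : nat) (X : topologicalType) :=
  SmoothManifold {
  atlas : set (chart R n X);
  manifold_hausdorff : hausdorff_space X;
  manifold_second_countable : @second_countable X;
  atlas_cover : forall x, exists2 c, atlas c & cdom c x;
  atlas_compatible :
    forall c c', atlas c -> atlas c' -> smooth_transition c c';
  atlas_maximal : forall c,
    (forall c', atlas c' -> smooth_transition c c' /\ smooth_transition c' c) ->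
    atlas c }.

(* [vcoord c x] is the coordinate vector, in the chart [c], of the tangent
   vector at [x]; [vcoord_compatible] is the transformation law
   v_{c'}(x) = d(c' o c^-1)_{c(x)} (v_c(x)) of tangent vectors. *)
Record vector_field (R : realType) (n : nat) (X : topologicalType)
    (M : smooth_manifold R n X) := VectorField {
  vcoord :> chart R n X -> X -> 'rV[R]_n;
  vcoord_compatible : forall c c' x, atlas M c -> atlas M c' -> cdom c x -> cdom c' x ->
    vcoord c' x = 'D_(vcoord c x) (transition c c') (c x);
  vcoord_smooth : forall c, atlas M c ->
    smooth_map_on (cimg c) (fun y => vcoord c (cinv c y)) }.

Definition vf_support (R : realType) (n : nat) (X : topologicalType)
    (M : smooth_manifold R n X) (V : vector_field M) : set X :=
  closure [set x | exists c, [/\ atlas M c, cdom c x & V c x != 0]].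

Record homeo (X : topologicalType) := Homeo {
  hmap :> X -> X;
  hinv : X -> X;
  hmapK : cancel hmap hinv;
  hinvK : cancel hinv hmap;
  hmap_continuous : continuous hmap;
  hinv_continuous : continuous hinv }.

(* The flow of [V]: t |-> psi t x is the integral curve of [V] starting at [x].
   Uniqueness of integral curves determines [psi] from [V], and smooth
   dependence on initial data makes every [psi t] a diffeomorphism.
   Continuity in [t] is needed since [c] is unconstrained outside [cdom c]. *)
Definition is_flow (R : realType) (n : nat) (X : topologicalType)
    (M : smooth_manifold R n X) (V : vector_field M) (psi : R -> homeo X) :=
  [/\ forall x, psi 0 x = x,
      forall x, continuous (fun t : R => psi t x) &
      forall x t c, atlas M c -> cdom c (psi t x) ->
        is_derive t 1 (fun s : R => c (psi s x)) (V c (psi t x))].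

Definition bilin (R : realType) (n : nat) (G : 'M[R]_n) (u v : 'rV[R]_n) : R :=
  (u *m G *m v^T) 0 0.

(* [gcoord c x] is the Gram matrix of the scalar product on the tangent space
   at [x], in the coordinates given by the chart [c]. *)
Record riemannian_metric (R : realType) (n : nat) (X : topologicalType)
    (M : smooth_manifold R n X) := RiemannianMetric {
  gcoord :> chart R n X -> X -> 'M[R]_n;
  gcoord_sym : forall c x, atlas M c -> cdom c x -> (gcoord c x)^T = gcoord c x;
  gcoord_pos : forall c x (u : 'rV[R]_n), atlas M c -> cdom c x -> u != 0 ->
    0 < bilin (gcoord c x) u u;
  gcoord_compatible : forall c c' x (u v : 'rV[R]_n),
    atlas M c -> atlas M c' -> cdom c x -> cdom c' x ->
    bilin (gcoord c x) u v =
    bilin (gcoord c' x) ('D_u (transition c c') (c x))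
                        ('D_v (transition c c') (c x));
  gcoord_smooth : forall c i j, atlas M c ->
    smooth_on (cimg c) (fun y => gcoord c (cinv c y) i j) }.

Definition C1_curve (R : realType) (n : nat) (X : topologicalType)
    (M : smooth_manifold R n X) (sigma : R -> X) : Prop :=
  continuous sigma /\
  forall t c, atlas M c -> cdom c (sigma t) ->
    derivable (fun s : R => c (sigma s)) t 1 /\
    {for t, continuous (fun s : R => 'D_1 (fun r : R => c (sigma r)) s)}.

Definition is_speed (R : realType) (n : nat) (X : topologicalType)
    (M : smooth_manifold R n X) (g : riemannian_metric M)
    (sigma : R -> X) (s : R -> R) : Prop :=
  forall t c, atlas M c -> cdom c (sigma t) ->
    let v := 'D_1 (fun r : R => c (sigma r)) t in
    s t = Num.sqrt (bilin (g c (sigma t)) v v).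

(* [path_length g x y l]: some piecewise C^1 curve from [x] to [y] has
   length [l]. *)
Inductive path_length (R : realType) (n : nat) (X : topologicalType)
    (M : smooth_manifold R n X) (g : riemannian_metric M) :
    X -> X -> R -> Prop :=
| path_C1 (sigma : R -> X) (s : R -> R) :
    C1_curve M sigma -> is_speed g sigma s ->
    path_length g (sigma 0) (sigma 1)
      (\int[lebesgue_measure]_(t in `[0, 1]) s t)
| path_cat (x y z : X) (l l' : R) :
    path_length g x y l -> path_length g y z l' -> path_length g x z (l + l').

Definition riem_dist (R : realType) (n : nat) (X : topologicalType)
    (M : smooth_manifold R n X) (g : riemannian_metric M) (x y : X) : R :=
  inf [set l | path_length g x y l].

Definition complete_metric (R : realType) (n : nat) (X : topologicalType)
    (M : smooth_manifold R n X) (g : riemannian_metric M) : Prop :=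
  forall u : nat -> X,
    (forall e : R, 0 < e -> exists N, forall i j, (N <= i)%N -> (N <= j)%N ->
       riem_dist g (u i) (u j) < e) ->
    exists x, forall e : R, 0 < e -> exists N, forall i, (N <= i)%N ->
      riem_dist g (u i) x < e.

Definition euclidean (R : realType) (n : nat) (X : topologicalType)
    (M : smooth_manifold R n X) (g : riemannian_metric M) : Prop :=
  exists c, [/\ atlas M c, cdom c = setT, cimg c = setT & forall x, g c x = 1%:M].

Notation borel T := (g_sigma_algebraType (@open T)).

(* As everywhere in the library, a measure is a function on all sets of which
   only the values on measurable sets matter. Two elements of [config R X]
   that agree on the Borel sets of [X] are topologically indistinguishable. *)
Record config (R : realType) (X : ptopologicalType) := Config {
  cmeas :> {measure set (borel X) -> \bar R};
  cmeas_integer : forall A : set (borel X), measurable A ->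
    (exists k : nat, cmeas A = k%:R%:E) \/ cmeas A = +oo%E;
  cmeas_compact : forall K : set X, compact K -> (cmeas K < +oo)%E;
  cmeas_regular : forall A : set (borel X), measurable A ->
    cmeas A = ereal_sup [set cmeas K | K in [set K : set X | compact K /\ K `<=` A]] }.

Record cc_fun (R : realType) (X : topologicalType) := CcFun {
  ccf :> X -> R;
  ccf_continuous : continuous ccf;
  ccf_compact : compact (closure [set x | ccf x != 0]) }.

HB.instance Definition _ (R : realType) (X : topologicalType) :=
  gen_eqMixin (cc_fun R X).
HB.instance Definition _ (R : realType) (X : topologicalType) :=
  gen_choiceMixin (cc_fun R X).

Definition vague_eval (R : realType) (X : ptopologicalType)
    (gamma : config R X) : prod_topology (fun _ : cc_fun R X => R) :=
  fun f => \int[cmeas gamma]_x f x.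

Section ConfigStructures.
Variables (R : realType) (X : ptopologicalType).

Lemma mzero_integer (A : set (borel X)) : measurable A ->
  (exists k : nat, @mzero _ (borel X) R A = k%:R%:E) \/
  @mzero _ (borel X) R A = +oo%E.
Proof. by left; exists 0%N. Qed.

Lemma mzero_compact (K : set X) : compact K ->
  (@mzero _ (borel X) R K < +oo)%E.
Proof. by rewrite /mzero ltry. Qed.

Lemma mzero_regular (A : set (borel X)) : measurable A ->
  @mzero _ (borel X) R A =
  ereal_sup [set @mzero _ (borel X) R K |
             K in [set K : set X | compact K /\ K `<=` A]].
Proof.
move=> _; rewrite /mzero.
rewrite (_ : [set _ | _ in _] = [set 0%E]) ?ereal_sup1//.
apply/seteqP; split=> [_ [K _ <-]//|_ ->]; exists set0 => //.
by split; [exact: compact0|exact: sub0set].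
Qed.

HB.instance Definition _ := gen_eqMixin (config R X).
HB.instance Definition _ := gen_choiceMixin (config R X).
HB.instance Definition _ := isPointed.Build (config R X)
  (Config mzero_integer mzero_compact mzero_regular).
HB.instance Definition _ :=
  Topological.copy (config R X) (initial_topology (@vague_eval R X)).

(* [psi^* gamma := gamma \o psi^-1], for a homeomorphism [psi]. *)
Section Pushforward.
Variables (gamma : config R X) (psi : homeo X).

Lemma homeo_measurable :
  measurable_fun [set: borel X] (psi : borel X -> borel X).
Proof.
apply: (@measurability _ _ (borel X) (borel X) setT _ (@open X) erefl).
move=> _ [U oU <-].
rewrite setTI; apply: sub_sigma_algebra.
by move: oU; apply/(continuousP psi).1; exact: hmap_continuous.
Qed.

Definition homeo_push : set (borel X) -> \bar R :=
  pushforward gamma (psi : borel X -> borel X).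

Lemma homeo_push0 : homeo_push set0 = 0%E.
Proof. by rewrite /homeo_push /pushforward preimage_set0 measure0. Qed.

Lemma homeo_push_ge0 (A : set (borel X)) : (0 <= homeo_push A)%E.
Proof. by rewrite /homeo_push /pushforward measure_ge0. Qed.

Lemma homeo_preimage_measurable (A : set (borel X)) :
  measurable A -> measurable (psi @^-1` A : set (borel X)).
Proof.
by move=> mA; rewrite -[X in measurable X]setTI; exact: homeo_measurable.
Qed.

Lemma homeo_push_sigma_additive : semi_sigma_additive homeo_push.
Proof.
move=> F mF tF mUF; rewrite /homeo_push /pushforward preimage_bigcup.
apply: measure_semi_sigma_additive.
- by move=> n; exact: homeo_preimage_measurable.
- apply/trivIsetP => /= i j _ _ ij; rewrite -preimage_setI.
  by move/trivIsetP : tF => /(_ _ _ _ _ ij) ->//; rewrite preimage_set0.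
- by rewrite -preimage_bigcup; exact: homeo_preimage_measurable.
Qed.

HB.instance Definition _ := isMeasure.Build _ _ _ homeo_push
  homeo_push0 homeo_push_ge0 homeo_push_sigma_additive.

Lemma homeo_push_integer (A : set (borel X)) : measurable A ->
  (exists k : nat, homeo_push A = k%:R%:E) \/ homeo_push A = +oo%E.
Proof. by move=> mA; have := cmeas_integer gamma (homeo_preimage_measurable mA). Qed.

Lemma homeo_preimageE (A : set X) : psi @^-1` A = hinv psi @` A.
Proof.
apply/seteqP; split=> [x Ax|_ [x Ax <-]]; last by rewrite /preimage /= hinvK.
by exists (psi x) => //; rewrite hmapK.
Qed.

Lemma homeo_preimage_compact (K : set X) : compact K -> compact (psi @^-1` K).
Proof.
move=> cK; rewrite homeo_preimageE; apply: continuous_compact => //.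
by apply: continuous_subspaceT; exact: hinv_continuous.
Qed.

Lemma homeo_image_compact (K : set X) : compact K -> compact (psi @` K).
Proof.
move=> cK; apply: continuous_compact => //.
by apply: continuous_subspaceT; exact: hmap_continuous.
Qed.

Lemma homeo_push_compact (K : set X) : compact K -> (homeo_push K < +oo)%E.
Proof. by move=> cK; have := cmeas_compact gamma (homeo_preimage_compact cK). Qed.

Lemma homeo_push_regular (A : set (borel X)) : measurable A ->
  homeo_push A = ereal_sup [set homeo_push K |
                            K in [set K : set X | compact K /\ K `<=` A]].
Proof.
move=> mA; rewrite {1}/homeo_push /pushforward.
rewrite cmeas_regular; last exact: homeo_preimage_measurable.
congr ereal_sup; apply/seteqP; split=> _ [K [cK KA] <-].
- exists (psi @` K).
    by split; [exact: homeo_image_compact|move=> _ [x /KA Ax <-]].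
  rewrite /homeo_push /pushforward homeo_preimageE; congr (gamma _).
  apply/seteqP; split=> [_ [_ [x Kx <-] <-]|x Kx]; first by rewrite hmapK.
  by exists (psi x); [exists x|rewrite hmapK].
- exists (psi @^-1` K) => //.
  by split; [exact: homeo_preimage_compact|move=> x /KA].
Qed.

Definition conf_push : config R X :=
  Config homeo_push_integer homeo_push_compact homeo_push_regular.

End Pushforward.

End ConfigStructures.

(* Main.v *)
Require Import Defs.
From HB Require Import structures.
From mathcomp Require Import all_boot all_order all_algebra.
From mathcomp Require Import all_classical all_reals all_analysis.
From mathcomp Require Import measurable_realfun ring lra.
Import Order.TTheory GRing.Theory Num.Theory.
Import numFieldNormedType.Exports.
Local Open Scope classical_set_scope.
Local Open Scope ring_scope.

Set Implicit Arguments.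
Unset Strict Implicit.
Unset Printing Implicit Defensive.

(** Suppose that a non-empty open set [U] is null, and let [Z] be the set of
    configurations that have a null open neighbourhood. By quasi-invariance, [Z]
    contains a configuration as soon as it contains its image under the flow of a
    compactly supported vector field. A configuration with unit atoms is nothing
    but a locally finite set of points, and almost every configuration is of this
    kind. It suffices to show that flows can move the points of such a
    configuration, provided that it has the right number of them, so that it enters
    [U], which is contained in [Z]. Then all these configurations lie in [Z].
    Countably many null open sets cover the configurations with unit atoms in [Z]
    ([countable_network], [negligible_simple]). So the set of configurations with
    the given total mass, respectively with at least that total mass, is null,
    which contradicts the assumption on [mu].

    The set [U] contains all configurations whose integrals against finitely many
    test functions are close to those of some [gamma0] in [U]. The test functions
    live on a compact set [K], in which [gamma0] has finitely many atoms; let [N] be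
    their number with multiplicity. A configuration with unit atoms enters [U] if
    [N] of its points are placed at distinct places close to these atoms and the
    others outside [K] ([approximate_config]). In the compact case [K] may be taken
    to be all of the manifold, and the mass [N] leaves no other points.

    The moves come from flows inside one chart. In a box, take a bump function times
    a coordinate field, where the bump is a product of one-dimensional ones: the
    flow moves a single coordinate and reduces to a flow on an interval, whose
    travel time is given in closed form ([flow1], [box_flow], [box_move]). As the box
    can avoid the other points of the configuration, membership in [Z] is a locally
    constant function of one point while the others are kept fixed
    ([all_in_local]). Hence a point can be moved along any connected set which
    avoids the others ([all_in_connected]). In dimension at least two the complement
    of a locally finite set is connected, and points can be moved one after the
    other to any places ([exchange_higher]). On the line, points keep their order,
    and two finite sets of the same size in an interval that is free of other points
    are matched increasingly ([exchange_line]). A connected manifold of dimension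
    zero is a point, on which no configuration with unit atoms has mass 2. *)

(** * Functions of class C^k *)

Section CkCalculus.
Context {R : realType}.
Implicit Types (n k : nat).

Lemma near_open n (U : set 'rV[R]_n) x (P : 'rV[R]_n -> Prop) :
  open U -> U x -> (forall y, U y -> P y) -> \forall y \near x, P y.
Proof. by move=> oU Ux UP; apply: filterS (open_nbhs_nbhs (conj oU Ux)). Qed.

Lemma near_eq_continuous (T T' : topologicalType) (f h : T -> T') x :
  {near x, f =1 h} -> {for x, continuous f} -> {for x, continuous h}.
Proof.
move=> fh cf; rewrite /prop_for /continuous_at -(nbhs_singleton fh).
by apply: cvg_trans cf; exact: near_eq_cvg.
Qed.

Lemma Ck_on_continuous n k (U : set 'rV[R]_n) f :
  Ck_on k U f -> forall x, U x -> {for x, continuous f}.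
Proof. by case: k => [|k] []. Qed.

Lemma Ck_on_ext n k (U : set 'rV[R]_n) f h : open U ->
  (forall x, U x -> f x = h x) -> Ck_on k U f -> Ck_on k U h.
Proof.
move=> oU; elim: k f h => [|k IH] f h fh [cf Cf]; split.
- by move=> x Ux; apply: near_eq_continuous (cf x Ux); exact: near_open fh.
- by [].
- by move=> x Ux; apply: near_eq_continuous (cf x Ux); exact: near_open fh.
- move=> i; have [df Df] := Cf i; split=> [x Ux|].
    by apply: near_eq_derivable (df x Ux); exact: near_open fh.
  apply: IH Df => x Ux; apply: near_eq_derive; exact: near_open fh.
Qed.

(** Used to glue the expression of a vector field near its support with zero
    elsewhere. *)
Lemma Ck_on_local n k (U : set 'rV[R]_n) f :
  (forall x, U x -> exists W, [/\ open W, W x & Ck_on k W f]) -> Ck_on k U f.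
Proof.
elim: k f => [|k IH] f Uf; split=> //.
- by move=> x /Uf[W [_ Wx]] /Ck_on_continuous; exact.
- by move=> x /Uf[W [_ Wx]] /Ck_on_continuous; exact.
- move=> i; split; first by move=> x /Uf[W [_ Wx [_ /(_ i)[+ _]]]]; exact.
  apply: IH => x /Uf[W [oW Wx [_ /(_ i)[_ ?]]]]; by exists W.
Qed.

Lemma Ck_onS n k (U : set 'rV[R]_n) f : Ck_on k.+1 U f -> Ck_on k U f.
Proof.
elim: k f => [|k IH] f; first by case.
move=> [cf Cf]; split=> // i; have [df Dh] := Cf i; split=> //; exact: IH.
Qed.

Lemma Ck_on_cst n k (U : set 'rV[R]_n) (a : R) : Ck_on k U (fun=> a).
Proof.
elim: k a => [|k IH] a; split=> //; try by move=> x _; exact: cst_continuous.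
move=> i; split; first by move=> x _; exact: (@derivable_cst R _ R^o a x).
have -> : (fun x : 'rV[R]_n => 'D_(delta_mx 0 i) (fun=> a) x) = (fun=> 0).
  by apply/funext => x; exact: (@derive_cst R _ R^o a x).
exact: IH.
Qed.

Lemma Ck_onD n k (U : set 'rV[R]_n) f h : open U ->
  Ck_on k U f -> Ck_on k U h -> Ck_on k U (fun x => f x + h x).
Proof.
move=> oU; elim: k f h => [|k IH] f h [cf Cf] [ch Ch]; split=> //.
- by move=> x Ux; exact: cvgD (cf x Ux) (ch x Ux).
- by move=> x Ux; exact: cvgD (cf x Ux) (ch x Ux).
- move=> i; have [df Df] := Cf i; have [dh Dh] := Ch i; split.
    by move=> x Ux; exact: derivableD (df x Ux) (dh x Ux).
  apply: Ck_on_ext (IH _ _ Df Dh) => // x Ux.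
  by rewrite -deriveD; [|exact: df|exact: dh].
Qed.

Lemma Ck_onM n k (U : set 'rV[R]_n) f h : open U ->
  Ck_on k U f -> Ck_on k U h -> Ck_on k U (fun x => f x * h x).
Proof.
move=> oU; elim: k f h => [|k IH] f h Hf Hh; split=> //.
- by move=> x Ux; exact: cvgM (Ck_on_continuous Hf Ux) (Ck_on_continuous Hh Ux).
- by move=> x Ux; exact: cvgM (Ck_on_continuous Hf Ux) (Ck_on_continuous Hh Ux).
- move: (Hf) (Hh) => [cf Cf] [ch Ch].
  move=> i; have [df Df] := Cf i; have [dh Dh] := Ch i; split.
    by move=> x Ux; exact: derivableM (df x Ux) (dh x Ux).
  have := Ck_onD oU (IH _ _ (Ck_onS Hf) Dh) (IH _ _ (Ck_onS Hh) Df).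
  apply: Ck_on_ext => // x Ux.
  by have -> := deriveM (df x Ux) (dh x Ux).
Qed.

Lemma Ck_on_sum n k (U : set 'rV[R]_n) (I : Type) (s : seq I) (F : I -> 'rV[R]_n -> R) :
  open U -> (forall i, Ck_on k U (F i)) -> Ck_on k U (fun x => \sum_(i <- s) F i x).
Proof.
move=> oU HF; elim: s => [|i s IH].
  by apply: Ck_on_ext (Ck_on_cst k U 0) => // x _; rewrite big_nil.
by apply: Ck_on_ext (Ck_onD oU (HF i) IH) => // x _; rewrite big_cons.
Qed.

Lemma Ck_on_prod n k (U : set 'rV[R]_n) (I : Type) (s : seq I) (P : pred I)
    (F : I -> 'rV[R]_n -> R) :
  open U -> (forall i, Ck_on k U (F i)) ->
  Ck_on k U (fun x => \prod_(i <- s | P i) F i x).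
Proof.
move=> oU HF; elim: s => [|i s IH].
  by apply: Ck_on_ext (Ck_on_cst k U 1) => // x _; rewrite big_nil.
case Pi : (P i).
  by apply: Ck_on_ext (Ck_onM oU (HF i) IH) => // x _; rewrite big_cons Pi.
by apply: Ck_on_ext IH => // x _; rewrite big_cons Pi.
Qed.

Lemma Ck_onV n k (U : set 'rV[R]_n) f : open U -> (forall x, U x -> f x != 0) ->
  Ck_on k U f -> Ck_on k U (fun x => (f x)^-1).
Proof.
move=> oU f0; elim: k => [|k IH] Hf; split=> //.
- by move=> x Ux; exact: cvgV (f0 x Ux) (Ck_on_continuous Hf Ux).
- by move=> x Ux; exact: cvgV (f0 x Ux) (Ck_on_continuous Hf Ux).
- move: (Hf) => [cf Cf] i; have [df Df] := Cf i; split.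
    by move=> x Ux; apply: derivableV; [exact: f0|exact: df].
  have HV := IH (Ck_onS Hf).
  have := Ck_onM oU (Ck_on_cst k U (-1)) (Ck_onM oU (Ck_onM oU HV HV) Df).
  apply: Ck_on_ext => // x Ux.
  have -> := deriveV (f0 x Ux) (df x Ux).
  by rewrite mulN1r -exprVn expr2 /GRing.scale/= mulNr.
Qed.

Lemma Ck_on_coord n k (U : set 'rV[R]_n) j : Ck_on k U (fun x => x 0 j).
Proof.
case: k => [|k]; split=> //; try by move=> x _; exact: coord_continuous.
move=> i; split.
  by move=> x _; apply: diff_derivable; exact: differentiable_coord.
have -> : (fun x : 'rV[R]_n => 'D_(delta_mx 0 i) (fun y : 'rV[R]_n => y 0 j) x) =
          (fun=> (delta_mx 0 i : 'rV[R]_n) 0 j).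
  apply/funext => x.
  have d := @derivable_id _ _ x (delta_mx 0 i : 'rV[R]_n).
  by have := derive_mx d; rewrite derive_id => /matrixP/(_ 0 j); rewrite [RHS]mxE.
exact: Ck_on_cst.
Qed.

End CkCalculus.

(** * Total differentials *)

Section TotalDifferential.
Context {R : realType}.

(** The differential is a chosen linear map; any continuous linear map that
    satisfies the expansion shows that the choice is possible. *)
Lemma differentiable_expansion (V W : normedModType R) (f : V -> W)
    (df : {linear V -> W}) x : continuous df ->
  (forall e, 0 < e ->
    \forall h \near (0 : V), `|f (h + x) - f x - df h| <= e * `|h|) ->
  differentiable f x.
Proof.
move=> cdf fdf.
have fE : f = cst (f x) + (df \o center x) +o_ (nbhs x) (center x).
  apply/eqaddoP => e e0; rewrite [\forall x \near _, _ <= _](near_shift 0)/= subr0; near=> h.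
  rewrite /= -![(_ + _ : _ -> _) _]/(_ + _) -![(- _ : _ -> _) _]/(- _)/=.
  rewrite opprD addrA /comp !addrK; near: h; exact: fdf.
apply/diffP => /=.
apply: (@getPex _ (fun (df : {linear V -> W}) => continuous df /\
  forall y, f y = f (lim (nbhs x)) + df (y - lim (nbhs x))
                  +o_(y \near x) (y - lim (nbhs x)))).
exists df; split=> // z; rewrite lim_id//.
by move: fE; rewrite funeqE => /(_ z).
Unshelve. all: by end_near. Qed.

Lemma is_derive_line (V W : normedModType R) (f : V -> W) (z v : V) (s : R) :
  derivable f (z + s *: v) v ->
  is_derive s 1 (fun r : R => f (z + r *: v)) ('D_v f (z + s *: v)).
Proof.
have E : (fun h : R => h^-1 *: (((fun r : R => f (z + r *: v)) \o shift s) (h *: (1:R)) -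
            f (z + s *: v))) =
         (fun h => h^-1 *: ((f \o shift (z + s *: v)) (h *: v) - f (z + s *: v))).
  apply/funext => h /=; congr (_ *: (f _ - _)).
  by rewrite scalerDl addrCA /GRing.scale/= mulr1.
by move=> df; split; rewrite /derivable /derive E.
Qed.

Lemma mvt_sym (h dh : R -> R) (b : R) :
  (forall s : R, `|s| <= `|b| -> is_derive s (1 : R) h (dh s)) ->
  exists2 c, `|c| <= `|b| & h b - h 0 = dh c * b.
Proof.
move=> H; have C s : `|s| <= `|b| -> {for s, continuous h}.
  move=> /H[ds _]; apply: differentiable_continuous.
  exact/derivable1_diffP.
have W (i : interval R) : (forall s, s \in i -> `|s| <= `|b|) ->
    {within [set` i], continuous h}.
  move=> Hi; apply: continuous_in_subspaceT => s.
  by rewrite inE /= => /Hi; exact: C.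
have [b0|b0|<-] := ltgtP 0 b; last first.
- by exists 0; rewrite ?normr0// subrr mulr0.
- have I s : s \in `[b, 0]%R -> `|s| <= `|b|.
    by rewrite in_itv/= => /andP[bs s0]; rewrite !ler0_norm ?lerN2// ltW.
  have [s sI| |c cI E] := @MVT R h dh b 0 b0.
  + by apply: H; apply: I; exact: subset_itv_oo_cc.
  + exact: W.
  exists c; first by apply: I; exact: subset_itv_oo_cc.
  by apply: oppr_inj; rewrite opprB E sub0r mulrN.
- have I s : s \in `[0, b]%R -> `|s| <= `|b|.
    by rewrite in_itv/= => /andP[s0 sb]; rewrite !ger0_norm// ltW.
  have [s sI| |c cI E] := @MVT R h dh 0 b b0.
  + by apply: H; apply: I; exact: subset_itv_oo_cc.
  + exact: W.
  exists c; first by apply: I; exact: subset_itv_oo_cc.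
  by rewrite E subr0.
Qed.

Lemma rV_normP n (x : 'rV[R]_n) (e : R) : 0 <= e ->
  (`|x| <= e) <-> (forall i, `|x 0 i| <= e).
Proof.
move=> e0; rewrite {1}/Num.norm/= mx_normrE; split.
  by move=> /bigmax_leP[_ H] i; exact: (H (0, i)).
by move=> H; apply/bigmax_leP; split=> // -[i j] _/=; rewrite ord1.
Qed.

Lemma rV_norm_coord n (x : 'rV[R]_n) i : `|x 0 i| <= `|x|.
Proof. by move: i; apply/(rV_normP x (normr_ge0 x)). Qed.

(** The vertices of the broken line from 0 to [h] along the coordinate axes. *)
Definition row_trunc n (h : 'rV[R]_n) (k : nat) : 'rV[R]_n :=
  \row_j (if (j < k)%N then h 0 j else 0).

Lemma row_truncS n (h : 'rV[R]_n) (i : 'I_n) :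
  row_trunc h i.+1 = row_trunc h i + h 0 i *: delta_mx 0 i.
Proof.
apply/rowP => j; rewrite !mxE eqxx/= ltnS.
have [->|ij] := eqVneq j i; first by rewrite leqnn ltnn mulr1 add0r.
by rewrite mulr0 addr0 leq_eqVlt (negbTE (ij : val j != val i)).
Qed.

(** Along the broken line that changes one coordinate at a time, the mean value
    theorem expresses each increment by a partial derivative at a nearby point. *)
Lemma C1_differentiable n (U : set 'rV[R]_n) (f : 'rV[R]_n -> R) x :
  open U -> Ck_on 1 U f -> U x -> differentiable f x.
Proof.
move=> oU [_ Cf] Ux.
pose L (h : 'rV[R]_n) : R := \sum_(i < n) h 0 i * 'D_(delta_mx 0 i) f x.
have Llin : linear L.
  move=> a u v; rewrite /L scaler_sumr -big_split/=; apply: eq_bigr => i _.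
  by rewrite !mxE mulrDl /GRing.scale/= mulrA.
pose Lm := GRing.isLinear.Build _ _ _ _ L Llin.
pose df : {linear 'rV[R]_n -> R} := HB.pack L Lm.
apply: (@differentiable_expansion _ _ f df).
  have CL : Ck_on 0 [set: 'rV[R]_n] L.
    apply: Ck_on_sum openT _ => i.
    exact: Ck_onM openT (Ck_on_coord _ _ _) (Ck_on_cst _ _ _).
  by move=> h; exact: (Ck_on_continuous CL).
move=> e e0.
pose e' := e / n.+1%:R.
have e'0 : 0 < e' by rewrite divr_gt0.
have near_x : \forall y \near x, U y /\
    forall i : 'I_n, `|'D_(delta_mx 0 i) f x - 'D_(delta_mx 0 i) f y| <= e'.
  have nearD : \forall y \near x,
      forall i : 'I_n, `|'D_(delta_mx 0 i) f x - 'D_(delta_mx 0 i) f y| <= e'.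
    apply: (@filter_forall _ 'I_n (fun i y => `|'D_(delta_mx 0 i) f x - 'D_(delta_mx 0 i) f y| <= e') _ (nbhs_filter x)) => i.
    have [_ [cD _]] := Cf i.
    by have /cvgrPdist_le/(_ _ e'0) := cD x Ux.
  by apply: filterI nearD; exact: near_open oU Ux _.
have [d /= d0 dU] := (nbhs_ballP _ _).1 near_x.
near=> h.
have hd : `|h| < d by near: h; exact: cvgr0_norm_lt.
have Utr i (s : R) : `|s| <= `|h 0 i| ->
    U (x + row_trunc h i + s *: delta_mx 0 i) /\
    forall j : 'I_n, `|'D_(delta_mx 0 j) f x -
       'D_(delta_mx 0 j) f (x + row_trunc h i + s *: delta_mx 0 i)| <= e'.
  move=> sh; apply: dU; rewrite -ball_normE/= opprD addrA opprD addNKr -opprD normrN.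
  apply: le_lt_trans hd; apply/rV_normP => // j; rewrite !mxE eqxx/=.
  have [->|ij] := eqVneq j i.
    by rewrite ltnn add0r mulr1 (le_trans sh)// rV_norm_coord.
  rewrite mulr0 addr0; case: ifP => _; last by rewrite normr0.
  exact: rV_norm_coord.
have step (i : 'I_n) : `|f (x + row_trunc h i.+1) - f (x + row_trunc h i) -
    h 0 i * 'D_(delta_mx 0 i) f x| <= e' * `|h|.
  have [s sh|c ch] := @mvt_sym
    (fun s => f (x + row_trunc h i + s *: delta_mx 0 i))
    (fun s => 'D_(delta_mx 0 i) f (x + row_trunc h i + s *: delta_mx 0 i)) (h 0 i).
    apply: is_derive_line.
    by have [+ _] := Cf i; apply; have [] := Utr i s sh.
  rewrite scale0r addr0 -[_ + _ *: _]addrA -row_truncS => ->.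
  rewrite mulrC -mulrBr normrM mulrC ler_pM//; last exact: rV_norm_coord.
  by rewrite distrC; have [_] := Utr i c ch; exact.
have -> : f (h + x) - f x - df h = \sum_(i < n)
    (f (x + row_trunc h i.+1) - f (x + row_trunc h i) -
     h 0 i * 'D_(delta_mx 0 i) f x).
  rewrite sumrB; congr (_ - _).
  rewrite -(big_mkord xpredT (fun i => f (x + row_trunc h i.+1) - f (x + row_trunc h i))).
  rewrite (telescope_sumr (fun i => f (x + row_trunc h i)))//.
  congr (f _ - f _).
    by rewrite addrC; congr (_ + _); apply/rowP => j; rewrite mxE ltn_ord.
  by rewrite -[LHS]addr0; congr (_ + _); apply/rowP => j; rewrite !mxE.
apply: le_trans (ler_norm_sum _ _ _) _.
apply: le_trans (ler_sum _ (fun i _ => step i)) _.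
rewrite sumr_const card_ord -mulr_natl mulrA ler_wpM2r//.
rewrite /e' mulrCA ger_pMr// ler_pdivrMr ?mul1r ?ler_nat//.
Unshelve. all: by end_near. Qed.

End TotalDifferential.

(** * The chain rule *)

Section ChainRule.
Context {R : realType}.

Lemma differentiable_row n m (F : 'rV[R]_n -> 'rV[R]_m) x :
  (forall j, differentiable (fun y => F y 0 j) x) -> differentiable F x.
Proof.
move=> dF.
have -> : F = \sum_(j < m) (fun y => F y 0 j *: (delta_mx 0 j : 'rV[R]_m)).
  by apply/funext => y; rewrite fct_sumE; exact: row_sum_delta.
by apply: differentiable_sum => j; exact: differentiableZl.
Qed.

Lemma C1_map_differentiable n m (U : set 'rV[R]_n) (F : 'rV[R]_n -> 'rV[R]_m) x :
  open U -> (forall j, Ck_on 1 U (fun y => F y 0 j)) -> U x ->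
  differentiable F x.
Proof.
by move=> oU CF Ux; apply: differentiable_row => j; exact: C1_differentiable (CF j) Ux.
Qed.

Lemma derive_comp n (V W : normedModType R) (F : V -> 'rV[R]_n) (f : 'rV[R]_n -> W) x v :
  differentiable F x -> differentiable f (F x) ->
  'D_v (f \o F) x = 'D_('D_v F x) f (F x).
Proof.
move=> dF df; rewrite !deriveE//; last exact: differentiable_comp.
by rewrite diff_comp.
Qed.

Lemma derive_coords n (W : normedModType R) (f : 'rV[R]_n -> W) y v :
  differentiable f y -> 'D_v f y = \sum_j v 0 j *: 'D_(delta_mx 0 j) f y.
Proof.
move=> df; rewrite deriveE// {1}(row_sum_delta v) linear_sum; apply: eq_bigr => j _.
by rewrite linearZ deriveE.
Qed.

Lemma derive_coord (V : normedModType R) n (F : V -> 'rV[R]_n) x v j :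
  derivable F x v -> ('D_v F x) 0 j = 'D_v (fun y => F y 0 j) x.
Proof. by move=> dF; rewrite derive_mx// mxE. Qed.

Lemma Ck_on_C1 n k (U : set 'rV[R]_n) f : Ck_on k.+1 U f -> Ck_on 1 U f.
Proof. by elim: k f => [//|k IH] f Cf; apply: IH; exact: Ck_onS. Qed.

(** Induction on [k]: the partial derivatives of the composite are sums of
    products of functions of class [k], by the chain rule. *)
Lemma Ck_on_comp n m k (U : set 'rV[R]_n) (W : set 'rV[R]_m)
    (F : 'rV[R]_n -> 'rV[R]_m) (f : 'rV[R]_m -> R) :
  open U -> open W -> (forall x, U x -> W (F x)) ->
  (forall j, Ck_on k U (fun x => F x 0 j)) -> Ck_on k W f ->
  Ck_on k U (f \o F).
Proof.
move=> oU oW UW.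
have cont (k' : nat) h : (forall j, Ck_on k' U (fun x => F x 0 j)) -> Ck_on k' W h ->
    forall x, U x -> {for x, continuous (h \o F)}.
  move=> CF Ch x Ux; apply: continuous_comp; last first.
    by apply: (Ck_on_continuous Ch); exact: UW.
  move=> P [Q Qx QP]; apply: (@filterS _ (nbhs x) _ _ _ (fun y => QP (F y))).
  have H i j : \forall y \near x, Q i j (F y i j).
    by have := Qx i j; rewrite (ord1 i); exact: (Ck_on_continuous (CF j) Ux).
  apply: (@filter_forall _ 'I_1 (fun i y => forall j, Q i j (F y i j))
          _ (nbhs_filter x)) => i.
  exact: (@filter_forall _ 'I_m (fun j y => Q i j (F y i j)) _ (nbhs_filter x)) (H i).
elim: k f => [|k IH] f CF Cf; split; try exact: cont Cf.
  by [].
have dF x : U x -> differentiable F x.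
  by apply: C1_map_differentiable => // j; exact: Ck_on_C1 (CF j).
have df y : W y -> differentiable f y.
  by apply: C1_differentiable => //; exact: Ck_on_C1 Cf.
move=> i; split=> [x Ux|].
  apply: diff_derivable; apply: differentiable_comp; first exact: dF.
  by apply: df; exact: UW.
apply: (@Ck_on_ext _ _ _ _ (fun x => \sum_j 'D_(delta_mx 0 i) (fun y => F y 0 j) x *
                                  'D_(delta_mx 0 j) f (F x))) => //.
  move=> x Ux; rewrite derive_comp; [|exact: dF|by apply: df; exact: UW].
  rewrite derive_coords; last by apply: df; exact: UW.
  apply: eq_bigr => j _; rewrite derive_coord//.
  by apply: diff_derivable; exact: dF.
apply: Ck_on_sum => // j; apply: Ck_onM => //.
  by have [_ /(_ i)[]] := CF j.
apply: (IH ('D_(delta_mx 0 j) f)); first by move=> l; exact: Ck_onS.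
by have [_ /(_ j)[]] := Cf.
Qed.

Lemma smooth_on_derive n (U : set 'rV[R]_n) f i :
  smooth_on U f -> smooth_on U ('D_(delta_mx 0 i) f).
Proof. by move=> Sf k; have [_ /(_ i)[]] := Sf k.+1. Qed.

End ChainRule.

(** * Flat functions *)

Section FlatFunctions.
Context {R : realType}.
Implicit Types (s : R) (m : nat).

(** The functions [s ^- m * exp (- 1 / s)], extended by zero. Every derivative of
    one of them is a combination of others, which makes the induction on the order
    of smoothness possible. *)
Definition flat m s : R := if 0 < s then s^-1 ^+ m * expR (- s^-1) else 0.

Lemma flat_gt0 m s : 0 < s -> 0 < flat m s.
Proof. by rewrite /flat => s0; rewrite s0 mulr_gt0// ?expR_gt0// exprn_gt0// invr_gt0. Qed.

Lemma flat_le0 m s : s <= 0 -> flat m s = 0.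
Proof. by rewrite /flat leNgt => /negbTE ->. Qed.

Lemma flat_ge0 m s : 0 <= flat m s.
Proof. by have [/flat_le0->//|/flat_gt0/ltW] := leP s 0; exact. Qed.

(** The exponential of [1 / s] dominates the term of degree [m.+1] of its series. *)
Lemma flat_bound m s : flat m s <= m.+1`!%:R * `|s|.
Proof.
have [s0|s0] := leP s 0; first by rewrite flat_le0// mulr_ge0.
rewrite /flat s0 gtr0_norm// expRN.
have u0 : 0 < s^-1 by rewrite invr_gt0.
have le_e := expR_ge1Dxn m (ltW u0).
have f0 : 0 < m.+1`!%:R :> R by rewrite ltr0n fact_gt0.
have {}le_e : s^-1 ^+ m.+1 / m.+1`!%:R <= expR s^-1 by apply: le_trans le_e; rewrite lerDr.
rewrite ler_pdivrMr ?expR_gt0// mulrAC -ler_pdivrMr// -ler_pdivrMl//.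
by apply: le_trans le_e; rewrite exprSr mulrC.
Qed.

Lemma flatS m s : s^-1 * flat m s = flat m.+1 s.
Proof. by rewrite /flat; case: ifP => _; rewrite ?mulr0// exprS mulrA. Qed.

(** At the origin the difference quotient of each flat function is the next one,
    which tends to zero; this is what makes the extension by zero smooth. *)
Lemma is_derive_flat m s :
  is_derive s 1 (flat m) (- m%:R * flat m.+1 s + flat m.+2 s).
Proof.
have [s0|s0|->] := ltgtP s 0; last first.
- rewrite !flat_le0// mulr0 addr0.
  have H : (h^-1 *: ((flat m \o shift (0 : R)) (h *: (1 : R)) - flat m 0)) @[h --> (0 : R)^'] --> (0 : R).
    apply/cvgrPdist_le => e e0; near=> h.
    rewrite /= addr0 /GRing.scale/= mulr1 (@flat_le0 m 0)// subr0 sub0r normrN.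
    rewrite flatS ger0_norm ?flat_ge0//; apply: le_trans (flat_bound _ _) _.
    rewrite -ler_pdivlMl ?ltr0n ?fact_gt0//; apply: ltW.
    by near: h; apply: dnbhs0_lt; rewrite mulr_gt0// invr_gt0 ltr0n fact_gt0.
  by split; [apply/cvg_ex; exists 0|apply/cvg_lim].
- have dV : is_derive s 1 (fun r : R => r^-1) (- s ^- 2).
    have := @is_deriveV R id s 1 1; rewrite /GRing.scale/= mulr1; apply.
    by rewrite gt_eqF.
  have dE : is_derive s 1 (fun r : R => expR (- r^-1)) (expR (- s^-1) * s ^- 2).
    rewrite -[s ^- 2]opprK.
    have dN : is_derive s 1 (fun r : R => - r^-1) (- - s ^- 2) by exact: is_deriveN.
    exact: (@is_derive1_comp _ expR (fun r => - r^-1) s _ _ (is_derive_expR _) dN).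
  have dX : is_derive s 1 (fun r : R => r^-1 ^+ m) (m%:R * s^-1 ^+ m.-1 * - s ^- 2).
    have -> : (fun r : R => r^-1 ^+ m) = (fun r : R => r^-1) ^+ m.
      by apply/funext => r; rewrite exprfctE.
    exact: is_deriveX.
  have := @is_deriveM _ _ _ _ s 1 _ _ dX dE.
  rewrite /GRing.scale/= => H.
  apply: (near_eq_is_derive (f := fun r : R => r^-1 ^+ m * expR (- r^-1))).
    near=> r; rewrite /flat ifT//; near: r; exact: lt_nbhsr.
  apply: (is_derive_eq H).
  rewrite /flat s0 -!exprVn; case: (m) => [|k]; rewrite /= ?expr0 ?expr1.
    by rewrite !mul0r !mulr0 oppr0 mul0r add0r addr0; ring.
  by rewrite !exprS expr0; ring.
- rewrite !flat_le0 ?ltW// mulr0 addr0.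
  apply: (near_eq_is_derive (f := cst (0 : R))).
  near=> r; rewrite flat_le0//; apply: ltW; near: r; exact: lt_nbhsl.
Unshelve. all: by end_near. Qed.

Lemma flat_continuous m : continuous (flat m).
Proof.
move=> s; apply: differentiable_continuous; apply/derivable1_diffP.
by have [] := is_derive_flat m s.
Qed.

Lemma derive_comp1 (V : normedModType R) (f : R -> R) (l : V -> R) x v df :
  differentiable l x -> is_derive (l x) 1 f df ->
  derivable (f \o l) x v /\ 'D_v (f \o l) x = 'D_v l x * df.
Proof.
move=> dl [/[dup] fd /derivable1_diffP dif <-].
split; first by apply: diff_derivable; exact: differentiable_comp.
rewrite (deriveE v (differentiable_comp dl dif)) (diff_comp dl dif) (deriveE v dl) -(derive1E f).
exact: (congr1 (fun h => h ('d l x v)) (deriv1E fd)).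
Qed.

(** The induction on [k] is uniform in [m], as the derivative of [flat m] involves
    [flat m.+1] and [flat m.+2]. *)
Lemma Ck_on_flat n k (U : set 'rV[R]_n) l m : open U -> Ck_on k U l ->
  Ck_on k U (fun x => flat m (l x)).
Proof.
move=> oU; elim: k m => [|k IH] m Cl; split=> //.
- move=> x Ux; apply: continuous_comp; first exact: (Ck_on_continuous Cl).
  exact: flat_continuous.
- move=> x Ux; apply: continuous_comp; first exact: (Ck_on_continuous Cl).
  exact: flat_continuous.
move=> i.
have dl x : U x -> differentiable l x.
  by apply: C1_differentiable => //; exact: Ck_on_C1 Cl.
split; first by move=> x Ux; have [] := derive_comp1 (delta_mx 0 i) (dl x Ux) (is_derive_flat m (l x)).
apply: (@Ck_on_ext _ _ _ _ (fun x => 'D_(delta_mx 0 i) l x *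
   (- m%:R * flat m.+1 (l x) + flat m.+2 (l x)))) => //.
  by move=> x Ux; have [_ ->] := derive_comp1 (delta_mx 0 i) (dl x Ux) (is_derive_flat m (l x)).
apply: Ck_onM => //; first by have [_ /(_ i)[]] := Cl.
apply: Ck_onD => //; last by apply: IH; exact: Ck_onS.
apply: Ck_onM => //; first exact: Ck_on_cst.
by apply: IH; exact: Ck_onS.
Qed.

End FlatFunctions.

(** * An explicit flow on the line *)

Section OneDimensionalFlow.
Context {R : realType}.
Implicit Types (s t u : R).

Definition ramp s : R := s ^+ 2 * flat 0 s.

(** With [ramp s = s ^+ 2 * exp (- 1 / s)], this is the reciprocal of the
    derivative of [travel_time] on the interval from -1 to 1; written in this form
    it visibly extends by zero to a smooth function on the line. *)
Definition bump s : R := ramp (1 - s) * ramp (1 + s) / (ramp (1 - s) + ramp (1 + s)).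

(** The time needed to get from 0 to [s] at speed [bump]. It tends to infinity at
    both ends of the interval, so the motion never reaches them and the flow is
    complete. *)
Definition travel_time s : R := expR (1 - s)^-1 - expR (1 + s)^-1.

Definition travel_time_inv u : R :=
  get [set s | `|s| < 1 /\ travel_time s = u].

Definition flow1 t s : R :=
  if `|s| < 1 then travel_time_inv (travel_time s + t) else s.

Lemma ramp_ge0 s : 0 <= ramp s.
Proof. by rewrite mulr_ge0 ?flat_ge0// sqr_ge0. Qed.

Lemma ramp_gt0 s : 0 < s -> 0 < ramp s.
Proof. by move=> s0; rewrite mulr_gt0 ?flat_gt0// exprn_gt0. Qed.

Lemma ramp_le0 s : s <= 0 -> ramp s = 0.
Proof. by move=> s0; rewrite /ramp flat_le0// mulr0. Qed.

Lemma ramp_sum_gt0 s : 0 < ramp (1 - s) + ramp (1 + s).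
Proof.
have [s0|s0] := leP 0 s.
- by rewrite ltr_wpDl ?ramp_ge0// ramp_gt0//; lra.
- by rewrite ltr_wpDr ?ramp_ge0// ramp_gt0//; lra.
Qed.

Lemma bump_gt0 s : `|s| < 1 -> 0 < bump s.
Proof.
rewrite ltr_norml => /andP[s1 s2].
by rewrite divr_gt0 ?ramp_sum_gt0// mulr_gt0// ramp_gt0//; lra.
Qed.

Lemma bump_out s : 1 <= `|s| -> bump s = 0.
Proof.
rewrite ler_normr => /orP[s1|s1].
- by rewrite /bump ramp_le0 ?mul0r//; lra.
- by rewrite /bump (@ramp_le0 (1 + s)) ?mulr0 ?mul0r//; lra.
Qed.

Lemma Ck_on_bump n k (U : set 'rV[R]_n) l : open U -> Ck_on k U l ->
  Ck_on k U (fun x => bump (l x)).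
Proof.
move=> oU Cl.
have Cramp h : Ck_on k U h -> Ck_on k U (fun x => ramp (h x)).
  move=> Ch; apply: Ck_onM => //; last exact: Ck_on_flat.
  by apply: (Ck_on_ext oU _ (Ck_onM oU Ch Ch)) => x _; rewrite expr2.
have C1 := Cramp _ (Ck_onD oU (Ck_on_cst k U 1) (Ck_onM oU (Ck_on_cst k U (-1)) Cl)).
have C2 := Cramp _ (Ck_onD oU (Ck_on_cst k U 1) Cl).
have C3 : Ck_on k U (fun x => ramp (1 - l x)).
  by apply: (Ck_on_ext oU _ C1) => x _; rewrite mulN1r.
apply: Ck_onM => //; first exact: Ck_onM.
apply: Ck_onV => //; last exact: Ck_onD.
by move=> x _; rewrite gt_eqF// ramp_sum_gt0.
Qed.

Lemma travel_timeN s : travel_time (- s) = - travel_time s.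
Proof. by rewrite /travel_time opprK opprB. Qed.

Lemma travel_time_lt : {in [pred s | `|s| < 1] &, {homo travel_time : s s' / s < s'}}.
Proof.
move=> s s'; rewrite !inE !ltr_norml => /andP[a1 a2] /andP[b1 b2] ss.
rewrite /travel_time ltrD// ?ltrN2 ltr_expR ltf_pV2 ?posrE; lra.
Qed.

Lemma travel_time_inj s s' : `|s| < 1 -> `|s'| < 1 ->
  travel_time s = travel_time s' -> s = s'.
Proof.
move=> s1 s'1 E; case: (ltgtP s s') => // ss.
- by have := travel_time_lt s1 s'1 ss; rewrite E ltxx.
- by have := travel_time_lt s'1 s1 ss; rewrite E ltxx.
Qed.

Lemma is_derive_travel_time s : `|s| < 1 -> is_derive s 1 travel_time (bump s)^-1.
Proof.
rewrite ltr_norml => /andP[s1 s2].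
have a0 : 1 - s != 0 by lra.
have b0 : 1 + s != 0 by lra.
have dA : is_derive s 1 (fun r : R => 1 - r) (- 1).
  by apply: (is_derive_eq (is_deriveB _ _)); rewrite ?sub0r.
have dB : is_derive s 1 (fun r : R => 1 + r) 1.
  by apply: (is_derive_eq (is_deriveD _ _)); rewrite ?add0r.
have dA' := @is_deriveV R (fun r : R => 1 - r) s (-1) 1 a0 dA.
have dB' := @is_deriveV R (fun r : R => 1 + r) s 1 1 b0 dB.
have dEA := @is_derive1_comp _ expR (fun r => (1 - r)^-1) s _ _ (is_derive_expR _) dA'.
have dEB := @is_derive1_comp _ expR (fun r => (1 + r)^-1) s _ _ (is_derive_expR _) dB'.
apply: (is_derive_eq (is_deriveB dEA dEB)).
rewrite /bump /ramp /flat /GRing.scale/= (_ : 0 < 1 - s); last lra.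
rewrite (_ : 0 < 1 + s); last lra.
rewrite !expr0 !mul1r !expRN.
have := expR_gt0 (1 - s)^-1; have := expR_gt0 (1 + s)^-1.
move: (expR _) (expR _) => B A B0 A0.
field; rewrite a0 b0 !gt_eqF//=.
by rewrite addr_gt0// mulr_gt0// exprn_gt0//; lra.
Qed.

Lemma travel_time_continuous s : `|s| < 1 -> {for s, continuous travel_time}.
Proof.
move=> /is_derive_travel_time[ds _]; apply: differentiable_continuous.
exact/derivable1_diffP.
Qed.

(** On the right half, [travel_time s] is at least [1 / (1 - s) + 1 - e], hence takes
    every nonnegative value; the left half follows since the function is odd. *)
Lemma travel_time_surj u : exists s, `|s| < 1 /\ travel_time s = u.
Proof.
wlog u0 : u / 0 <= u.
  move=> H; have [/H//|u0] := leP 0 u.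
  have [|s [s1 su]] := H (- u); first by rewrite oppr_ge0 ltW.
  by exists (- s); rewrite normrN travel_timeN su opprK.
pose w := u + expR 1.
have w1 : 1 < w by rewrite ltr_wpDl// expR_gt1.
have w0 : 0 < w by apply: lt_trans w1.
pose s1 := 1 - w^-1.
have s10 : 0 <= s1 by rewrite subr_ge0 invf_le1// ltW.
have s11 : s1 < 1 by rewrite ltrBlDr ltrDl invr_gt0.
have ts1 : u <= travel_time s1.
  have le_w : 1 + w <= expR (1 - s1)^-1 by rewrite /s1 subKr invrK expR_ge1Dx.
  have le_e : expR (1 + s1)^-1 <= expR 1 by rewrite ler_expR invf_le1; lra.
  by rewrite /travel_time; rewrite /w in le_w; lra.
have [||s sI ts] := @IVT R travel_time 0 s1 u s10.
- apply: continuous_in_subspaceT => s; rewrite inE/= in_itv/= => /andP[sa sb].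
  by apply: travel_time_continuous; rewrite ger0_norm// (le_lt_trans sb).
- have -> : travel_time 0 = 0 by rewrite /travel_time subr0 addr0 subrr.
  by rewrite ge_min u0 le_max ts1 orbT.
- exists s; split=> //; move: sI; rewrite in_itv/= => /andP[sa sb].
  by rewrite ger0_norm// (le_lt_trans sb).
Qed.

Lemma travel_time_invP u :
  `|travel_time_inv u| < 1 /\ travel_time (travel_time_inv u) = u.
Proof.
exact: (@getPex _ [set s | `|s| < 1 /\ travel_time s = u] (travel_time_surj u)).
Qed.

Lemma travel_timeK s : `|s| < 1 -> travel_time_inv (travel_time s) = s.
Proof. by move=> s1; have [? ?] := travel_time_invP (travel_time s); apply: travel_time_inj. Qed.

Lemma norm_lt1_near s : `|s| < 1 -> \forall r \near s, `|r| < 1.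
Proof. by move=> s1; apply: (@cvgr_lt _ _ (nbhs s) _ Num.norm `|s|) => //; exact: norm_continuous. Qed.

Lemma is_derive_travel_time_inv u :
  is_derive u 1 travel_time_inv (bump (travel_time_inv u)).
Proof.
have [s1 su] := travel_time_invP u.
rewrite -[bump _]invrK -[in is_derive _]su.
apply: (@is_derive_inverse _ travel_time).
- by near=> r; apply: travel_timeK; near: r; exact: norm_lt1_near.
- by near=> r; apply: travel_time_continuous; near: r; exact: norm_lt1_near.
- exact: is_derive_travel_time.
- by rewrite invr_neq0// gt_eqF// bump_gt0.
Unshelve. all: by end_near. Qed.

Lemma flow1_in t s : `|s| < 1 -> `|flow1 t s| < 1.
Proof. by rewrite /flow1 => s1; rewrite s1; have [] := travel_time_invP (travel_time s + t). Qed.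

Lemma flow1_out t s : 1 <= `|s| -> flow1 t s = s.
Proof. by rewrite /flow1 leNgt => /negbTE ->. Qed.

Lemma flow1_0 s : flow1 0 s = s.
Proof. by rewrite /flow1; case: ifP => // s1; rewrite addr0 travel_timeK. Qed.

Lemma flow1D t t' s : flow1 t (flow1 t' s) = flow1 (t + t') s.
Proof.
have [s1|s1] := leP 1 `|s|; first by rewrite !flow1_out.
rewrite {1}/flow1 flow1_in// /flow1 s1; congr travel_time_inv.
by have [_ ->] := travel_time_invP (travel_time s + t'); rewrite -addrA [t' + t]addrC.
Qed.

Lemma flow1N t s : flow1 t (- s) = - flow1 (- t) s.
Proof.
rewrite /flow1 normrN; case: ifP => // s1.
have [a1 a2] := travel_time_invP (travel_time (- s) + t).
have [b1 b2] := travel_time_invP (travel_time s - t).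
apply: travel_time_inj => //; first by rewrite normrN.
by rewrite a2 !travel_timeN b2; ring.
Qed.

Lemma flow1_trans s s' : `|s| < 1 -> `|s'| < 1 -> exists t, flow1 t s = s'.
Proof.
move=> s1 s'1; exists (travel_time s' - travel_time s).
by rewrite /flow1 s1 addrC subrK travel_timeK.
Qed.

Lemma is_derive_flow1 t s : is_derive t 1 (flow1 ^~ s) (bump (flow1 t s)).
Proof.
have [s1|s1] := leP 1 `|s|.
  rewrite flow1_out// bump_out//.
  have -> : flow1 ^~ s = cst s by apply/funext => r; rewrite flow1_out.
  exact: is_derive_cst.
have -> : flow1 ^~ s = travel_time_inv \o (fun t => travel_time s + t).
  by apply/funext => r; rewrite /flow1 s1.
rewrite {1}/flow1 s1 -[bump _]mulr1.
have dB : is_derive t 1 (fun r : R => travel_time s + r) 1.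
  by apply: (is_derive_eq (is_deriveD _ _)); rewrite ?add0r.
exact: (@is_derive1_comp _ travel_time_inv _ t _ _ (is_derive_travel_time_inv _) dB).
Qed.

(** Inside the interval this is a composite of continuous maps. At an endpoint, a
    point starting close to it cannot leave a given neighbourhood within bounded
    time, because the travel time is infinite there. *)
Lemma flow1_continuous : continuous (fun p : R * R => flow1 p.1 p.2).
Proof.
have c1 : continuous (fst : R * R -> R) by move=> p; exact: cvg_fst.
have c2 : continuous (snd : R * R -> R) by move=> p; exact: cvg_snd.
have right_end t0 : {for (t0, 1), continuous (fun p : R * R => flow1 p.1 p.2)}.
  apply/cvgrPdist_lt => /= e e0; rewrite flow1_out ?normr1//.
  pose c := 1 - Num.min e 1 / 2.
  have m0 : 0 < Num.min e 1 by rewrite lt_min e0 ltr01.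
  have m1 : Num.min e 1 <= 1 by rewrite ge_min lexx orbT.
  have me : Num.min e 1 <= e by rewrite ge_min lexx.
  have c1' : `|c| < 1 by rewrite ltr_norml /c; apply/andP; split; lra.
  have [d1 d2] := travel_time_invP (travel_time c - t0 + 1).
  set d := travel_time_inv _ in d1 d2.
  have nt : \forall p \near (t0, 1 : R), t0 - 1 < p.1.
    by apply: (@cvgr_gt _ _ (nbhs (t0, 1 : R)) _ fst t0); [exact: (c1 (t0, 1))|lra].
  have ns : \forall p \near (t0, 1 : R), d < p.2.
    apply: (@cvgr_gt _ _ (nbhs (t0, 1 : R)) _ snd 1); first exact: (c2 (t0, 1)).
    by move: d1; rewrite ltr_norml => /andP[].
  have ns' : \forall p \near (t0, 1 : R), `|1 - p.2| < e.
    by have /cvgrPdist_lt/(_ e e0) := c2 (t0, 1).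
  near=> p; rewrite /flow1; case: ifP => [p1|_]; last by near: p.
  have [q1 q2] := travel_time_invP (travel_time p.2 + p.1).
  have cq : c < travel_time_inv (travel_time p.2 + p.1).
    rewrite ltNge; apply/negP => qc.
    have : travel_time d < travel_time p.2.
      by apply: travel_time_lt => //; near: p.
    have : t0 - 1 < p.1 by near: p.
    have : travel_time p.2 + p.1 <= travel_time c.
      rewrite -q2; move: qc; rewrite le_eqVlt => /orP[/eqP->//|qc].
      by apply: ltW; apply: travel_time_lt.
    rewrite d2; lra.
  move: q1; rewrite ltr_norml => /andP[_ q1].
  by rewrite ger0_norm; rewrite /c in cq; lra.
move=> [t0 s0]; have [s1|s1|s1] := ltgtP `|s0| 1.
- have H : {for (t0, s0), continuous (fun p : R * R => travel_time_inv (travel_time p.2 + p.1))}.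
    apply: (@continuous_comp _ _ _ (fun p : R * R => travel_time p.2 + p.1)).
      apply: cvgD; last exact: c1.
      apply: (@continuous_comp _ _ _ snd); first exact: c2.
      exact: travel_time_continuous.
    apply: differentiable_continuous; apply/derivable1_diffP.
    by have [] := is_derive_travel_time_inv (travel_time s0 + t0).
  apply: near_eq_continuous H.
  near=> p; rewrite /flow1 ifT//; near: p.
  exact: (c2 (t0, s0) _ (norm_lt1_near s1)).
- have H : {for (t0, s0), continuous (snd : R * R -> R)} by exact: c2.
  apply: near_eq_continuous H.
  near=> p; rewrite flow1_out//; apply: ltW; near: p.
  apply: (@cvgr_gt _ _ (nbhs (t0, s0)) _ (fun p => `|p.2|) `|s0|) => //.
  apply: (@continuous_comp _ _ _ snd); first exact: c2.
  exact: norm_continuous.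
- have [s0E|s0E] : s0 = 1 \/ s0 = -1.
    by move: s1; case: (ler0P s0) => _ E; [right; rewrite -E opprK|left].
  + by rewrite s0E; exact: right_end.
  + rewrite s0E.
    have -> : (fun p : R * R => flow1 p.1 p.2) =
              (fun p => - flow1 p.1 p.2) \o (fun p => (- p.1, - p.2)).
      by apply/funext => p /=; rewrite -flow1N opprK.
    apply: continuous_comp.
      exact: (cvg_pair (cvgN (c1 (t0, -1))) (cvgN (c2 (t0, -1)))).
    by rewrite /= opprK; apply: cvgN; exact: right_end.
Unshelve. all: by end_near. Qed.

End OneDimensionalFlow.

(** * An explicit flow in a box *)

Section BoxFlow.
Context {R : realType} (n : nat) (p : 'rV[R]_n) (r : R) (i : 'I_n).
Hypothesis r0 : 0 < r.
Implicit Types (y z : 'rV[R]_n) (t : R).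

Definition box_coord y j : R := (y 0 j - p 0 j) / r.

(** The product of bumps in the other coordinates: it is constant along the flow,
    which therefore is the one-dimensional flow run at the speed [box_weight]. *)
Definition box_weight y : R := \prod_(j | j != i) bump (box_coord y j).

Definition box_speed y : R := r * bump (box_coord y i) * box_weight y.

Definition box_flow t y : 'rV[R]_n :=
  y + (r * (flow1 (t * box_weight y) (box_coord y i) - box_coord y i)) *: delta_mx 0 i.

Lemma rV_norm_ltP (x : 'rV[R]_n) (e : R) : 0 < e ->
  (`|x| < e) <-> (forall j, `|x 0 j| < e).
Proof.
move=> e0; rewrite {1}/Num.norm/= mx_normrE; split.
  by move=> /bigmax_ltP[_ H] j; exact: (H (0, j)).
by move=> H; apply/bigmax_ltP; split=> // -[k j] _/=; rewrite ord1.
Qed.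

Lemma box_coord_lt1 y j : (`|box_coord y j| < 1) = (`|(y - p) 0 j| < r).
Proof. by rewrite normf_div (gtr0_norm r0) ltr_pdivrMr// mul1r !mxE. Qed.

Lemma box_flow_other t y j : j != i -> box_flow t y 0 j = y 0 j.
Proof. by move=> ji; rewrite !mxE eqxx (negbTE ji) mulr0 addr0. Qed.

Lemma box_coord_flow t y :
  box_coord (box_flow t y) i = flow1 (t * box_weight y) (box_coord y i).
Proof.
rewrite {1}/box_coord !mxE !eqxx mulr1; move: (flow1 _ _) => F.
by rewrite /box_coord; field; rewrite gt_eqF.
Qed.

Lemma box_coord_flow_other t y j : j != i ->
  box_coord (box_flow t y) j = box_coord y j.
Proof. by move=> ji; rewrite /box_coord box_flow_other. Qed.

Lemma box_weight_flow t y : box_weight (box_flow t y) = box_weight y.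
Proof. by apply: eq_bigr => j ji; rewrite box_coord_flow_other. Qed.

Lemma box_coord_inj y z : (forall j, box_coord y j = box_coord z j) -> y = z.
Proof.
move=> yz; apply/rowP => j; have /mulIf := yz j.
by move=> /(_ (invr_neq0 (lt0r_neq0 r0)))/addIr.
Qed.

Lemma box_flow0 y : box_flow 0 y = y.
Proof. by rewrite /box_flow mul0r flow1_0 subrr mulr0 scale0r addr0. Qed.

Lemma box_flowD t t' y : box_flow t (box_flow t' y) = box_flow (t + t') y.
Proof.
apply: box_coord_inj => j; have [->|ji] := eqVneq j i.
  by rewrite !box_coord_flow box_weight_flow flow1D mulrDl.
by rewrite !box_coord_flow_other.
Qed.

Lemma box_flow_in t y : `|y - p| < r -> `|box_flow t y - p| < r.
Proof.
move=> /rV_norm_ltP-/(_ r0) H; apply/rV_norm_ltP => // j.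
rewrite -box_coord_lt1; have [->|ji] := eqVneq j i.
  by rewrite box_coord_flow flow1_in// box_coord_lt1.
by rewrite box_coord_flow_other// box_coord_lt1.
Qed.

Lemma box_outP y : ~ `|y - p| < r -> exists j, 1 <= `|box_coord y j|.
Proof.
move=> H; apply/not_existsP => K; apply: H; apply/rV_norm_ltP => // j.
by rewrite -box_coord_lt1 ltNge; apply/negP; exact: K.
Qed.

Lemma box_weight_out y j : j != i -> 1 <= `|box_coord y j| -> box_weight y = 0.
Proof. by move=> ji H; rewrite /box_weight (bigD1 j)//= bump_out// mul0r. Qed.

Lemma box_flow_out t y : ~ `|y - p| < r -> box_flow t y = y.
Proof.
move=> /box_outP[j H]; case: (eqVneq j i) H => [->|ji] H.
  by rewrite /box_flow flow1_out// subrr mulr0 scale0r addr0.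
by rewrite /box_flow (box_weight_out ji H) mulr0 flow1_0 subrr mulr0 scale0r addr0.
Qed.

Lemma box_speed_out y : ~ `|y - p| < r -> box_speed y = 0.
Proof.
move=> /box_outP[j H]; case: (eqVneq j i) H => [->|ji] H.
  by rewrite /box_speed bump_out// mulr0 mul0r.
by rewrite /box_speed (box_weight_out ji H) mulr0.
Qed.

Lemma is_derive_box_flow t y :
  is_derive t 1 (box_flow ^~ y) (box_speed (box_flow t y) *: delta_mx 0 i).
Proof.
have dF : is_derive t 1
    (fun s : R => r * (flow1 (s * box_weight y) (box_coord y i) - box_coord y i))
    (box_speed (box_flow t y)).
  have dM : is_derive t 1 (fun s : R => s * box_weight y) (box_weight y).
    apply: (is_derive_eq (is_deriveM (is_derive_id t 1) (@is_derive_cst R R R^o (box_weight y) t 1))).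
    by rewrite scaler0 add0r /GRing.scale/= mulr1.
  have dC := @is_derive1_comp _ (flow1 ^~ (box_coord y i)) _ t _ _
    (is_derive_flow1 (t * box_weight y) (box_coord y i)) dM.
  have dB := is_deriveB dC (is_derive_cst (box_coord y i) t 1).
  have dZ := is_deriveZ r dB.
  apply: (is_derive_eq dZ).
  by rewrite /box_speed box_coord_flow box_weight_flow subr0 /GRing.scale/= mulrA.
have [dF1 dF2] := dF.
have dS : is_derive t 1 (fun s : R => (r * (flow1 (s * box_weight y) (box_coord y i)
    - box_coord y i)) *: (delta_mx 0 i : 'rV[R]_n))
   (box_speed (box_flow t y) *: delta_mx 0 i).
  have dd : differentiable (fun s : R => (r * (flow1 (s * box_weight y) (box_coord y i)
    - box_coord y i)) *: (delta_mx 0 i : 'rV[R]_n)) t.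
    by apply: differentiableZl; apply/derivable1_diffP.
  split; first exact/derivable1_diffP.
  rewrite deriveE// diffZl; last exact/derivable1_diffP.
  by rewrite /= -deriveE ?dF2//; apply/derivable1_diffP.
have := is_deriveD (is_derive_cst y t 1) dS.
by rewrite add0r.
Qed.

Lemma box_coord_smooth k (U : set 'rV[R]_n) j : open U -> Ck_on k U (box_coord ^~ j).
Proof.
move=> oU; apply: Ck_onM => //; last exact: Ck_on_cst.
by apply: Ck_onD => //; [exact: Ck_on_coord|exact: Ck_on_cst].
Qed.

Lemma box_weight_smooth k (U : set 'rV[R]_n) : open U -> Ck_on k U box_weight.
Proof.
move=> oU; apply: Ck_on_prod => // j; apply: Ck_on_bump => //.
exact: box_coord_smooth.
Qed.

Lemma box_speed_smooth (U : set 'rV[R]_n) : open U -> smooth_on U box_speed.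
Proof.
move=> oU k; apply: Ck_onM => //; last exact: box_weight_smooth.
apply: Ck_onM => //; first exact: Ck_on_cst.
apply: Ck_on_bump => //; exact: box_coord_smooth.
Qed.

Lemma box_flow_continuous t : continuous (box_flow t).
Proof.
move=> y.
have cu : {for y, continuous (fun z => box_coord z i)}.
  exact: (Ck_on_continuous (box_coord_smooth 0 i openT)).
have cw : {for y, continuous (fun z => t * box_weight z)}.
  exact: (Ck_on_continuous (Ck_onM openT (Ck_on_cst 0 _ t) (box_weight_smooth 0 openT))).
have cp : {for y, continuous (fun z => (t * box_weight z, box_coord z i))}.
  exact: (cvg_pair cw cu).
have cf : {for y, continuous (fun z => flow1 (t * box_weight z) (box_coord z i))}.
  exact: (@continuous_comp _ _ _ _ (fun q : R * R => flow1 q.1 q.2) y cp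
           (@flow1_continuous R _)).
have cr : {for y, continuous (fun=> r : R)} by exact: cst_continuous.
have ce : {for y, continuous (fun=> delta_mx 0 i : 'rV[R]_n)} by exact: cst_continuous.
have cy : {for y, continuous (fun z : 'rV[R]_n => z)} by exact: cvg_id.
exact: (cvgD cy (cvgZ (cvgM cr (cvgB cf cu)) ce)).
Qed.

Lemma box_flow_trans y z : `|y - p| < r -> `|z - p| < r ->
  (forall j, j != i -> y 0 j = z 0 j) -> exists t, box_flow t y = z.
Proof.
move=> /rV_norm_ltP-/(_ r0) Hy /rV_norm_ltP-/(_ r0) Hz yz.
have w0 : 0 < box_weight y.
  by apply: prodr_gt0 => j _; apply: bump_gt0; rewrite box_coord_lt1.
have [t tE] := @flow1_trans _ (box_coord y i) (box_coord z i)
  (eq_ind_r is_true (Hy i) (box_coord_lt1 y i))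
  (eq_ind_r is_true (Hz i) (box_coord_lt1 z i)).
exists (t / box_weight y); apply: box_coord_inj => j.
have [->|ji] := eqVneq j i.
  by rewrite box_coord_flow divfK// gt_eqF.
by rewrite box_coord_flow_other// /box_coord yz.
Qed.

End BoxFlow.

(** * Flows on a manifold *)

Section Charts.
Context {R : realType} {n : nat} {X : topologicalType}.
Implicit Types (c : chart R n X).

Lemma cinv_dom c y : cimg c y -> cdom c (cinv c y).
Proof. by move=> [x cx <-]; rewrite cmapK. Qed.

Lemma cinvK c y : cimg c y -> c (cinv c y) = y.
Proof. by move=> [x cx <-]; rewrite cmapK. Qed.

Lemma near_cdom c x : cdom c x -> \forall x' \near x, cdom c x'.
Proof. by move=> cx; apply: open_nbhs_nbhs; split=> //; exact: cdom_open. Qed.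

Lemma near_cimg c y : cimg c y -> \forall y' \near y, cimg c y'.
Proof. by move=> cy; apply: open_nbhs_nbhs; split=> //; exact: cimg_open. Qed.

Lemma chart_image_open c (O : set X) : open O -> open (c @` (cdom c `&` O)).
Proof.
move=> oO; rewrite openE => _ [x [cx Ox] <-].
have nO : \forall y \near c x, O (cinv c y).
  apply: (cinv_continuous (c := c)); first by exists x.
  by rewrite cmapK//; apply: open_nbhs_nbhs.
have ni := @near_cimg c (c x) (imageP c cx).
rewrite /interior; near=> y.
have cy : cimg c y by near: y.
by exists (cinv c y); [split; [exact: cinv_dom|near: y]|exact: cinvK].
Unshelve. all: by end_near. Qed.

Lemma chart_imageP c (O : set X) y :
  (c @` (cdom c `&` O)) y <-> cimg c y /\ O (cinv c y).
Proof.
split=> [[x [cx Ox] <-]|[cy Oy]]; first by rewrite cmapK//; split=> //; exists x.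
by exists (cinv c y); [split=> //; exact: cinv_dom|exact: cinvK].
Qed.

End Charts.

Section TransitionMaps.
Context {R : realType} {n : nat} {X : topologicalType} (M : smooth_manifold R n X).
Implicit Types (c : chart R n X).

Lemma transitionE c c' x : cdom c x -> transition c c' (c x) = c' x.
Proof. by move=> cx; rewrite /transition/= cmapK. Qed.

Lemma transition_differentiable c c' x : atlas M c -> atlas M c' ->
  cdom c x -> cdom c' x -> differentiable (transition c c') (c x).
Proof.
move=> Mc Mc' cx c'x.
apply: (@C1_map_differentiable _ _ _ (c @` (cdom c `&` cdom c'))).
- by apply: chart_image_open; exact: cdom_open.
- by move=> j; exact: (atlas_compatible Mc Mc').
- by exists x.
Qed.

(** The chain rule for the transition maps is the transformation law of tangent
    vectors. *)
Lemma transition_cocycle c c1 c2 x : atlas M c -> atlas M c1 -> atlas M c2 ->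
  cdom c x -> cdom c1 x -> cdom c2 x -> forall v,
  'D_v (transition c c2) (c x) =
  'D_('D_v (transition c c1) (c x)) (transition c1 c2) (c1 x).
Proof.
move=> Mc Mc1 Mc2 cx c1x c2x v.
have o12 : open (c @` (cdom c `&` (cdom c1 `&` cdom c2))).
  by apply: chart_image_open; apply: openI; exact: cdom_open.
rewrite -(transitionE c1 cx) -derive_comp.
- apply: near_eq_derive; apply: (near_open o12); first by exists x.
  by move=> _ [z [cz [c1z c2z]] <-]; rewrite /= !transitionE.
- exact: transition_differentiable.
- by rewrite transitionE//; exact: transition_differentiable.
Qed.

End TransitionMaps.

Section ChartBoxFlow.
Context {R : realType} {n : nat} {X : topologicalType} (M : smooth_manifold R n X).
Variables (c : chart R n X) (p : 'rV[R]_n) (r : R) (i : 'I_n).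
Hypotheses (Mc : atlas M c) (r0 : 0 < r).
Hypothesis box_sub : forall y, `|y - p| <= r -> cimg c y.

Let e_i : 'rV[R]_n := delta_mx 0 i.
Let box := cinv c @` [set y | `|y - p| <= r].

Lemma box_compact : compact box.
Proof.
apply: continuous_compact.
  by apply: continuous_in_subspaceT => y /set_mem/box_sub; exact: cinv_continuous.
have -> : [set y | `|y - p| <= r] = closed_ball p r.
  by rewrite closed_ballE// /closed_ball_; apply: eq_set => y; rewrite distrC.
apply: bounded_closed_compact; last exact: closed_ball_closed.
exists (r + `|p|); split; first exact: num_real.
move=> s rs y; rewrite closed_ballE//= /closed_ball_/= => yr.
apply: le_trans (ltW rs); rewrite -(subrK p y).
by apply: le_trans (ler_normD _ _) _; rewrite lerD2r distrC.
Qed.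

Lemma box_closed : closed box.
Proof. by apply: compact_closed; [exact: (manifold_hausdorff M)|exact: box_compact]. Qed.

Lemma not_in_box x : cdom c x -> ~ box x -> ~ `|c x - p| < r.
Proof. by move=> cx bx /ltW xr; apply: bx; exists (c x) => //; exact: cmapK. Qed.

(** The coordinate field of the chart [c] times the box speed, transported to the
    chart [c'] by the derivative of the transition map. *)
Definition box_vcoord (c' : chart R n X) (x : X) : 'rV[R]_n :=
  if x \in cdom c then box_speed p r i (c x) *: 'D_e_i (transition c c') (c x) else 0.

Lemma box_vcoord_out c' x : ~ (cdom c x /\ `|c x - p| < r) -> box_vcoord c' x = 0.
Proof.
move=> H; rewrite /box_vcoord; case: ifPn => // /set_mem cx.
by rewrite box_speed_out ?scale0r// => xr; apply: H.
Qed.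

Lemma box_vcoord_compatible c1 c2 x : atlas M c1 -> atlas M c2 ->
  cdom c1 x -> cdom c2 x ->
  box_vcoord c2 x = 'D_(box_vcoord c1 x) (transition c1 c2) (c1 x).
Proof.
move=> Mc1 Mc2 c1x c2x; rewrite /box_vcoord.
case: ifPn => [/set_mem cx|_]; last by rewrite derive0.
have d12 := transition_differentiable Mc1 Mc2 c1x c2x.
by rewrite (transition_cocycle Mc Mc1 Mc2)// !(deriveE _ d12) linearZ.
Qed.

(** On the domain of [c] this is a composite of smooth maps; a point outside that
    domain has a neighbourhood which avoids the compact box, where the field
    vanishes. *)
Lemma box_vcoord_smooth c' : atlas M c' ->
  smooth_map_on (cimg c') (fun y => box_vcoord c' (cinv c' y)).
Proof.
move=> Mc' j k; apply: Ck_on_local => y c'y.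
have [cx|cx] := pselect (cdom c (cinv c' y)); last first.
  exists (c' @` (cdom c' `&` ~` box)); split.
  - by apply: chart_image_open; rewrite openC; exact: box_closed.
  - apply/chart_imageP; split=> // -[z zb zE]; apply: cx.
    by rewrite -zE; apply: cinv_dom; exact: box_sub.
  - apply: (Ck_on_ext _ _ (Ck_on_cst k _ 0)).
      by apply: chart_image_open; rewrite openC; exact: box_closed.
    move=> _ [x [c'x bx] <-]; rewrite cmapK// box_vcoord_out ?mxE//.
    by move=> [cx' xr]; exact: not_in_box xr.
have oW : open (c' @` (cdom c' `&` cdom c)).
  by apply: chart_image_open; exact: cdom_open.
have oW' : open (c @` (cdom c `&` cdom c')).
  by apply: chart_image_open; exact: cdom_open.
exists (c' @` (cdom c' `&` cdom c)); split=> //; first exact/chart_imageP.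
pose G (z : 'rV[R]_n) := box_speed p r i z * 'D_e_i (fun w => transition c c' w 0 j) z.
apply: (@Ck_on_ext _ _ _ _ (G \o transition c' c)) => //.
  move=> _ [x [c'x cx'] <-]; rewrite /G /= transitionE// cmapK// /box_vcoord mem_set//.
  rewrite mxE derive_coord//; apply: diff_derivable.
  exact: (transition_differentiable Mc Mc').
apply: (Ck_on_comp oW oW').
- by move=> _ [x [c'x cx'] <-]; rewrite transitionE//; exists x.
- by move=> l; exact: (atlas_compatible Mc' Mc).
- apply: Ck_onM => //; first exact: box_speed_smooth.
  by apply: smooth_on_derive; exact: (atlas_compatible Mc Mc').
Qed.

Definition box_field : vector_field M :=
  VectorField box_vcoord_compatible box_vcoord_smooth.

Lemma box_field_support : compact (vf_support box_field).
Proof.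
apply: (subclosed_compact _ box_compact); first exact: closed_closure.
rewrite ((closure_id box).1 box_closed).
apply: closure_subset => x [c' [Mc' c'x]].
rewrite /= /box_field/= => V0; apply: contrapT => bx; move/eqP: V0; apply.
by apply: box_vcoord_out => -[cx]; exact: not_in_box.
Qed.

Definition box_map t (x : X) : X :=
  if x \in cdom c then cinv c (box_flow p r i t (c x)) else x.

Lemma box_flow_cimg t y : cimg c y -> cimg c (box_flow p r i t y).
Proof.
move=> cy; have [yr|yr] := pselect (`|y - p| < r); last by rewrite box_flow_out.
by apply: box_sub; apply: ltW; exact: box_flow_in.
Qed.

Lemma box_map_dom t x : cdom c x -> box_map t x = cinv c (box_flow p r i t (c x)).
Proof. by move=> cx; rewrite /box_map mem_set. Qed.

Lemma box_map_out t x : ~ (cdom c x /\ `|c x - p| < r) -> box_map t x = x.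
Proof.
move=> H; rewrite /box_map; case: ifPn => // /set_mem cx.
by rewrite box_flow_out ?cmapK// => xr; apply: H.
Qed.

Lemma box_mapD t t' x : box_map t (box_map t' x) = box_map (t + t') x.
Proof.
have [cx|cx] := pselect (cdom c x); last by rewrite !box_map_out// => -[].
have cy : cimg c (box_flow p r i t' (c x)) by apply: box_flow_cimg; exists x.
rewrite (box_map_dom t' cx) box_map_dom; last exact: cinv_dom.
by rewrite cinvK// box_flowD// box_map_dom.
Qed.

Lemma box_map0 x : box_map 0 x = x.
Proof.
have [cx|cx] := pselect (cdom c x); last by rewrite !box_map_out// => -[].
by rewrite box_map_dom// box_flow0 cmapK.
Qed.

Lemma box_map_continuous t : continuous (box_map t).
Proof.
move=> x; have [cx|cx] := pselect (cdom c x).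
  have H : {for x, continuous (fun z => cinv c (box_flow p r i t (c z)))}.
    apply: (@continuous_comp _ _ _ c (fun y => cinv c (box_flow p r i t y))).
      exact: cmap_continuous.
    apply: continuous_comp; first exact: box_flow_continuous.
    by apply: cinv_continuous; apply: box_flow_cimg; exists x.
  apply: near_eq_continuous H; near=> z; rewrite box_map_dom//; near: z.
  exact: near_cdom.
have H : {for x, continuous (fun z : X => z)} by exact: cvg_id.
apply: near_eq_continuous H.
have bx : (~` box) x.
  move=> [y yr yx]; apply: cx; rewrite -yx; apply: cinv_dom; exact: box_sub.
have ob : open (~` box) by rewrite openC; exact: box_closed.
apply: filterS (open_nbhs_nbhs (conj ob bx)) => z bz.
by rewrite box_map_out// => -[cz]; exact: not_in_box.
Unshelve. all: by end_near. Qed.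

Lemma box_mapK t : cancel (box_map t) (box_map (- t)).
Proof. by move=> x; rewrite box_mapD addNr box_map0. Qed.

Lemma box_mapVK t : cancel (box_map (- t)) (box_map t).
Proof. by move=> x; rewrite box_mapD subrr box_map0. Qed.

Definition box_homeo t : homeo X :=
  Homeo (box_mapK t) (box_mapVK t) (@box_map_continuous t) (@box_map_continuous (- t)).

Lemma box_is_flow : is_flow box_field box_homeo.
Proof.
have dF x t := is_derive_box_flow p i r0 t (c x).
have dif x t : differentiable (fun s => box_flow p r i s (c x)) t.
  by apply/derivable1_diffP; have [] := dF x t.
split; first exact: box_map0.
- move=> x; have [cx|cx] := pselect (cdom c x); last first.
    rewrite /= (_ : (fun t => box_map t x) = fun=> x); first exact: cst_continuous.
    by apply/funext => t; rewrite box_map_out// => -[].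
  rewrite /= (_ : (fun t => box_map t x) = cinv c \o (fun t => box_flow p r i t (c x))).
    move=> t; apply: continuous_comp; first exact: differentiable_continuous.
    by apply: cinv_continuous; apply: box_flow_cimg; exists x.
  by apply/funext => t; rewrite /= box_map_dom.
- move=> x t c' Mc' /=; have [cx|cx] := pselect (cdom c x); last first.
    move=> c'x; rewrite (_ : (fun s => c' (box_map s x)) = fun=> c' x).
      rewrite box_map_out ?box_vcoord_out// => [|[]//|[]//].
      exact: is_derive_cst.
    by apply/funext => s; rewrite box_map_out// => -[].
  have cy s : cimg c (box_flow p r i s (c x)) by apply: box_flow_cimg; exists x.
  rewrite box_map_dom// => c'y.
  rewrite (_ : (fun s => _) = transition c c' \o (fun s => box_flow p r i s (c x))); last first.
    by apply/funext => s; rewrite /= box_map_dom.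
  have dT : differentiable (transition c c') (box_flow p r i t (c x)).
    rewrite -(cinvK (cy t)); apply: (transition_differentiable Mc Mc') => //.
    exact: cinv_dom.
  have dTF := differentiable_comp (dif x t) dT.
  split; first exact/derivable1_diffP.
  rewrite (derive_comp _ (dif x t) dT) /box_vcoord mem_set; last exact: cinv_dom.
  have [_ ->] := dF x t.
  by rewrite cinvK// (deriveE _ dT) linearZ -(deriveE _ dT).
Qed.

End ChartBoxFlow.

(** Moving one coordinate at a time is enough to connect any two points of a
    box, and it keeps the flow explicit: the orbits are coordinate lines. *)
Lemma box_move (R : realType) (n : nat) (X : topologicalType) (M : smooth_manifold R n X)
    (c : chart R n X) (p : 'rV[R]_n) (r : R) (i : 'I_n) (y z : 'rV[R]_n) :
  atlas M c -> 0 < r -> (forall y, `|y - p| <= r -> cimg c y) ->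
  `|y - p| < r -> `|z - p| < r -> (forall j, j != i -> y 0 j = z 0 j) ->
  exists (V : vector_field M) (psi : R -> homeo X) (t : R),
    [/\ compact (vf_support V), is_flow V psi, psi t (cinv c y) = cinv c z &
        forall x, ~ (cdom c x /\ `|c x - p| < r) -> psi t x = x].
Proof.
move=> Mc r0 sub yr zr yz.
have [t tE] := box_flow_trans r0 yr zr yz.
have cy := sub _ (ltW yr).
exists (box_field i Mc r0 sub), (box_homeo M i r0 sub), t; split.
- exact: box_field_support.
- exact: box_is_flow.
- by rewrite /= box_map_dom ?cinvK ?tE//; exact: cinv_dom.
- by move=> x; exact: box_map_out.
Qed.

(** * The vague topology *)

Section VagueTopology.
Context {R : realType} {X : ptopologicalType}.
Implicit Types (gamma : config R X) (f : cc_fun R X).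

Lemma vague_eval_continuous f :
  continuous (fun gamma : config R X => vague_eval gamma f).
Proof.
move=> gamma.
apply: (@continuous_comp _ _ _ (@vague_eval R X : config R X -> prod_topology _)
  (fun h : prod_topology (fun _ : cc_fun R X => R) => h f)).
  exact: (@initial_continuous _ _ (@vague_eval R X)).
exact: (@proj_continuous (cc_fun R X) (fun=> R) f).
Qed.

(** The vague topology is initial for a map into a product of lines, and a
    neighbourhood in a product constrains finitely many coordinates only. *)
Lemma vague_basis (U : set (config R X)) gamma : open U -> U gamma ->
  exists (fs : seq (cc_fun R X)) (e : R), 0 < e /\
    forall gamma' : config R X,
      (forall f, f \in fs -> `|vague_eval gamma f - vague_eval gamma' f| < e) -> U gamma'.
Proof.
move=> [B oB <-] Bg.
pose I := (seq (cc_fun R X) * R)%type.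
pose nb (i : I) := [set h : prod_topology (fun _ : cc_fun R X => R) |
  forall f, f \in i.1 -> `|vague_eval gamma f - h f| < i.2].
pose F := filter_from [set i : I | 0 < i.2] nb.
have FF : Filter F.
  apply: filter_from_filter; first by exists ([::], 1) => /=; exact: ltr01.
  move=> [fs e] [fs' e'] /= e0 e'0; exists (fs ++ fs', Num.min e e') => /=.
    by rewrite lt_min e0.
  move=> h H; split=> f /= fi; have := H f; rewrite /= mem_cat fi ?orbT => /(_ isT).
    by move=> /lt_le_trans; apply; rewrite ge_min lexx.
  by move=> /lt_le_trans; apply; rewrite ge_min lexx orbT.
have FB : F --> (vague_eval gamma : prod_topology (fun _ : cc_fun R X => R)).
  apply/cvg_sup => f A; rewrite nbhsE => -[_ [[W oW <-] Wg]] sub.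
  have /nbhs_ballP[e /= e0 We] := open_nbhs_nbhs (conj oW Wg).
  exists ([:: f], e) => //= h H; apply: sub; apply: We.
  by rewrite /ball/=; apply: H; rewrite /= mem_seq1.
have [[fs e] /= e0 sub] := FB B (open_nbhs_nbhs (conj oB Bg)).
by exists fs, e; split=> // gamma' H; apply: sub.
Qed.

Lemma near_all_seq (T : topologicalType) (I : eqType) (s : seq I) (P : I -> T -> Prop) (x : T) :
  (forall i, i \in s -> \forall y \near x, P i y) ->
  \forall y \near x, forall i, i \in s -> P i y.
Proof.
elim: s => [|i s IH] H; first by apply: filterE => y j.
have Hi := H i (mem_head i s).
have Hs : \forall y \near x, forall j, j \in s -> P j y.
  by apply: IH => j js; apply: H; rewrite inE js orbT.
near=> y => j; rewrite inE => /orP[/eqP->|]; first by near: y.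
by move: j; near: y.
Unshelve. all: by end_near. Qed.

Lemma borel_open (O : set X) : open O -> measurable (O : set (borel X)).
Proof. exact: sub_sigma_algebra. Qed.

Lemma borel_closed (C : set X) : closed C -> measurable (C : set (borel X)).
Proof.
by move=> cC; rewrite -[C]setCK; apply: measurableC; apply: borel_open; exact: closed_openC.
Qed.

Lemma continuous_borel_measurable (f : X -> R) : continuous f ->
  measurable_fun [set: borel X] (f : borel X -> R).
Proof.
move=> cf; apply: (measurability _ (RGenOpens.measurableE R)) => _ [_ [a [b ->]] <-].
rewrite setTI; apply: borel_open.
by apply: open_comp; [move=> x _; exact: cf|exact: interval_open].
Qed.

Lemma cc_support_measurable f : measurable ([set x | f x != 0] : set (borel X)).
Proof.
apply: borel_open; have -> : [set x | f x != 0] = f @^-1` [set~ 0].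
  by apply/seteqP; split=> x /eqP.
apply: open_comp; first by move=> x _; exact: ccf_continuous.
by rewrite openC; exact: (accessible_closed_set1 (hausdorff_accessible (@norm_hausdorff _ R))).
Qed.

Section CompactSupportComp.
Variables (psi : homeo X) (f : cc_fun R X).

Lemma comp_homeo_continuous : continuous (f \o psi).
Proof.
move=> x; apply: continuous_comp; first exact: hmap_continuous.
exact: ccf_continuous.
Qed.

Lemma comp_homeo_compact : compact (closure [set x | (f \o psi) x != 0]).
Proof.
have H := @homeo_preimage_compact _ psi _ (ccf_compact (c := f)).
apply: (subclosed_compact _ H).
  exact: closed_closure.
have cl : closed (psi @^-1` closure [set x | f x != 0]).
  apply: closed_comp; last exact: closed_closure.
  by move=> x _; exact: hmap_continuous.
rewrite ((closure_id _).1 cl); apply: closure_subset => x fx.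
exact: subset_closure.
Qed.

Definition cc_comp : cc_fun R X := CcFun comp_homeo_continuous comp_homeo_compact.

Lemma vague_eval_push gamma :
  vague_eval (conf_push gamma psi) f = vague_eval gamma cc_comp.
Proof.
rewrite /vague_eval /Rintegral; congr fine.
have mf : measurable_fun [set: borel X] (EFin \o (f : borel X -> R)).
  by apply/measurable_EFinP; apply: continuous_borel_measurable; exact: ccf_continuous.
rewrite [LHS]integralE [RHS]integralE.
have E (h : borel X -> \bar R) : measurable_fun setT h -> (forall x, (0 <= h x)%E) ->
    (\int[conf_push gamma psi]_x h x = \int[gamma]_x (h \o psi) x)%E.
  move=> mh h0.
  exact: (@ge0_integral_pushforward _ _ (borel X) (borel X) R psi (homeo_measurable psi) gamma setT h measurableT
            mh (fun x _ => h0 x)).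
rewrite (E _ (measurable_funepos mf))// (E _ (measurable_funeneg mf))//.
by rewrite !unlock.
Qed.

End CompactSupportComp.

(** The integral of [f] for the image configuration is the integral of [f \o psi],
    which again is a test function. *)
Lemma conf_push_open (psi : homeo X) (U : set (config R X)) : open U ->
  open [set gamma : config R X | U (conf_push gamma psi)].
Proof.
move=> oU; rewrite openE => gamma Ug.
have [fs [e [e0 sub]]] := vague_basis oU Ug.
rewrite /interior.
suff : \forall g \near gamma, forall f, f \in fs ->
    `|vague_eval gamma (cc_comp psi f) - vague_eval g (cc_comp psi f)| < e.
  apply: filterS => g H; apply: sub => f ff.
  by rewrite !vague_eval_push; exact: H.
apply: near_all_seq => f _.
by have /cvgrPdist_lt/(_ e e0) := @vague_eval_continuous (cc_comp psi f) gamma.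
Qed.

End VagueTopology.

(** * Atoms of a configuration *)

Definition locally_finite (X : topologicalType) (S : set X) : Prop :=
  forall x, exists O, [/\ open O, O x & forall y, O y -> S y -> y = x].

(** The configurations that charge each point of [S] with mass 1 and nothing else;
    as measures are functions on all sets, there may be several of them, which
    agree on Borel sets. *)
Definition supported_on (R : realType) (X : ptopologicalType)
    (gamma : config R X) (S : set X) : Prop :=
  [/\ locally_finite S, forall x, S x -> gamma [set x] = 1%E & gamma (~` S) = 0%E].

Section LocallyFinite.
Context {X : topologicalType}.
Implicit Types (S : set X) (x : X).

Lemma locally_finite_closed S : locally_finite S -> closed S.
Proof.
move=> lS x clx; have [ O [oO Ox OS]] := lS x.
have [y [Sy Oy]] := clx O (open_nbhs_nbhs (conj oO Ox)).
by rewrite -(OS y Oy Sy).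
Qed.

Lemma locally_finite_sub S S' : S' `<=` S -> locally_finite S -> locally_finite S'.
Proof.
move=> SS lS x; have [ O [oO Ox OS]] := lS x; exists O; split=> // y Oy /SS.
exact: OS.
Qed.

Lemma locally_finite_setU1 S x : hausdorff_space X ->
  locally_finite S -> locally_finite (x |` S).
Proof.
move=> hX lS y; have [ O [oO Oy OS]] := lS y.
have [E|xy] := pselect (x = y).
  by subst y; exists O; split=> // z Oz [->//|]; exact: OS.
exists (O `\` [set x]); split.
- by apply: openI => //; rewrite openC; exact: accessible_closed_set1 (hausdorff_accessible hX) x.
- by split=> // yx; exact: xy.
- by move=> z [Oz zx] [/zx//|]; exact: OS.
Qed.

Lemma locally_finite_compact (Y : ptopologicalType) (S K : set Y) : locally_finite S -> compact K ->
  finite_set (S `&` K).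
Proof.
move=> lS; rewrite compact_cover => cK.
have [f fP] := choice lS.
have of_ (x : Y) : [set: Y] x -> open (f x) by have [] := fP x.
have [x Kx|D _ KD] := cK {classic Y} setT f of_.
  by exists x => //; have [] := fP x.
apply: (@sub_finite_set {classic Y} _ _ _ (finite_fset D)).
move=> y [Sy /KD[z Dz fzy]]; have [_ _ H] := fP z.
by rewrite (H y fzy Sy).
Qed.

End LocallyFinite.

Section Supports.
Context {R : realType} {n : nat} {X : ptopologicalType} (M : smooth_manifold R n X).
Implicit Types (gamma : config R X) (S : set X) (x : X).

Lemma manifold_closed1 x : closed [set x].
Proof. exact: accessible_closed_set1 (hausdorff_accessible (manifold_hausdorff M)) x. Qed.

Lemma borel_set1 x : measurable ([set x] : set (borel X)).
Proof. by apply: borel_closed; exact: manifold_closed1. Qed.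

Lemma borel_le gamma (A B : set (borel X)) : measurable A -> measurable B ->
  A `<=` B -> (gamma A <= gamma B)%E.
Proof. by move=> mA mB AB; apply: le_measure; rewrite ?inE. Qed.

Lemma borel_sub0 gamma (A B : set (borel X)) : measurable A -> measurable B ->
  A `<=` B -> gamma B = 0%E -> gamma A = 0%E.
Proof.
move=> mA mB AB B0; apply/eqP; rewrite eq_le measure_ge0 andbT -B0.
exact: borel_le.
Qed.

Lemma small_box x (O : set X) : open O -> O x ->
  exists (c : chart R n X) (r : R), [/\ atlas M c, cdom c x, 0 < r &
    forall y, `|y - c x| <= r -> cimg c y /\ O (cinv c y)].
Proof.
move=> oO Ox; have [c Mc cx] := atlas_cover M x; exists c.
have : nbhs (c x) (c @` (cdom c `&` O)).
  by apply: open_nbhs_nbhs; split; [exact: chart_image_open|exists x].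
move=> /nbhs_ballP[e /= e0 eO]; exists (e / 2); split=> //.
  by rewrite divr_gt0.
move=> y ye; apply/chart_imageP; apply: eO; rewrite -ball_normE/= distrC.
by apply: le_lt_trans ye _; rewrite ltr_pdivrMr// ltr_pMr// ltr1n.
Qed.

Definition chart_ball (c : chart R n X) x (r : R) : set X :=
  [set x' | cdom c x' /\ `|c x' - c x| < r].

Lemma chart_ball_open (c : chart R n X) x r : open (chart_ball c x r).
Proof.
rewrite openE => y [cy yr]; rewrite /interior; apply: filterI; first exact: near_cdom.
have cc : {for y, continuous (fun z => `|c z - c x|)}.
  apply: (@continuous_comp _ _ _ c (fun w => `|w - c x|)); first exact: cmap_continuous.
  have c1 : {for c y, continuous (fun w : 'rV[R]_n => w)} by exact: cvg_id.
  have c2 : {for c y, continuous (fun=> c x)} by exact: cst_continuous.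
  exact: (cvg_norm (cvgB c1 c2)).
exact: (@cvgr_lt _ _ (nbhs y) _ _ _ cc).
Qed.

Lemma chart_ball_compact (c : chart R n X) x r : 0 < r ->
  (forall y, `|y - c x| <= r -> cimg c y) ->
  exists K : set X, [/\ compact K, chart_ball c x r `<=` K & K `<=` cdom c].
Proof.
move=> r0 sub; exists (cinv c @` [set y | `|y - c x| <= r]); split.
- exact: box_compact.
- by move=> z [cz /ltW zr]; exists (c z) => //; exact: cmapK.
- by move=> _ [y yr <-]; apply: cinv_dom; exact: sub.
Qed.

Lemma compact_borel (K : set X) : compact K -> measurable (K : set (borel X)).
Proof.
move=> cK; apply: borel_closed; apply: compact_closed cK; exact: (manifold_hausdorff M).
Qed.

Lemma config_lt1 gamma (A : set (borel X)) : measurable A -> (gamma A < 1)%E ->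
  gamma A = 0%E.
Proof.
move=> mA; have [[[|k] ->]//|->//] := cmeas_integer gamma mA.
by rewrite lte_fin ltrn1.
Qed.

(** The measures of the punctured balls around a point decrease to zero, hence
    vanish eventually because they are integers. *)
Lemma config_isolated gamma x :
  exists O, [/\ open O, O x & gamma (O `\` [set x]) = 0%E].
Proof.
have [c [r [Mc cx r0 sub]]] := @small_box x setT openT I.
pose B k := chart_ball c x (r / k.+1%:R).
pose F k : set (borel X) := B k `\` [set x].
have rk k : 0 < r / k.+1%:R by rewrite divr_gt0.
have mB k : measurable (B k : set (borel X)) by apply: borel_open; exact: chart_ball_open.
have mF k : measurable (F k) by apply: measurableD => //; exact: borel_set1.
have F0 : (gamma (F 0%N) < +oo)%E.
  have [K [cK BK _]] := @chart_ball_compact c x r r0 (fun y yr => (sub y yr).1).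
  apply: le_lt_trans (cmeas_compact gamma cK).
  apply: borel_le => //; first exact: compact_borel.
  by move=> y [By _]; apply: BK; move: By; rewrite /B divr1.
have dF : nonincreasing_seq F.
  apply/nonincreasing_seqP => k; rewrite subsetEset => y [[cy yr] yx]; split=> //.
  split=> //; apply: lt_le_trans yr _.
  by rewrite ler_pM2l// lef_pV2 ?posrE// ler_nat.
have capF : \bigcap_k F k = set0.
  apply/seteqP; split=> // y Fy; have [[cy _] yx] := Fy 0%N I.
  apply: yx; rewrite /= -(cmapK cy) -(cmapK cx); congr (cinv c _).
  apply: contrapT => /eqP; rewrite -subr_eq0 -normr_gt0 => v0.
  have [k] := ltr_add_invr (divr_gt0 v0 r0); rewrite add0r ltr_pdivlMr// mulrC => kv.
  by have [[_ /(lt_trans kv)]] := Fy k I; rewrite ltxx.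
have cvF : gamma (F k) @[k --> \oo] --> 0%E.
  rewrite -[0%E](measure0 gamma) -capF.
  apply: nonincreasing_cvg_mu => //.
  by rewrite capF; exact: measurable0.
have [k Fk] : exists k, (gamma (F k) < 1)%E.
  move: cvF => /fine_cvgP[fin /cvgrPdist_lt/(_ 1 ltr01) lt1].
  have [k _ /(_ k (leqnn k))[/= fk]] := filterI fin lt1.
  rewrite sub0r normrN => fk1; exists k; rewrite -(fineK fk) lte_fin.
  exact: le_lt_trans (ler_norm _) fk1.
exists (B k); split; first exact: chart_ball_open.
- by rewrite /B /chart_ball/= subrr normr0; split.
- exact: config_lt1 (mF k) Fk.
Qed.

End Supports.

Section SupportMeasure.
Context {R : realType} {n : nat} {X : ptopologicalType} (M : smooth_manifold R n X).
Implicit Types (gamma : config R X) (S : set X) (x : X).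

Lemma countable_base : exists b : nat -> set X, (forall k, open (b k)) /\
  forall x (O : set X), open O -> O x -> exists k, b k x /\ b k `<=` O.
Proof.
have [B /pfcard_geP[B0|[b]] [Bo Bx]] := manifold_second_countable M.
  have [U [BU _] _] := Bx point setT filterT.
  by rewrite B0 in BU.
exists b; split=> [k|x O oO Ox]; first by apply: Bo; exact: funS.
have [U [BU Ux] UO] := Bx x O (open_nbhs_nbhs (conj oO Ox)).
have [k _ bU] : (b @` [set: nat]) U by apply: (@surj _ _ [set: nat] B b).
by exists k; rewrite bU.
Qed.

(** A union of null sets taken from the countable base. *)
Lemma null_of_local gamma (D : set X) :
  (forall x, D x -> exists O, [/\ open O, O x & gamma O = 0%E]) ->
  exists W, [/\ open W, D `<=` W & gamma W = 0%E].
Proof.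
move=> H; have [b [bo bx]] := countable_base.
pose F k : set (borel X) := if pselect (gamma (b k) = 0%E) then b k else set0.
have mF k : measurable (F k).
  by rewrite /F; case: pselect => p; [exact: borel_open|exact: measurable0].
have F0 k : gamma (F k) = 0%E by rewrite /F; case: pselect => p; rewrite ?measure0.
have oF : open (\bigcup_k F k : set X).
  apply: bigcup_open => k _; rewrite /F; by case: pselect => p; [exact: bo|exact: open0].
exists (\bigcup_k F k); split=> //.
- move=> x /H[ O [oO Ox O0]]; have [k [bkx bkO]] := bx x O oO Ox.
  exists k => //; rewrite /F; case: pselect => // bk0; exfalso; apply: bk0.
  by apply: borel_sub0 O0 => //; exact: borel_open.
- apply: measure_negligible; first exact: borel_open.
  by apply: negligible_bigcup => k; exists (F k); split.
Qed.

Lemma config_set1_fin gamma x : gamma [set x] \is a fin_num.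
Proof.
rewrite ge0_fin_numE ?measure_ge0//; apply: cmeas_compact.
exact: compact_set1.
Qed.

Lemma config_null_nbhd gamma x : gamma [set x] = 0%E ->
  exists O, [/\ open O, O x & gamma O = 0%E].
Proof.
move=> gx; have [ O [oO Ox O0]] := config_isolated M gamma x; exists O; split=> //.
have mO := borel_open oO; have mx := borel_set1 M x.
have mD : measurable (O `\` [set x] : set (borel X)) by exact: measurableD.
rewrite (_ : O = [set x] `|` (O `\` [set x])).
  rewrite measureU//; first by rewrite -[RHS]adde0; congr (_ + _)%E.
  by apply/seteqP; split=> // z [-> [_ nx]]; exact: nx.
by rewrite setDUK// => y ->.
Qed.

Lemma config_atoms_locally_finite gamma :
  locally_finite [set x | gamma [set x] != 0%E].
Proof.
move=> x; have [ O [oO Ox O0]] := config_isolated M gamma x.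
exists O; split=> // y Oy /= gy; apply: contrapT => yx; move/eqP: gy; apply.
apply: (borel_sub0 _ _ _ O0); first exact: (borel_set1 M).
  by apply: measurableD; [exact: borel_open|exact: (borel_set1 M)].
by move=> _ ->; split.
Qed.

Lemma locally_finite_borel S : locally_finite S -> measurable (S : set (borel X)).
Proof. by move=> lS; apply: borel_closed; exact: locally_finite_closed. Qed.

Lemma config_off_atoms gamma : gamma (~` [set x | gamma [set x] != 0%E]) = 0%E.
Proof.
have lS := config_atoms_locally_finite gamma.
have [x /negP/negPn/eqP/config_null_nbhd//|W [oW SW W0]] :=
  @null_of_local gamma (~` [set x | gamma [set x] != 0%E]).
apply: borel_sub0 W0 => //; last exact: borel_open.
by apply: measurableC; exact: locally_finite_borel.
Qed.

Lemma simple_supported gamma :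
  (forall x, gamma [set x] = 0%E \/ gamma [set x] = 1%E) ->
  supported_on gamma [set x | gamma [set x] != 0%E].
Proof.
move=> gs; split; first exact: config_atoms_locally_finite.
- by move=> x /= gx; have [g0|//] := gs x; rewrite g0 eqxx in gx.
- exact: config_off_atoms.
Qed.

Lemma supported_push gamma (psi : homeo X) S : supported_on gamma S ->
  supported_on (conf_push gamma psi) (psi @` S).
Proof.
move=> [lS S1 S0]; split.
- move=> x; have [ O [oO Ox OS]] := lS (hinv psi x).
  exists (hinv psi @^-1` O); split=> //.
    by apply: open_comp => // z _; exact: hinv_continuous.
  move=> y + [w Sw wy]; rewrite -wy /preimage/= hmapK => Ow.
  by rewrite (OS w Ow Sw) hinvK.
- move=> _ [w Sw <-]; rewrite -(S1 w Sw) /= /homeo_push /pushforward.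
  congr (gamma _); apply/seteqP; split=> [z /= E|_ -> //].
  by rewrite -(@hmapK X psi z) E hmapK.
- rewrite -S0 /= /homeo_push /pushforward; congr (gamma _).
  apply/seteqP; split=> z /= nz; first by move=> Sz; apply: nz; exists z.
  by move=> [w Sw E]; apply: nz; rewrite -(@hmapK X psi z) -E hmapK.
Qed.

(** The test function agrees almost everywhere with a combination of indicators of
    points. *)
Lemma vague_eval_points gamma (f : cc_fun R X) (xs : seq X) : uniq xs ->
  gamma ([set x | f x != 0] `\` [set` xs]) = 0%E ->
  vague_eval gamma f = \sum_(x <- xs) f x * fine (gamma [set x]).
Proof.
move=> uxs g0.
have mf : measurable_fun [set: borel X] (f : borel X -> R).
  by apply: continuous_borel_measurable; exact: ccf_continuous.
have mxs : measurable ([set` xs] : set (borel X)).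
  elim: (xs) => [|a s IH]; first by rewrite set_nil; exact: measurable0.
  have -> : [set` a :: s] = [set a] `|` [set` s].
    apply/seteqP; split=> z /=; rewrite inE.
      by move=> /orP[/eqP|]; [left|right].
    by move=> [->|->]; rewrite ?eqxx ?orbT.
  by apply: measurableU => //; exact: (borel_set1 M).
have mN : measurable ([set x | f x != 0] `\` [set` xs] : set (borel X)).
  by apply: measurableD => //; exact: cc_support_measurable.
have intI (a : X) : gamma.-integrable [set: borel X] (fun x => (\1_([set a] : set (borel X)) x)%:E).
  apply/integrableP; split.
    by apply/measurable_EFinP; apply: measurable_indic; exact: (borel_set1 M).
  under eq_integral do rewrite gee0_abs ?lee_fin//.
  rewrite integral_indic ?setIT//; last exact: (borel_set1 M).
  by rewrite ltey_eq config_set1_fin.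
pose g (x : borel X) : \bar R := (\sum_(a <- xs) (f a)%:E * (\1_([set a] : set (borel X)) x)%:E)%E.
have intZ (a : X) : gamma.-integrable [set: borel X]
    (fun x => ((f a)%:E * (\1_([set a] : set (borel X)) x)%:E)%E).
  by apply: integrableZl => //; exact: measurableT.
have Eg : (\int[gamma]_x g x = \sum_(a <- xs) (f a)%:E * gamma [set a])%E.
  rewrite integral_sum//; apply: eq_bigr => a _.
  rewrite integralZl// integral_indic ?setIT//; exact: (borel_set1 M).
have gE x : g x = (\sum_(a <- xs) f a * (x == a)%:R)%:E.
  rewrite /g -sumEFin; apply: eq_bigr => a _; rewrite -EFinM indicE.
  congr (_ * _)%:E; congr ((nat_of_bool _)%:R); apply/idP/eqP; first by rewrite inE.
  by move=> ->; rewrite inE.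
have mg : measurable_fun [set: borel X] g.
  apply: emeasurable_sum => a; exact: measurable_int (intZ a).
rewrite /vague_eval /Rintegral.
rewrite (_ : (\int[gamma]_x (f x)%:E)%E = (\int[gamma]_x g x)%E).
  rewrite Eg -sum_fine/=.
    by apply: eq_bigr => a _; rewrite fineM// config_set1_fin.
  by move=> a _; rewrite fin_numM// config_set1_fin.
apply: ae_eq_integral => //; first exact/measurable_EFinP.
exists ([set x | f x != 0] `\` [set` xs]); split=> // x /= H.
have xxs : ~ (x \in xs).
  move=> xxs; apply: H => _; rewrite gE (bigD1_seq x)//= eqxx mulr1 big1 ?addr0//.
  by move=> a ax; rewrite eq_sym (negbTE ax) mulr0.
split=> //; apply/eqP => fx; apply: H => _; rewrite gE fx big1_seq// => a /= ax.
by have [xa|] := eqVneq x a; rewrite ?mulr0//; rewrite -xa in ax.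
Qed.

End SupportMeasure.

(** * Test functions and total mass *)

Section Bumps.
Context {R : realType} {n : nat} {X : ptopologicalType} (M : smooth_manifold R n X).
Implicit Types (f : cc_fun R X).

(** A plateau function of the distance to [x], read in a chart. *)
Lemma cc_bump_local (x : X) : exists (f : cc_fun R X) (O : set X),
  [/\ open O, O x, forall y, 0 <= f y <= 1 & forall y, O y -> f y = 1].
Proof.
have [c [r [Mc cx r0 sub]]] := @small_box _ _ _ M x setT openT I.
have r20 : 0 < r / 2 by rewrite divr_gt0.
pose h (v : 'rV[R]_n) : R := Num.min 1 (Num.max 0 (2 - `|v - c x| * (2 / r))).
pose f (y : X) : R := if y \in cdom c then h (c y) else 0.
have [K [cK BK Kc]] := @chart_ball_compact _ _ _ c x r r0 (fun y yr => (sub y yr).1).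
have clK : closed K by apply: compact_closed cK; exact: (manifold_hausdorff M).
have f_out y : ~ K y -> f y = 0.
  rewrite /f; case: ifPn => // /set_mem cy Ky.
  have : ~ `|c y - c x| < r by move=> yr; apply: Ky; exact: BK.
  move/negP; rewrite -leNgt => yr; rewrite /h max_l ?min_r//.
  by rewrite subr_le0 mulrA ler_pdivlMr// mulrC ler_pM2r.
have hc : continuous h.
  move=> v.
  have c1 : {for v, continuous (fun w : 'rV[R]_n => w)} by exact: cvg_id.
  have c2 : {for v, continuous (fun=> c x)} by exact: cst_continuous.
  have c3 : {for v, continuous (fun w : 'rV[R]_n => `|w - c x| * (2 / r))}.
    exact: (cvgM (cvg_norm (cvgB c1 c2)) (@cst_continuous _ R (2 / r) v)).
  have c4 : {for v, continuous (fun w : 'rV[R]_n => 2 - `|w - c x| * (2 / r))}.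
    exact: (cvgB (@cst_continuous _ R 2 v) c3).
  have c5 := continuous_max (@cst_continuous _ R 0 v) c4.
  exact: (continuous_min (@cst_continuous _ R 1 v) c5).
have fc : continuous f.
  move=> y; have [cy|cy] := pselect (cdom c y).
    have H : {for y, continuous (h \o c)}.
      by apply: continuous_comp; [exact: cmap_continuous|exact: hc].
    apply: near_eq_continuous H; apply: filterS (near_cdom cy) => z cz.
    by rewrite /f mem_set.
  have Ky : ~ K y by move=> /Kc.
  have H : {for y, continuous (fun=> 0 : R)} by exact: cst_continuous.
  apply: near_eq_continuous H.
  have oK : open (~` K) by rewrite openC.
  by apply: filterS (open_nbhs_nbhs (conj oK Ky)) => z Kz; rewrite f_out.
have fK : compact (closure [set y | f y != 0]).
  apply: (subclosed_compact _ cK); first exact: closed_closure.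
  rewrite ((closure_id K).1 clK); apply: closure_subset => y /eqP fy.
  by apply: contrapT => Ky; apply: fy; exact: f_out.
exists (CcFun fc fK), (chart_ball c x (r / 2)); split => /=.
- exact: chart_ball_open.
- by rewrite /chart_ball/= subrr normr0.
- move=> y; rewrite /f; case: ifP => _; last by rewrite lexx ler01.
  by rewrite /h ge_min lexx le_min ler01 le_max lexx.
- move=> y [cy yr]; rewrite /f mem_set// /h min_l// le_max; apply/orP; right.
  have : `|c y - c x| * (2 / r) < r / 2 * (2 / r) by rewrite ltr_pM2r// divr_gt0.
  rewrite (_ : r / 2 * (2 / r) = 1); last by field; rewrite gt_eqF.
  by move: (_ * (2 / r)) => w w1; lra.
Qed.

End Bumps.

Section TotalMass.
Context {R : realType} {n : nat} {X : ptopologicalType} (M : smooth_manifold R n X).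
Implicit Types (f h : cc_fun R X) (gamma : config R X).

Lemma cc_zero : exists f, forall x, f x = 0.
Proof.
have c0 : continuous (fun _ : X => 0 : R) by exact: cst_continuous.
have k0 : compact (closure [set x : X | (fun=> 0 : R) x != 0]).
  rewrite (_ : [set x | _] = set0) ?closure0; first exact: compact0.
  by apply/seteqP; split=> // x /=; rewrite eqxx.
by exists (CcFun c0 k0).
Qed.

Lemma cc_max f h : (forall x, 0 <= f x) ->
  exists fh : cc_fun R X, forall x, fh x = Num.max (f x) (h x).
Proof.
move=> f0.
have cm : continuous (fun x => Num.max (f x) (h x)).
  move=> x.
  have cf : {for x, continuous f} by exact: ccf_continuous.
  have ch : {for x, continuous h} by exact: ccf_continuous.
  exact: (continuous_max cf ch).
have km : compact (closure [set x | Num.max (f x) (h x) != 0]).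
  apply: (subclosed_compact _ (compactU (ccf_compact (c := f)) (ccf_compact (c := h)))).
    exact: closed_closure.
  rewrite -closureU; apply: closure_subset => x /=.
  have [->|fx _] := eqVneq (f x) 0; last by left.
  by rewrite /Num.max; case: ifP; rewrite ?eqxx//; right.
by exists (CcFun cm km).
Qed.

Lemma cc_bump (K : set X) : compact K ->
  exists f, (forall x, 0 <= f x <= 1) /\ (forall x, K x -> f x = 1).
Proof.
rewrite compact_cover => cK.
have /choice[ F FP] := cc_bump_local M.
have {FP} /choice[ O OP] := FP.
have oO (x : X) : [set: X] x -> open (O x) by have [] := OP x.
have [x Kx|D _ KD] := cK {classic X} setT O oO.
  by exists x => //; have [] := OP x.
suff H (s : seq {classic X}) : exists f, (forall x, 0 <= f x <= 1) /\
    (forall (x : X) (y : {classic X}), y \in s -> O y x -> f x = 1).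
  have [f [f01 f1]] := H (finmap.enum_fset D); exists f; split=> // x /KD[y Dy Oy].
  exact: (f1 x y Dy Oy).
elim: s => [|y s [f [f01 f1]]].
  by have [f f0] := cc_zero; exists f; split=> // x; rewrite f0 lexx ler01.
have [_ _ F01 F1] := OP y.
have [|fh fhE] := @cc_max f (F y); first by move=> x; have /andP[] := f01 x.
exists fh; split=> x.
  have /andP[a b] := f01 x; have /andP[c d] := F01 x.
  by rewrite fhE le_max a ge_max b d.
move=> z; rewrite inE fhE => /orP[/eqP->|zs] Oz.
  by rewrite F1// max_r//; have /andP[] := f01 x.
by rewrite (f1 x z)// max_l//; have /andP[] := F01 x.
Qed.

Lemma cc_ereal_measurable f :
  measurable_fun [set: borel X] (fun x : borel X => (f x)%:E).
Proof.
by apply/measurable_EFinP; apply: continuous_borel_measurable; exact: ccf_continuous.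
Qed.

Lemma integral_le_mass gamma f (A : set (borel X)) : measurable A ->
  (forall x, 0 <= f x <= 1) -> (forall x, ~ A x -> f x = 0) ->
  (\int[gamma]_x (f x)%:E <= gamma A)%E.
Proof.
move=> mA f01 f0.
have -> : gamma A = (\int[gamma]_x (\1_A x)%:E)%E.
  by rewrite integral_indic ?setIT//; exact: measurableT.
apply: ge0_le_integral => //.
- by move=> x _; rewrite lee_fin; have /andP[] := f01 x.
- exact: cc_ereal_measurable.
- by apply/measurable_EFinP; exact: measurable_indic.
- move=> x _; rewrite lee_fin indicE; case: (boolP (x \in A)) => [_|/negP xA].
    by have /andP[] := f01 x.
  by rewrite f0// => Ax; apply: xA; exact: mem_set.
Qed.

Lemma mass_le_integral gamma f (A : set (borel X)) : measurable A ->
  (forall x, 0 <= f x <= 1) -> (forall x, A x -> f x = 1) ->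
  (gamma A <= \int[gamma]_x (f x)%:E)%E.
Proof.
move=> mA f01 f1.
have -> : gamma A = (\int[gamma]_x (\1_A x)%:E)%E.
  by rewrite integral_indic ?setIT//; exact: measurableT.
apply: ge0_le_integral => //.
- by apply/measurable_EFinP; exact: measurable_indic.
- exact: cc_ereal_measurable.
- move=> x _; rewrite lee_fin indicE; case: (boolP (x \in A)) => [/set_mem/f1->//|_].
  by have /andP[] := f01 x.
Qed.

Lemma vague_eval_fin gamma f : (forall x, 0 <= f x <= 1) ->
  (vague_eval gamma f)%:E = (\int[gamma]_x (f x)%:E)%E.
Proof.
move=> f01; rewrite /vague_eval /Rintegral fineK// ge0_fin_numE; last first.
  by apply: integral_ge0 => x _; rewrite lee_fin; have /andP[] := f01 x.
apply: le_lt_trans (cmeas_compact gamma (ccf_compact (c := f))).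
apply: integral_le_mass => //; first by apply: borel_closed; exact: closed_closure.
move=> x xf; apply: contrapT => /eqP fx; apply: xf; exact: subset_closure.
Qed.

(** The total mass is lower semicontinuous: it is the supremum of the integrals
    of the compactly supported functions between 0 and 1. *)
Lemma total_mass_open k :
  open [set gamma : config R X | (k%:R%:E <= gamma [set: X])%E].
Proof.
case: k => [|k].
  rewrite (_ : [set gamma : config R X | (0%:R%:E <= gamma [set: X])%E] = setT).
    exact: openT.
  by apply/seteqP; split=> // gamma _; exact: measure_ge0.
rewrite openE => gamma /= gk.
have [_ [K [cK _] <-] kK] : exists2 e, [set cmeas gamma K | K in
    [set K : set X | compact K /\ K `<=` setT]] e & (k%:R%:E < e)%E.
  apply: (ereal_sup_gt (x := k%:R%:E)).
  rewrite -cmeas_regular; last exact: measurableT.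
  by apply: lt_le_trans gk; rewrite lte_fin ltr_nat.
have [f [f01 f1]] := cc_bump cK.
have gf : k%:R < vague_eval gamma f.
  rewrite -lte_fin vague_eval_fin//; apply: lt_le_trans kK _.
  by apply: mass_le_integral => //; exact: (compact_borel M).
have /cvgrPdist_lt := @vague_eval_continuous R X f gamma.
move=> /(_ (vague_eval gamma f - k%:R)); rewrite subr_gt0 => /(_ gf).
rewrite /interior; apply: filterS => g; rewrite ltr_norml => /andP[_].
rewrite ltrD2l ltrN2 -lte_fin vague_eval_fin// => kg.
have {}kg : (k%:R%:E < g setT)%E.
  by apply: lt_le_trans kg _; apply: integral_le_mass => // x [].
rewrite /=; have [[j gj]|->] := cmeas_integer g (@measurableT _ (borel X)); last exact: leey.
by move: kg; rewrite gj lte_fin lee_fin ltr_nat ler_nat.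
Qed.

End TotalMass.

(** * A countable network for the vague topology *)

Section Network.
Context {R : realType} {n : nat} {X : ptopologicalType} (M : smooth_manifold R n X).
Implicit Types (f : cc_fun R X) (gamma : config R X) (S : set X).

Lemma cc_supports_compact (fs : seq (cc_fun R X)) :
  compact (\bigcup_(f in [set` fs]) closure [set x | f x != 0]).
Proof.
elim: fs => [|f s IH]; first by rewrite set_nil bigcup_set0; exact: compact0.
have -> : [set` f :: s] = [set f] `|` [set` s].
  apply/seteqP; split=> z /=; rewrite inE.
    by move=> /orP[/eqP|]; [left|right].
  by move=> [->|->]; rewrite ?eqxx ?orbT.
by rewrite bigcup_setU bigcup_set1; apply: compactU => //; exact: ccf_compact.
Qed.

Lemma vague_eval_supported gamma S f (xs : seq X) : supported_on gamma S -> uniq xs ->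
  (forall x, x \in xs -> S x) -> (forall x, S x -> f x != 0 -> x \in xs) ->
  vague_eval gamma f = \sum_(x <- xs) f x.
Proof.
move=> [lS S1 S0] uxs xsS Sxs; rewrite (vague_eval_points M (xs := xs))//.
  rewrite !big_seq; apply: eq_bigr => x xxs.
  by rewrite S1 ?mulr1//; exact: xsS.
apply: (borel_sub0 _ _ _ S0).
- apply: measurableD; first exact: cc_support_measurable.
  apply: locally_finite_borel; apply: locally_finite_sub lS => x /= xs_; exact: xsS.
- by apply: measurableC; exact: locally_finite_borel.
- by move=> x /= [fx xs_] Sx; apply: xs_; exact: Sxs.
Qed.

Lemma supported_null gamma S (O : set X) : supported_on gamma S -> open O ->
  gamma O = 0%E -> forall x, O x -> ~ S x.
Proof.
move=> [lS S1 S0] oO O0 x Ox Sx.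
have : (gamma [set x] <= gamma O)%E.
  apply: borel_le; [exact: (borel_set1 M)|exact: borel_open|by move=> _ ->].
by rewrite S1// O0 lee_fin ler10.
Qed.

Lemma supported_off gamma S (A : set (borel X)) : supported_on gamma S -> measurable A ->
  (forall x, A x -> ~ S x) -> gamma A = 0%E.
Proof.
move=> [lS S1 S0] mA AS; apply: (borel_sub0 mA _ _ S0) => //.
by apply: measurableC; exact: locally_finite_borel.
Qed.

Lemma supported_one gamma S (A : set (borel X)) x : supported_on gamma S -> measurable A ->
  S x -> A x -> (forall y, A y -> S y -> y = x) -> gamma A = 1%E.
Proof.
move=> gS mA Sx Ax Ay; have [_ S1 _] := gS.
have mx := borel_set1 M x.
have mD : measurable (A `\` [set x]) by exact: measurableD.
rewrite (_ : A = [set x] `|` (A `\` [set x])); last by rewrite setDUK// => y ->.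
rewrite measureU//; last by apply/seteqP; split=> // z [-> [_ nx]]; exact: nx.
rewrite -[RHS]adde0; congr (_ + _)%E; first exact: S1.
by apply: (supported_off gS) => // y [Ay' yx] Sy; apply: yx; exact: Ay.
Qed.

Lemma supported_one_inv gamma S (A : set (borel X)) : supported_on gamma S -> measurable A ->
  gamma A = 1%E -> exists x, [/\ S x, A x & forall y, A y -> S y -> y = x].
Proof.
move=> gS mA A1; have [_ S1 _] := gS.
have [x [Sx Ax]] : exists x, S x /\ A x.
  apply/not_existsP => H.
  have A0 : gamma A = 0%E by apply: (supported_off gS) => // x Ax Sx; exact: (H x).
  by move: A1; rewrite A0 => /eqP; rewrite eq_sym onee_eq0.
exists x; split=> // y Ay Sy; apply: contrapT => yx.
have mx := borel_set1 M x; have my := borel_set1 M y.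
have : (gamma ([set x] `|` [set y]) <= gamma A)%E.
  by apply: borel_le => //; [exact: measurableU|move=> _ [->|->]].
rewrite measureU//; last by apply/seteqP; split=> // z [-> E]; apply: yx; rewrite E.
rewrite A1; have := S1 x Sx; have := S1 y Sy => /= -> ->.
by rewrite -EFinD lee_fin gerDl ler10.
Qed.

Lemma base_nbhs (b : nat -> set X) :
  (forall x (O : set X), open O -> O x -> exists k, b k x /\ b k `<=` O) ->
  forall x (A : set X), nbhs x A -> exists k, b k x /\ b k `<=` A.
Proof.
move=> bx x A; rewrite nbhsE => -[ O [oO Ox] OA]; have [k [bk bO]] := bx x O oO Ox.
by exists k; split=> //; exact: subset_trans OA.
Qed.

(** A point gets the intersection of the neighbourhoods chosen for an ordered pair
    and for its reverse, so that one family serves both points of the pair. *)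
Lemma hausdorff_sep : exists sep : X -> X -> set X,
  forall x y, x <> y -> [/\ open (sep x y), sep x y x & forall z, ~ (sep x y z /\ sep y x z)].
Proof.
have H (xy : X * X) : exists AB : set X * set X, xy.1 <> xy.2 ->
    [/\ open AB.1, open AB.2, AB.1 xy.1, AB.2 xy.2 & AB.1 `&` AB.2 = set0].
  have [E|xy12] := pselect (xy.1 = xy.2); first by exists (set0, set0).
  have := manifold_hausdorff M; rewrite open_hausdorff => /(_ xy.1 xy.2).
  move=> /(_ (introN eqP xy12)) [[A B] /= [xA yB] [oA oB AB]].
  by exists (A, B) => _; split=> //=; [exact: set_mem|exact: set_mem|exact/eqP].
have /choice[sp spP] := H.
exists (fun x y => (sp (x, y)).1 `&` (sp (y, x)).2) => x y xy.
have [/= o1 o2 x1 x2 e1] := spP (x, y) xy.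
have [/= o3 o4 x3 x4 e2] := spP (y, x) (fun E => xy (esym E)).
split=> //; first exact: openI.
move=> z [[z1 _] [_ z2]]; suff : set0 z by [].
by rewrite -e1; split.
Qed.

(** This takes the place of second countability of the vague topology. The set
    with index [(s, t)] prescribes mass 1 on the basic open sets in [s] and mass 0
    on those in [t]. Around [gamma], take for [s] small disjoint neighbourhoods of
    the finitely many atoms in the support of the test functions, and for [t] a
    finite null cover of the rest of that support: every configuration with unit
    atoms that satisfies these constraints has exactly one atom near each atom of
    [gamma] and none elsewhere in the support. *)
Lemma countable_network : exists N : seq nat * seq nat -> set (config R X),
  forall gamma S (U : set (config R X)), supported_on gamma S -> open U -> U gamma ->
  exists i, N i gamma /\
    forall gamma' S', supported_on gamma' S' -> N i gamma' -> U gamma'.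
Proof.
have [b [bo /base_nbhs bx]] := countable_base M.
exists (fun i => [set gamma | (forall k, k \in i.1 -> gamma (b k) = 1%E) /\
                          (forall k, k \in i.2 -> gamma (b k) = 0%E)]).
move=> gamma S U gS oU Ug; have [lS S1 S0] := gS.
have [fs [e [e0 fsU]]] := vague_basis oU Ug.
pose K := \bigcup_(f in [set` fs]) closure [set x | f x != 0].
have cK : compact K := @cc_supports_compact fs.
have fK f x : f \in fs -> f x != 0 -> K x.
  by move=> ff fx; exists f => //; exact: subset_closure.
have /finite_seqP[xs0 xs0E] := locally_finite_compact lS cK.
pose xs := undup xs0.
have uxs : uniq xs by exact: undup_uniq.
have xsP x : x \in xs <-> S x /\ K x.
  rewrite mem_undup; have -> : (x \in xs0) = (x \in [set` xs0] :> bool).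
    by apply/idP/idP => H; [exact: mem_set|exact: set_mem H].
  by rewrite -xs0E; split=> [/set_mem[]|H]; [|exact: mem_set].
have [sep sepP] := hausdorff_sep.
pose d := e / (size xs).+1%:R.
have d0 : 0 < d by rewrite divr_gt0.
pose P x := [set z | [/\ S z -> z = x,
   forall y, y \in xs -> x <> y -> sep x y z &
   forall f, f \in fs -> `|f x - f z| < d]].
have Pnb x : nbhs x (P x).
  have [ O [oO Ox OS]] := lS x.
  have n1 : \forall z \near x, S z -> z = x.
    by apply: filterS (open_nbhs_nbhs (conj oO Ox)) => z Oz; exact: OS.
  have n2 : \forall z \near x, forall y, y \in xs -> x <> y -> sep x y z.
    apply: near_all_seq => y _; have [E|xy] := pselect (x = y).
      by apply: filterE => z /(_ E).
    have [os sx _] := sepP x y xy.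
    by apply: filterS (open_nbhs_nbhs (conj os sx)).
  have n3 : \forall z \near x, forall f, f \in fs -> `|f x - f z| < d.
    apply: near_all_seq => f _.
    by have /cvgrPdist_lt/(_ d d0) := @ccf_continuous _ _ f x.
  by apply: filterS3 n1 n2 n3 => z; split.
have /choice[ix ixP] : forall x, exists k, b k x /\ b k `<=` P x by move=> x; exact: bx.
pose W := K `\` \bigcup_(x in [set` xs]) b (ix x).
have cW : compact W.
  have oB : open (\bigcup_(x in [set` xs]) b (ix x)) by apply: bigcup_open => x _; exact: bo.
  by rewrite /W setDE; apply: compact_closedI => //; exact: open_closedC.
move: cW; rewrite compact_cover => cW.
have [k /= _|z [Kz nbz]|T Tnull WT] := cW nat [set k | gamma (b k) = 0%E] b.
- exact: bo.
- have Sz : ~ S z.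
    move=> Sz; apply: nbz; exists z; first by apply/xsP.
    by have [] := ixP z.
  have [ O [oO Oz OS]] := lS z.
  have [k [bk bkO]] := bx z O (open_nbhs_nbhs (conj oO Oz)).
  exists k => //=; apply: (supported_off gS); first exact: borel_open.
  by move=> y /bkO Oy Sy; apply: Sz; rewrite -(OS y Oy Sy).
exists ([seq ix x | x <- xs], finmap.enum_fset T); split.
- split=> /= k.
    move=> /mapP[x xxs ->]; have [bxx bP] := ixP x.
    apply: (supported_one gS (x := x)) => //; first exact: borel_open.
      by have [] := (xsP x).1 xxs.
    by move=> y /bP[+ _ _] => H Sy; exact: H.
  by move=> /Tnull; rewrite inE.
move=> gamma' S' gS' /= [N1 N0].
have /choice[pt ptP] : forall x, exists x', x \in xs ->
    [/\ S' x', b (ix x) x' & forall y, b (ix x) y -> S' y -> y = x'].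
  move=> x; have [xxs|] := boolP (x \in xs); last by exists x.
  have [x' H] := supported_one_inv gS' (borel_open (bo (ix x))) (N1 _ (map_f ix xxs)).
  by exists x'.
have uxs' : uniq (map pt xs).
  rewrite map_inj_in_uniq// => x y xxs yxs E; apply: contrapT => xy.
  have [_ bx' _] := ptP x xxs; have [_ by' _] := ptP y yxs.
  have [_ /(_ _ bx')[_ /(_ y yxs xy) s1 _]] := ixP x.
  have [_ /(_ _ by')[_ /(_ x xxs (fun E' => xy (esym E'))) s2 _]] := ixP y.
  have [_ _ /(_ (pt x))] := sepP x y xy; apply.
  by split=> //; rewrite E.
apply: fsU => f ff.
rewrite (vague_eval_supported (xs := xs) gS)//; first last.
- by move=> x Sx fx; apply/xsP; split=> //; exact: fK fx.
- by move=> x /xsP[].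
rewrite (vague_eval_supported (xs := map pt xs) gS')//; first last.
- move=> x Sx fx; have Kx := fK f x ff fx.
  have [[y yxs bxy]|nb] := pselect ((\bigcup_(x in [set` xs]) b (ix x)) x).
    by have [_ _ H] := ptP y yxs; rewrite (H x bxy Sx); exact: map_f.
  have [k Tk bkx] := WT x (conj Kx nb).
  by exfalso; apply: (supported_null gS' (bo k) (N0 k Tk) bkx).
- by move=> _ /mapP[x xxs ->]; have [] := ptP x xxs.
rewrite big_map -sumrB; apply: le_lt_trans (ler_norm_sum _ _ _) _.
apply: (@le_lt_trans _ _ (\sum_(x <- xs) d)).
  rewrite !big_seq; apply: ler_sum => x xxs; apply: ltW.
  have [_ bx' _] := ptP x xxs.
  by have [_ /(_ _ bx')[_ _ /(_ f ff)]] := ixP x.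
rewrite big_const_seq count_predT iter_addr_0 -mulr_natl /d mulrCA.
by rewrite gtr_pMr// ltr_pdivrMr// mul1r ltr_nat.
Qed.

End Network.

(** * Moving one point of a configuration *)

Lemma connected_locally_constant (T : topologicalType) (Q : T -> Prop) (C : set T) :
  connected C ->
  (forall x, C x -> exists O, [/\ open O, O x & forall y z, O y -> O z -> Q y -> Q z]) ->
  forall x y, C x -> C y -> Q x -> Q y.
Proof.
move=> cC lQ x y Cx Cy Qx.
pose A := [set z | exists O, [/\ open O, O z & forall w, O w -> Q w]].
pose A' := [set z | exists O, [/\ open O, O z & forall w, O w -> ~ Q w]].
have oA : open A.
  by rewrite openE => z [ O [oO Oz OQ]]; apply: filterS (open_nbhs_nbhs (conj oO Oz)) => w Ow; exists O.
have oA' : open A'.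
  by rewrite openE => z [ O [oO Oz OQ]]; apply: filterS (open_nbhs_nbhs (conj oO Oz)) => w Ow; exists O.
have AA' z : C z -> A z \/ A' z.
  move=> /lQ[ O [oO Oz OQ]]; have [Qz|nQz] := pselect (Q z).
    by left; exists O; split=> // w Ow; exact: OQ Qz.
  by right; exists O; split=> // w Ow /(OQ w z Ow Oz).
have AQ z : A z -> Q z by move=> [ O [_ Oz H]]; exact: H.
have A'Q z : A' z -> ~ Q z by move=> [ O [_ Oz H]]; exact: H.
suff : C `&` A = C by move=> E; apply: AQ; have [] : (C `&` A) y by rewrite E.
apply: cC.
- by exists x; split=> //; have [//|/A'Q] := AA' x Cx.
- by exists A.
- exists (~` A'); first by rewrite closedC.
  apply/seteqP; split=> z [Cz Az]; split=> //.
    by move=> A'z; exact: A'Q A'z (AQ _ Az).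
  by have [//|] := AA' z Cz.
Qed.

Section Moves.
Context {R : realType} {n : nat} {X : ptopologicalType} (M : smooth_manifold R n X).
(** [Z] is a set of configurations that contains a configuration as soon as it
    contains its image under some flow; the set of points that have a null open
    neighbourhood is the case of interest. *)
Variable Z : config R X -> Prop.
Hypothesis Zinv : forall (V : vector_field M) (psi : R -> homeo X),
  compact (vf_support V) -> is_flow V psi ->
  forall t gamma, Z (conf_push gamma (psi t)) -> Z gamma.
Implicit Types (F S : set X).

Definition all_in S : Prop := forall gamma, supported_on gamma S -> Z gamma.

(** The coordinates of [y] are changed into those of [z] one after the other, and
    the flows used do not move the points of [F]. *)
Lemma all_in_box c (p : 'rV[R]_n) r F y z : atlas M c -> 0 < r ->
  (forall w, `|w - p| <= r -> cimg c w) ->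
  (forall x, F x -> ~ (cdom c x /\ `|c x - p| < r)) ->
  `|y - p| < r -> `|z - p| < r ->
  all_in (cinv c z |` F) -> all_in (cinv c y |` F).
Proof.
move=> Mc r0 sub Fout yr zr Pz.
pose w k : 'rV[R]_n := \row_j (if (j < k)%N then z 0 j else y 0 j).
have w0 : w 0%N = y by apply/rowP => j; rewrite mxE.
have wn : w n = z by apply/rowP => j; rewrite mxE ltn_ord.
have wr k : `|w k - p| < r.
  apply/(rV_norm_ltP (w k - p) r0) => j; rewrite !mxE.
  have /(rV_norm_ltP (y - p) r0)/(_ j) := yr; have /(rV_norm_ltP (z - p) r0)/(_ j) := zr.
  by rewrite !mxE; case: ifP.
have step (i : 'I_n) : all_in (cinv c (w i.+1) |` F) -> all_in (cinv c (w i) |` F).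
  move=> Pi gamma gS.
  have wE j : j != i -> w i 0 j = w i.+1 0 j.
    by move=> ji; rewrite !mxE [(j < i.+1)%N]ltnS [(j <= i)%N]leq_eqVlt (negbTE (ji : j != i :> nat)).
  have [V [psi [t [cV fV psiw psiout]]]] := box_move Mc r0 sub (wr i) (wr i.+1) wE.
  apply: (Zinv cV fV (t := t)); apply: Pi.
  rewrite (_ : cinv c (w i.+1) |` F = psi t @` (cinv c (w i) |` F)).
    exact: supported_push.
  rewrite image_setU image_set1 psiw; congr (_ `|` _).
  apply/seteqP; split=> [x Fx|_ [x Fx <-]].
    by exists x => //; apply: psiout; exact: Fout.
  by rewrite psiout//; exact: Fout.
rewrite -w0; rewrite -wn in Pz; move: Pz.
suff H k : (k <= n)%N -> all_in (cinv c (w k) |` F) -> all_in (cinv c (w 0%N) |` F).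
  exact: H.
elim: k => // k IH kn Pk; apply: IH; first exact: ltnW.
exact: (step (Ordinal kn)).
Qed.

Lemma all_in_local F x : locally_finite F -> ~ F x ->
  exists O, [/\ open O, O x & forall y z, O y -> O z ->
    all_in (y |` F) -> all_in (z |` F)].
Proof.
move=> lF Fx.
have oF : open (~` F) by rewrite openC; exact: locally_finite_closed.
have [c [r [Mc cx r0 sub]]] := small_box M oF Fx.
exists (chart_ball c x r); split.
- exact: chart_ball_open.
- by split=> //; rewrite subrr normr0.
- move=> y z [cy yr] [cz zr]; rewrite -{1}(cmapK cy) -{1}(cmapK cz).
  apply: (all_in_box Mc r0 _ _ zr yr).
    by move=> w wr; have [] := sub w wr.
  move=> w Fw [cw wr]; have [_] := sub _ (ltW wr).
  by rewrite cmapK.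
Qed.

Lemma all_in_connected F (C : set X) x y : locally_finite F -> connected C ->
  (forall z, C z -> ~ F z) -> C x -> C y ->
  all_in (x |` F) -> all_in (y |` F).
Proof.
move=> lF cC CF; apply: (@connected_locally_constant _ (fun x => all_in (x |` F)) C) => //.
by move=> z /CF; exact: all_in_local.
Qed.

End Moves.

(** * Avoiding a locally finite set *)

Section NoIsolatedPoints.
Context {R : realType} {n : nat} {X : ptopologicalType} (M : smooth_manifold R n.+1 X).
Implicit Types (F O : set X).

Lemma open_avoid F O x : locally_finite F -> open O -> O x ->
  exists w, O w /\ ~ F w.
Proof.
move=> lF oO Ox; have [ O' [oO' Ox' FO']] := lF x.
have [c [r [Mc cx r0 sub]]] := small_box M (openI oO oO') (conj Ox Ox').
pose w := c x + r *: delta_mx 0 ord0.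
have wr : `|w - c x| <= r.
  rewrite /w addrAC subrr add0r; apply/(rV_normP _ (ltW r0)) => j.
  rewrite !mxE eqxx/=; case: (_ == _); rewrite ?mulr1 ?mulr0 ?normr0 ?(ltW r0)//.
  by rewrite gtr0_norm.
have [cw [Ow Ow']] := sub w wr.
exists (cinv c w); split=> // Fw.
have := FO' _ Ow' Fw; move/(congr1 c); rewrite cinvK// => /(congr1 (fun v : 'rV_n.+1 => v 0 ord0)).
by rewrite /w !mxE !eqxx/= mulr1 => /eqP; rewrite -subr_eq0 addrAC subrr add0r gt_eqF.
Qed.

Lemma locally_finite_setU_seq F (s : seq X) : locally_finite F ->
  locally_finite ([set` s] `|` F).
Proof.
move=> lF; elim: s => [|x s IH]; first by rewrite set_nil set0U.
have -> : [set` x :: s] `|` F = x |` ([set` s] `|` F).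
  apply/seteqP; split=> z /=; rewrite inE.
    by move=> [/orP[/eqP|]|]; [left|right; left|right; right].
  by move=> [->|[->|]]; rewrite ?eqxx ?orbT; [left|left|right].
exact: locally_finite_setU1 (manifold_hausdorff M) IH.
Qed.

End NoIsolatedPoints.

Section HigherDimension.
Context {R : realType} {n : nat} {X : ptopologicalType} (M : smooth_manifold R n.+2 X).
Variable Q : X -> Prop.
Variable F : set X.
Hypothesis lF : locally_finite F.
Hypothesis Q_local : forall x, ~ F x ->
  exists O, [/\ open O, O x & forall y z, O y -> O z -> Q y -> Q z].
Hypothesis X_connected : connected [set: X].

(** The condition on the coordinate [i] says that both ends lie strictly on the
    same side of [p] in that direction, so that the segment avoids [p]. *)
Lemma segment_const (c : chart R n.+2 X) (p : 'rV[R]_n.+2) r (u v : 'rV[R]_n.+2) i :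
  0 < r -> (forall y, `|y - p| <= r -> cimg c y) ->
  (forall y, `|y - p| < r -> F (cinv c y) -> y = p) ->
  `|u - p| < r -> `|v - p| < r -> 0 < (u - p) 0 i * (v - p) 0 i ->
  Q (cinv c u) -> Q (cinv c v).
Proof.
move=> r0 sub Fp ur vr uvi.
pose s (t : R) := u + t *: (v - u).
have sr t : t \in `[0, 1]%R -> `|s t - p| < r.
  rewrite in_itv/= => /andP[t0 t1].
  have -> : s t - p = (1 - t) *: (u - p) + t *: (v - p).
    by apply/rowP => j; rewrite !mxE; ring.
  apply: le_lt_trans (ler_normD _ _) _; rewrite !normrZ ger0_norm ?subr_ge0//.
  rewrite (ger0_norm t0); pose m := Num.max `|u - p| `|v - p|.
  have mr : m < r by rewrite gt_max ur vr.
  have um : `|u - p| <= m by rewrite le_max lexx.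
  have vm : `|v - p| <= m by rewrite le_max lexx orbT.
  have t1' : 0 <= 1 - t by rewrite subr_ge0.
  have := ler_wpM2l t1' um; have := ler_wpM2l t0 vm; lra.
have cs : {within `[0, 1]%classic, continuous (cinv c \o s)}.
  apply: continuous_in_subspaceT => t /set_mem/= tI.
  apply: (@continuous_comp _ _ _ s); last first.
    by apply: cinv_continuous; apply: sub; apply: ltW; exact: sr.
  have c1 : {for t, continuous (fun=> u : 'rV[R]_n.+2)} by exact: cst_continuous.
  have c2 : {for t, continuous (fun t : R => t)} by exact: cvg_id.
  have c3 : {for t, continuous (fun _ : R => v - u)} by exact: cst_continuous.
  exact: (cvgD c1 (cvgZ c2 c3)).
have cC := connected_continuous_connected (@segment_connected R 0 1) cs.
have -> : cinv c u = (cinv c \o s) 0 by rewrite /s/= scale0r addr0.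
have -> : cinv c v = (cinv c \o s) 1 by rewrite /s/= scale1r addrC subrK.
apply: (connected_locally_constant cC).
- move=> _ [t tI <-]; apply: Q_local => /= Fst.
  have := Fp _ (sr t tI) Fst; rewrite /s => /(congr1 (fun w : 'rV_n.+2 => w 0 i)).
  move: tI uvi; rewrite !mxE /= in_itv/= => /andP[t0 t1].
  set a := u 0 i - p 0 i; set b := v 0 i - p 0 i => ab E.
  have E0 : a + t * (b - a) = 0.
    have -> : a + t * (b - a) = u 0 i + t * (v 0 i - u 0 i) - p 0 i by rewrite /a /b; ring.
    by rewrite E subrr.
  have a0 : a != 0 by apply/eqP => a0; move: ab; rewrite a0 mul0r ltxx.
  have aa : 0 < a * a by rewrite -expr2 exprn_even_gt0.
  have K : (1 - t) * (a * a) + t * (a * b) = 0.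
    by rewrite -[RHS](mulr0 a) -[in RHS]E0; ring.
  have := mulr_ge0 t0 (ltW ab); have t1' : 0 <= 1 - t by rewrite subr_ge0.
  have := mulr_ge0 t1' (ltW aa).
  have [tE|tn0] := eqVneq t 0; first by move: K; rewrite tE; lra.
  have : 0 < t * (a * b) by rewrite mulr_gt0// lt_neqAle eq_sym tn0.
  lra.
- by exists 0 => //=; rewrite in_itv/= lexx ler01.
- by exists 1 => //=; rewrite in_itv/= lexx ler01.
Qed.

Lemma punctured_box_const (c : chart R n.+2 X) (p : 'rV[R]_n.+2) r (u v : 'rV[R]_n.+2) :
  0 < r -> (forall y, `|y - p| <= r -> cimg c y) ->
  (forall y, `|y - p| < r -> F (cinv c y) -> y = p) ->
  `|u - p| < r -> `|v - p| < r -> u <> p -> v <> p ->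
  Q (cinv c u) -> Q (cinv c v).
Proof.
move=> r0 sub Fp.
have seg := segment_const r0 sub Fp.
have r20 : 0 < r / 2 by rewrite divr_gt0.
have corner (a : 'I_n.+2 -> bool) : `|(p + \row_j (if a j then r / 2 else - (r / 2))) - p| < r.
  rewrite addrAC subrr add0r; apply/(rV_norm_ltP _ r0) => j; rewrite mxE.
  case: (a j); rewrite ?normrN gtr0_norm//; lra.
pose q := p + \row_j (if true then r / 2 else - (r / 2)).
have qr : `|q - p| < r := corner (fun=> true).
have qE j : (q - p) 0 j = r / 2 by rewrite /q !mxE addrAC subrr add0r.
suff H w : `|w - p| < r -> w <> p -> (Q (cinv c w) -> Q (cinv c q)) /\ (Q (cinv c q) -> Q (cinv c w)).
  by move=> ur vr up vp Qu; apply: (H v vr vp).2; apply: (H u ur up).1.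
move=> wr wp.
have [i wi] : exists i, (w - p) 0 i != 0.
  apply: contrapT => /forallNP Hn; apply: wp; apply/eqP; rewrite -subr_eq0; apply/eqP/rowP => j.
  by rewrite [RHS]mxE; apply/eqP/negPn/negP; exact: Hn.
have [wi0|wi0|wi0] := ltgtP ((w - p) 0 i) 0; last by rewrite wi0 eqxx in wi.
- (* the corner which is below p in direction i and above p in all others
     lies in a half-space with w, and in another one with q *)
  pose k : 'I_n.+2 := if i == ord0 then lift ord0 ord0 else ord0.
  have ki : k != i.
    by rewrite /k; case: (eqVneq i ord0) => [->//|]; rewrite eq_sym.
  pose m := p + \row_j (if j != i then r / 2 else - (r / 2)).
  have mr : `|m - p| < r := corner (fun j => j != i).
  have mi : (m - p) 0 i = - (r / 2) by rewrite /m !mxE addrAC subrr add0r eqxx.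
  have mk : (m - p) 0 k = r / 2 by rewrite /m !mxE addrAC subrr add0r ki.
  split=> [Qw|Qq].
    apply: (seg m q k) => //; first by rewrite mk qE mulr_gt0.
    by apply: (seg w m i) => //; rewrite mi nmulr_rgt0// oppr_lt0.
  apply: (seg m w i) => //; first by rewrite mi nmulr_rgt0// oppr_lt0.
  by apply: (seg q m k) => //; rewrite mk qE mulr_gt0.
- by split; [apply: (seg w q i)|apply: (seg q w i)] => //; rewrite qE mulr_gt0.
Qed.

(** In dimension at least two, removing a locally finite set does not disconnect
    the manifold: a small punctured box around a removed point is still connected,
    so that a locally constant [Q] extends across the point. *)
Lemma locally_finite_complement_const x y : ~ F x -> ~ F y -> Q x -> Q y.
Proof.
move=> Fx Fy Qx.
have loc p : exists O, [/\ open O, O p &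
    forall y z, O y -> O z -> ~ F y -> ~ F z -> Q y -> Q z].
  have [Fp|nFp] := pselect (F p); last first.
    have [ O [oO Op OQ]] := Q_local nFp; exists O; split=> // w z Ow Oz _ _; exact: OQ.
  have [ O [oO Op OF]] := lF p.
  have [c [r [Mc cp r0 sub]]] := small_box M oO Op.
  exists (chart_ball c p r); split.
  - exact: chart_ball_open.
  - by split=> //; rewrite subrr normr0.
  - move=> w z [cw wr] [cz zr] Fw Fz.
    rewrite -{1}(cmapK cw) -{1}(cmapK cz).
    apply: (@punctured_box_const c (c p) r) => //.
    + by move=> v vr; have [] := sub v vr.
    + move=> v vr Fv; have [cv Ov] := sub v (ltW vr).
      by rewrite -(OF _ Ov Fv) cinvK.
    + by move=> E; apply: Fw; rewrite -(cmapK cw) E cmapK.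
    + by move=> E; apply: Fz; rewrite -(cmapK cz) E cmapK.
pose Q' z := exists O, [/\ open O, O z & forall w, O w -> ~ F w -> Q w].
suff [ O [_ Oy]] : Q' y by apply.
apply: (@connected_locally_constant _ Q' setT X_connected _ x) => //; last first.
  have [ O [oO Ox OQ]] := Q_local Fx; exists O; split=> // w Ow _; exact: OQ Qx.
move=> p _; have [ O [oO Op OQ]] := loc p; exists O; split=> // u v Ou Ov [ O' [oO' Ou' OQ']].
have [w [[Ow Ow'] Fw]] := open_avoid M lF (openI oO oO') (conj Ou Ou').
exists O; split=> // z Oz Fz; apply: (OQ w z) => //; exact: OQ'.
Qed.

End HigherDimension.

(** * Exchanging finite sets of points *)

Section Exchange.
Context {R : realType} {X : ptopologicalType}.
Implicit Types (F : set X) (xs ys : seq X).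

Lemma setU_cons (x : X) xs F : [set` x :: xs] `|` F = x |` ([set` xs] `|` F).
Proof.
apply/seteqP; split=> z /=; rewrite inE.
  by move=> [/orP[/eqP|]|]; [left|right; left|right; right].
by move=> [->|[->|]]; rewrite ?eqxx ?orbT; [left|left|right].
Qed.

Lemma setU_cons_r (x : X) xs F : [set` x :: xs] `|` F = [set` xs] `|` (x |` F).
Proof. by rewrite setU_cons setUCA. Qed.

(** Points are moved one after the other to their targets; a target that already
    is one of the points stays where it is. *)
Lemma exchange_higher n (M : smooth_manifold R n.+2 X) (Z : config R X -> Prop)
    (Zinv : forall (V : vector_field M) (psi : R -> homeo X),
      compact (vf_support V) -> is_flow V psi ->
      forall t gamma, Z (conf_push gamma (psi t)) -> Z gamma) F xs ys :
  connected [set: X] -> locally_finite F -> uniq xs -> uniq ys -> size xs = size ys ->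
  (forall x, x \in xs -> ~ F x) -> (forall y, y \in ys -> ~ F y) ->
  all_in Z ([set` ys] `|` F) -> all_in Z ([set` xs] `|` F).
Proof.
move=> cX.
elim: {xs}(size xs) {-2}xs (erefl (size xs)) ys F => [|m IH] xs sxs ys F lF uxs uys.
  by rewrite sxs => /esym/size0nil ->; rewrite (size0nil sxs).
case: ys uys => [|y ys] /=; first by rewrite sxs.
move=> /andP[yys uys]; rewrite sxs => -[sys] xsF ysF Pys.
have hX := manifold_hausdorff M.
have lFy : locally_finite (y |` F) by exact: locally_finite_setU1.
have ysFy z : z \in ys -> ~ (y |` F) z.
  move=> zys [/= zy|]; first by rewrite -zy zys in yys.
  by apply: ysF; rewrite inE zys orbT.
rewrite setU_cons_r in Pys.
have [yxs|yxs] := boolP (y \in xs).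
  have -> : [set` xs] `|` F = [set` rem y xs] `|` (y |` F).
    rewrite -setU_cons_r; congr (_ `|` _); apply/seteqP; split=> z /=.
      by rewrite (perm_mem (perm_to_rem yxs)).
    by rewrite (perm_mem (perm_to_rem yxs)).
  apply: (IH _ _ ys) => //.
  - by rewrite size_rem// sxs.
  - exact: rem_uniq.
  - by rewrite size_rem// sxs.
  - move=> z; rewrite mem_rem_uniq// !inE => /andP[/eqP zy zxs] [//|].
    exact: xsF.
case: xs sxs uxs xsF yxs => [//|x xs] /= [sxs] /andP[xxs uxs] xsF.
rewrite inE negb_or => /andP[yx yxs].
have Pxs : all_in Z ([set` xs] `|` (y |` F)).
  apply: (IH _ sxs ys) => //; first by rewrite sxs.
  move=> z zxs [/= zy|]; first by rewrite -zy zxs in yxs.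
  by apply: xsF; rewrite inE zxs orbT.
rewrite -setU_cons_r setU_cons in Pxs; rewrite setU_cons.
have lFxs : locally_finite ([set` xs] `|` F) by exact: (locally_finite_setU_seq M).
apply: (@locally_finite_complement_const _ _ _ M
  (fun x => all_in Z (x |` ([set` xs] `|` F))) ([set` xs] `|` F) lFxs _ cX y x _ _ Pxs).
- by move=> z; exact: (all_in_local Zinv).
- by move=> [/= yxs'|]; [rewrite yxs' in yxs|apply: ysF; rewrite mem_head].
- by move=> [/= xxs'|]; [rewrite xxs' in xxs|apply: xsF; rewrite mem_head].
Qed.

End Exchange.

Section ExchangeLine.
Context {R : realType} {X : ptopologicalType} (M : smooth_manifold R 1 X).
Variable c : chart R 1 X.
Hypotheses (cT : cdom c = setT) (ciT : cimg c = setT).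
Variable Z : config R X -> Prop.
Hypothesis Zinv : forall (V : vector_field M) (psi : R -> homeo X),
  compact (vf_support V) -> is_flow V psi ->
  forall t gamma, Z (conf_push gamma (psi t)) -> Z gamma.
Implicit Types (F : set X).

Definition line_pt (s : R) : X := cinv c (const_mx s).

Definition line_coord (x : X) : R := c x 0 0.

Lemma line_ptK : cancel line_pt line_coord.
Proof. by move=> s; rewrite /line_coord /line_pt cinvK ?ciT// mxE. Qed.

Lemma line_coordK : cancel line_coord line_pt.
Proof.
move=> x; rewrite /line_pt /line_coord -[RHS](@cmapK _ _ _ c) ?cT//.
by congr (cinv c _); apply/rowP => i; rewrite mxE ord1.
Qed.

Lemma line_pt_continuous : continuous line_pt.
Proof.
move=> s; apply: (@continuous_comp _ _ _ (fun s : R => const_mx s : 'rV[R]_1)); last first.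
  by apply: cinv_continuous; rewrite -/(cimg c) ciT.
have -> : (fun s : R => const_mx s : 'rV[R]_1) = (fun s => s *: const_mx 1).
  by apply/funext => t; apply/rowP => i; rewrite !mxE mulr1.
have c2 : {for s, continuous (fun t : R => t)} by exact: cvg_id.
have c3 : {for s, continuous (fun _ : R => const_mx 1 : 'rV[R]_1)} by exact: cst_continuous.
exact: (cvgZ c2 c3).
Qed.

Lemma line_move F s t : locally_finite F -> s <= t ->
  (forall w, s <= w <= t -> ~ F (line_pt w)) ->
  (all_in Z (line_pt s |` F) -> all_in Z (line_pt t |` F)) /\
  (all_in Z (line_pt t |` F) -> all_in Z (line_pt s |` F)).
Proof.
move=> lF st FI.
have cC : connected (line_pt @` `[s, t]%classic).
  apply: connected_continuous_connected; first exact: segment_connected.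
  by apply: continuous_subspaceT; exact: line_pt_continuous.
have CF z : (line_pt @` `[s, t]%classic) z -> ~ F z.
  by move=> [w /=]; rewrite in_itv/= => sw <-; exact: FI.
have Cs : (line_pt @` `[s, t]%classic) (line_pt s).
  by exists s => //=; rewrite in_itv/= lexx st.
have Ct : (line_pt @` `[s, t]%classic) (line_pt t).
  by exists t => //=; rewrite in_itv/= lexx st.
by split; exact: (all_in_connected Zinv lF cC CF).
Qed.

(** On the line points cannot pass each other: increasing lists are matched in
    order, and of the two smallest points the larger one is moved down. *)
Lemma exchange_sorted F l u (xs ys : seq R) : locally_finite F ->
  (forall w, l < w < u -> ~ F (line_pt w)) ->
  sorted <%R xs -> sorted <%R ys -> size xs = size ys ->
  (forall x, x \in xs -> l < x < u) -> (forall y, y \in ys -> l < y < u) ->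
  all_in Z ([set` map line_pt ys] `|` F) -> all_in Z ([set` map line_pt xs] `|` F).
Proof.
have hX := manifold_hausdorff M.
elim: xs ys F l => [|x xs IH] [|y ys] F l //= lF FI pxs pys [sxy] xsI ysI Py.
have sxs := path_sorted pxs; have sys := path_sorted pys.
have xlt z : z \in xs -> x < z.
  by move=> zxs; have /allP/(_ _ zxs) := order_path_min lt_trans pxs.
have ylt z : z \in ys -> y < z.
  by move=> zys; have /allP/(_ _ zys) := order_path_min lt_trans pys.
have /andP[lx xu] := xsI x (mem_head _ _).
have /andP[ly yu] := ysI y (mem_head _ _).
have xsu z : z \in xs -> z < u.
  by move=> zxs; have /andP[] : l < z < u by apply: xsI; rewrite inE zxs orbT.
have ysu z : z \in ys -> z < u.
  by move=> zys; have /andP[] : l < z < u by apply: ysI; rewrite inE zys orbT.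
(* both lists avoid F together with the smaller of the two first points *)
have lF' w : locally_finite (line_pt w |` F) by exact: locally_finite_setU1.
have FI' w : l < w -> forall v, w < v < u -> ~ (line_pt w |` F) (line_pt v).
  move=> lw v /andP[wv vu] [/= /(can_inj line_ptK) vw|].
    by rewrite vw ltxx in wv.
  by apply: FI; rewrite (lt_trans lw wv).
have mv (zs : seq R) s t : l < s -> s <= t -> t < u -> (forall z, z \in zs -> t < z) ->
    forall w, s <= w <= t -> ~ ([set` map line_pt zs] `|` F) (line_pt w).
  move=> ls st tu tzs w /andP[sw wt] [/= /mapP[z zzs /(can_inj line_ptK) wz]|].
    by have := tzs z zzs; rewrite -wz ltNge wt.
  by apply: FI; rewrite (lt_le_trans ls sw) (le_lt_trans wt tu).
have [yx|xy] := leP y x.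
- rewrite setU_cons.
  apply: (line_move _ yx (mv xs _ _ ly yx xu xlt)).1.
    exact: (locally_finite_setU_seq M).
  rewrite -setU_cons setU_cons_r; apply: (IH ys _ y) => //; first exact: FI'.
  + by move=> z zxs; rewrite (le_lt_trans yx (xlt z zxs)) xsu.
  + by move=> z zys; rewrite ylt ?ysu.
  + by rewrite -setU_cons_r.
- rewrite setU_cons_r; apply: (IH ys _ x) => //; first exact: FI'.
  + by move=> z zxs; rewrite xlt ?xsu.
  + by move=> z zys; rewrite (lt_trans xy (ylt z zys)) ysu.
  + rewrite -setU_cons_r setU_cons.
    apply: (line_move _ (ltW xy) (mv ys _ _ lx (ltW xy) yu ylt)).2.
      exact: (locally_finite_setU_seq M).
    by rewrite -setU_cons.
Qed.

Lemma exchange_line F l u (xs ys : seq X) : locally_finite F ->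
  (forall x, l < line_coord x < u -> ~ F x) ->
  uniq xs -> uniq ys -> size xs = size ys ->
  (forall x, x \in xs -> l < line_coord x < u) ->
  (forall y, y \in ys -> l < line_coord y < u) ->
  all_in Z ([set` ys] `|` F) -> all_in Z ([set` xs] `|` F).
Proof.
move=> lF FI.
pose srt (zs : seq X) := sort <=%R (map line_coord zs).
have srtE zs : [set` zs] = [set` map line_pt (srt zs)].
  apply/seteqP; split=> z /=.
    move=> zzs; apply/mapP; exists (line_coord z); last by rewrite line_coordK.
    by rewrite mem_sort map_f.
  by move=> /mapP[s]; rewrite mem_sort => /mapP[w wzs ->] ->; rewrite line_coordK.
have srtS zs : uniq zs -> sorted <%R (srt zs).
  move=> uzs; rewrite sort_lt_sorted map_inj_uniq//; exact: (can_inj line_coordK).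
have srtI zs : (forall x, x \in zs -> l < line_coord x < u) ->
    forall x, x \in srt zs -> l < x < u.
  by move=> H x; rewrite mem_sort => /mapP[z zzs ->]; exact: H.
move=> uxs uys sxy xsI ysI; rewrite !(srtE xs) !(srtE ys).
apply: (exchange_sorted (l := l) (u := u)) => //.
- by move=> w wI; apply: FI; rewrite line_ptK.
- exact: srtS.
- exact: srtS.
- by rewrite !size_sort !size_map.
- exact: srtI.
- exact: srtI.
Qed.

End ExchangeLine.

(** * Approximating a configuration *)

Section Approximation.
Context {R : realType} {n : nat} {X : ptopologicalType} (M : smooth_manifold R n.+1 X).
Implicit Types (f : cc_fun R X) (gamma : config R X) (F I K : set X).

Lemma finite_avoid (O : set X) (s : seq X) x : open O -> O x ->
  exists w, O w /\ w \notin s.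
Proof.
have l0 : locally_finite (set0 : set X) by move=> y; exists setT; split=> //; exact: openT.
have := locally_finite_setU_seq M s l0; rewrite setU0 => ls oO Ox.
by have [w [Ow /negP ws]] := open_avoid M ls oO Ox; exists w.
Qed.

Lemma perturb_points (I : set X) (fs : seq (cc_fun R X)) (d : R) (ts : seq X) :
  open I -> 0 < d -> (forall t, t \in ts -> I t) ->
  exists ys : seq X, [/\ uniq ys, size ys = size ts, forall y, y \in ys -> I y &
    forall f, f \in fs -> `|\sum_(t <- ts) f t - \sum_(y <- ys) f y| <= d *+ size ts].
Proof.
move=> oI d0; elim: ts => [|t ts IH] tsI.
  by exists [::]; split=> // f _; rewrite !big_nil subrr normr0.
have [|ys [uys sys ysI ysf]] := IH; first by move=> z zts; apply: tsI; rewrite inE zts orbT.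
have nt : nbhs t (I `&` [set z | forall f, f \in fs -> `|f t - f z| < d]).
  apply: filterI; first by apply: open_nbhs_nbhs; split=> //; apply: tsI; exact: mem_head.
  apply: near_all_seq => f _.
  by have /cvgrPdist_lt/(_ d d0) := @ccf_continuous _ _ f t.
move: nt; rewrite nbhsE => -[ O [oO Ot] OI].
have [w [Ow wys]] := finite_avoid ys oO Ot; have [Iw fw] := OI w Ow.
exists (w :: ys); split=> /=; rewrite ?wys ?sys//.
- by move=> y; rewrite inE => /orP[/eqP->|/ysI].
- move=> f ff; rewrite !big_cons opprD addrACA mulrS.
  apply: le_trans (ler_normD _ _) _; rewrite lerD//; last exact: ysf.
  exact: ltW (fw f ff).
Qed.

Lemma add_points (O : set X) (m : nat) (ys : seq X) : open O ->
  m = 0%N \/ O !=set0 -> uniq ys ->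
  exists zs : seq X, [/\ uniq (zs ++ ys), size zs = m & forall z, z \in zs -> O z].
Proof.
move=> oO [->|[x Ox]] uys; first by exists [::].
elim: m => [|m [zs [uzs <- zsO]]]; first by exists [::].
have [w [Ow wzs]] := finite_avoid (zs ++ ys) oO Ox.
exists (w :: zs); split=> //=; first by rewrite wzs.
by move=> z; rewrite inE => /orP[/eqP->|/zsO].
Qed.

(** A compact set contains finitely many atoms, whose masses are integers. *)
Lemma atoms_with_multiplicity gamma K : compact K -> exists ts : seq X,
  (forall t, t \in ts -> K t) /\
  forall f, (forall x, f x != 0 -> K x) -> vague_eval gamma f = \sum_(t <- ts) f t.
Proof.
move=> cK; pose A := [set x | gamma [set x] != 0%E].
have lA := config_atoms_locally_finite M gamma.
have /finite_seqP[xs0 xs0E] := locally_finite_compact lA cK.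
pose xs := undup xs0.
have uxs : uniq xs by exact: undup_uniq.
have xsP x : x \in xs <-> A x /\ K x.
  rewrite mem_undup; have -> : (x \in xs0) = (x \in [set` xs0] :> bool).
    by apply/idP/idP => H; [exact: mem_set|exact: set_mem H].
  by rewrite -xs0E; split=> [/set_mem[]|H]; [|exact: mem_set].
have /choice[m mP] : forall x, exists k : nat, gamma [set x] = k%:R%:E.
  move=> x; have := config_set1_fin gamma x.
  by have [[k ->]|->] := cmeas_integer gamma (borel_set1 M x); [exists k|].
have sumE (h : X -> R) : \sum_(t <- flatten [seq nseq (m x) x | x <- xs]) h t =
    \sum_(x <- xs) h x *+ m x.
  rewrite big_flatten big_map; apply: eq_bigr => x _.
  by rewrite big_nseq iter_addr_0.
exists (flatten [seq nseq (m x) x | x <- xs]); split.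
- move=> t /flattenP[s /mapP[x /xsP[_ Kx] ->]]; by rewrite mem_nseq => /andP[_ /eqP->].
- move=> f fK; rewrite sumE (vague_eval_points M (xs := xs))//.
    by apply: eq_bigr => x _; rewrite mP/= mulr_natr.
  apply: (borel_sub0 _ _ _ (config_off_atoms M gamma)).
  + apply: measurableD; first exact: (cc_support_measurable f).
    apply: locally_finite_borel; apply: locally_finite_sub lA => x /= xxs.
    by have [] := (xsP x).1 xxs.
  + by apply: measurableC; exact: locally_finite_borel.
  + by move=> x [/= fx xxs] Ax; apply: xxs; apply/xsP; split=> //; exact: fK.
Qed.

Lemma supported_mass_seq gamma S (xs : seq X) : supported_on gamma S -> uniq xs ->
  (forall x, x \in xs -> S x) -> gamma [set` xs] = (size xs)%:R%:E.
Proof.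
move=> [_ S1 _]; elim: xs => [|x xs IH] /= => [_ _|/andP[xxs uxs] xsS].
  by rewrite set_nil measure0.
have mxs : measurable ([set` xs] : set (borel X)).
  apply: locally_finite_borel; rewrite -[[set` xs]]setU0.
  by apply: (locally_finite_setU_seq M) => y; exists setT; split=> //; exact: openT.
have mx := borel_set1 M x.
have -> : [set` x :: xs] = [set x] `|` [set` xs] by rewrite -[LHS]setU0 setU_cons setU0.
rewrite measureU//; last by apply/seteqP; split=> // z [-> /= zxs]; rewrite zxs in xxs.
rewrite -nat1r EFinD; congr (_ + _)%E; first by apply: S1; apply: xsS; exact: mem_head.
by apply: IH => // z zxs; apply: xsS; rewrite inE zxs orbT.
Qed.

Lemma supported_mass gamma (xs : seq X) : supported_on gamma [set` xs] -> uniq xs ->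
  gamma setT = (size xs)%:R%:E.
Proof.
move=> gS uxs; rewrite -(supported_mass_seq gS uxs)//.
have [lS _ S0] := gS; have mS := locally_finite_borel lS.
rewrite -(setvU [set` xs]) measureU//; last exact: setICl.
  by rewrite -[RHS]add0e; congr (_ + _)%E.
exact: measurableC.
Qed.

Lemma finite_or_more (S : set X) k :
  (exists xs : seq X, [/\ uniq xs, size xs = k & forall x, x \in xs -> S x]) \/
  (exists xs : seq X, [/\ uniq xs, (size xs < k)%N & S = [set` xs]]).
Proof.
elim: k => [|k [[xs [uxs sxs xsS]]|[xs [uxs sxs SE]]]]; first by left; exists [::].
- have [[x [Sx xxs]]|H] := pselect (exists x, S x /\ x \notin xs).
    left; exists (x :: xs); split=> /=; rewrite ?xxs ?sxs//.
    by move=> z; rewrite inE => /orP[/eqP->|/xsS].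
  right; exists xs; split=> //; first by rewrite sxs.
  apply/seteqP; split=> x /=; last exact: xsS.
  by move=> Sx; apply: contrapT => /negP xxs; apply: H; exists x.
- by right; exists xs; split=> //; exact: ltnW.
Qed.

(** The target configurations: the points of a finite set may be placed near
    the atoms of [gamma0] in [K], repeated with multiplicity, and the surplus
    of points outside [K], where the test functions vanish. *)
Lemma approximate_config (Z : config R X -> Prop) (U : set (config R X)) gamma0
    (fs : seq (cc_fun R X)) e K F I (ts xs : seq X) :
  (forall gamma, U gamma -> Z gamma) -> 0 < e ->
  (forall gamma, (forall f, f \in fs -> `|vague_eval gamma0 f - vague_eval gamma f| < e) ->
    U gamma) ->
  (forall f x, f \in fs -> f x != 0 -> K x) -> closed K ->
  (forall t, t \in ts -> I t) ->
  (forall f, f \in fs -> vague_eval gamma0 f = \sum_(t <- ts) f t) ->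
  open I -> (forall x, F x -> ~ K x) ->
  (forall xs ys : seq X, uniq xs -> uniq ys -> size xs = size ys ->
    (forall x, x \in xs -> I x) -> (forall y, y \in ys -> I y) ->
    all_in Z ([set` ys] `|` F) -> all_in Z ([set` xs] `|` F)) ->
  uniq xs -> (forall x, x \in xs -> I x) -> (size ts <= size xs)%N ->
  size xs = size ts \/ I `\` K !=set0 -> all_in Z ([set` xs] `|` F).
Proof.
move=> UZ e0 fsU fK clK tsI tsE oI FK exch uxs xsI le_ts extra.
pose d := e / (size ts).+1%:R.
have d0 : 0 < d by rewrite divr_gt0.
have [ys [uys sys ysI ysf]] := perturb_points fs oI d0 tsI.
have oIK : open (I `\` K) by apply: openI => //; rewrite openC.
have [|zs [uzys szs zsI]] := @add_points (I `\` K) (size xs - size ts)%N ys oIK _ uys.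
  by case: extra => [->|]; [left; rewrite subnn|right].
apply: (exch xs (zs ++ ys)) => //.
- by rewrite size_cat szs sys subnK.
- by move=> y; rewrite mem_cat => /orP[/zsI[]|/ysI].
move=> gamma gS; apply: UZ; apply: fsU => f ff.
rewrite tsE// (vague_eval_supported M (xs := zs ++ ys) gS)//.
- rewrite big_cat/= [X in _ - (X + _)]big1_seq ?add0r.
    apply: le_lt_trans (ysf f ff) _.
    rewrite -mulr_natl /d mulrCA gtr_pMr// ltr_pdivrMr// mul1r ltr_nat//.
  move=> z /= /zsI[_ nK]; apply/eqP/negPn/negP => fz; apply: nK; exact: fK fz.
- by move=> x xzs; left.
- by move=> x [//|Fx] fx; exfalso; apply: (FK x Fx); exact: fK fx.
Qed.

End Approximation.

(** * Points with a null open neighbourhood *)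

Section NullOpenSets.
Context {R : realType} {n : nat} {X : ptopologicalType} (M : smooth_manifold R n X).
Variable mu : probability (borel (config R X)) R.

(** The complement of the topological support of [mu]. *)
Definition negligible_point (gamma : config R X) : Prop :=
  exists O, [/\ open O, O gamma & mu O = 0%E].

Lemma config_borel_open (O : set (config R X)) : open O ->
  measurable (O : set (borel (config R X))).
Proof. exact: sub_sigma_algebra. Qed.

(** For each set of the network that lies in some null open set, up to
    configurations with multiple atoms, choose such an open set: countably many of
    them cover. *)
Lemma negligible_simple : exists N : set (borel (config R X)),
  [/\ measurable N, mu N = 0%E &
    forall gamma S, supported_on gamma S -> negligible_point gamma -> N gamma].
Proof.
have [N NP] := countable_network (R := R) M.
have /choice[ W WP] : forall i, exists W : set (config R X), [/\ open W, mu W = 0%E &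
    (exists O, [/\ open O, mu O = 0%E & forall gamma S, supported_on gamma S -> N i gamma -> O gamma]) ->
    forall gamma S, supported_on gamma S -> N i gamma -> W gamma].
  move=> i; have [[ O [oO O0 OP]]|H] := pselect (exists O, [/\ open O, mu O = 0%E &
      forall gamma S, supported_on gamma S -> N i gamma -> O gamma]).
    by exists O; split.
  by exists set0; split=> //; exact: open0.
pose V k : set (borel (config R X)) := if unpickle k is Some i then W i else set0.
have oV k : open (V k : set (config R X)).
  by rewrite /V; case: unpickle => [i|]; [have [] := WP i|exact: open0].
have V0 k : mu (V k) = 0%E.
  by rewrite /V; case: unpickle => [i|]; [have [] := WP i|exact: measure0].
have mV : measurable (\bigcup_k V k).
  by apply: config_borel_open; apply: bigcup_open => k _; exact: oV.
exists (\bigcup_k V k); split=> //.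
  apply: measure_negligible => //; apply: (@negligible_bigcup _ _ _ mu V) => k.
  by exists (V k); split=> //; [exact: (config_borel_open (oV k))|exact: V0].
move=> gamma S gS [ O [oO Og O0]].
have [i [Ng NO]] := NP gamma S O gS oO Og.
exists (pickle i) => //; rewrite /V pickleK.
by have [_ _ H] := WP i; apply: (H _ gamma S gS Ng); exists O.
Qed.

Hypothesis mu_simple : {ae mu, forall gamma : config R X,
  forall x : X, gamma [set x] = 0%E \/ gamma [set x] = 1%E}.

Lemma null_of_negligible_points (A : set (borel (config R X))) : measurable A ->
  (forall gamma S, supported_on gamma S -> A gamma -> negligible_point gamma) -> mu A = 0%E.
Proof.
move=> mA AZ; have [N [mN N0 NP]] := negligible_simple.
have [N' [mN' N'0 N'P]] := mu_simple.
have nN : mu.-negligible N by exists N; split.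
have nN' : mu.-negligible N' by exists N'; split.
apply: measure_negligible => //; apply: negligibleS (negligibleU nN nN').
move=> gamma Ag; have [Hs|Hs] := pselect (forall x : X, gamma [set x] = 0%E \/ gamma [set x] = 1%E).
  left; have gS := simple_supported M Hs.
  exact: NP gS (AZ _ _ gS Ag).
by right; apply: N'P.
Qed.

Lemma total_mass_measurable k :
  measurable ([set gamma : config R X | (k%:R%:E <= gamma [set: X])%E] : set (borel (config R X))).
Proof. by apply: config_borel_open; exact: (total_mass_open M). Qed.

Lemma total_mass_eq_measurable k :
  measurable ([set gamma : config R X | gamma [set: X] = k%:R%:E] : set (borel (config R X))).
Proof.
have -> : [set gamma : config R X | gamma [set: X] = k%:R%:E] =
    [set gamma : config R X | (k%:R%:E <= gamma [set: X])%E] `\`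
    [set gamma : config R X | (k.+1%:R%:E <= gamma [set: X])%E].
  apply/seteqP; split=> gamma /=.
    by move=> ->; rewrite lexx lee_fin ler_nat ltnn.
  have [[j ->]|->] := cmeas_integer gamma (@measurableT _ (borel X)).
    rewrite !lee_fin !ler_nat => -[kj /negP]; rewrite -ltnNge ltnS => jk.
    by congr (_%:R%:E); apply/eqP; rewrite eqn_leq jk kj.
  by move=> [_ /negP]; rewrite leey.
by apply: measurableD; exact: total_mass_measurable.
Qed.

End NullOpenSets.

(** * Reaching an open set by flows *)

Section PlacePoints.
Context {R : realType} {n : nat} {X : ptopologicalType} (M : smooth_manifold R n.+1 X).
Variables (Z : config R X -> Prop) (U : set (config R X)) (gamma0 : config R X).
Variables (fs : seq (cc_fun R X)) (e : R) (K : set X) (ts : seq X).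
Hypotheses (UZ : forall gamma, U gamma -> Z gamma) (e0 : 0 < e).
Hypothesis fsU : forall gamma,
  (forall f, f \in fs -> `|vague_eval gamma0 f - vague_eval gamma f| < e) -> U gamma.
Hypotheses (fK : forall f x, f \in fs -> f x != 0 -> K x) (cK : compact K).
Hypothesis tsK : forall t, t \in ts -> K t.
Hypothesis tsE : forall f, f \in fs -> vague_eval gamma0 f = \sum_(t <- ts) f t.

Let clK : closed K.
Proof. by apply: compact_closed cK; exact: (manifold_hausdorff M). Qed.

Lemma finite_set_uniq_seq (A : set X) : finite_set A ->
  exists xs : seq X, uniq xs /\ A = [set` xs].
Proof.
move=> /finite_seqP[xs0 ->]; exists (undup xs0); split; first exact: undup_uniq.
apply/seteqP; split=> x /=; rewrite mem_undup => H.
  by have : x \in [set` xs0]; [exact: mem_set|rewrite inE].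
exact: H.
Qed.

Lemma place_points (gamma : config R X) (S I : set X) (xs0 : seq X) : supported_on gamma S -> open I ->
  finite_set (S `&` I) -> K `<=` I -> I `\` K !=set0 ->
  uniq xs0 -> (forall x, x \in xs0 -> S x /\ I x) -> (size ts <= size xs0)%N ->
  (forall xs ys : seq X, uniq xs -> uniq ys -> size xs = size ys ->
    (forall x, x \in xs -> I x) -> (forall y, y \in ys -> I y) ->
    all_in Z ([set` ys] `|` (S `\` I)) -> all_in Z ([set` xs] `|` (S `\` I))) ->
  Z gamma.
Proof.
move=> gS oI /finite_set_uniq_seq[xs [uxs xsE]] KI IK uxs0 xs0P le_ts exch.
suff : all_in Z ([set` xs] `|` (S `\` I)).
  by apply; rewrite -xsE setUIDK.
apply: (approximate_config M UZ e0 fsU fK clK _ tsE oI _ exch) => //.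
- by move=> t /tsK/KI.
- by move=> x [_ nI] /KI.
- by move=> x xxs; have [] : (S `&` I) x by rewrite xsE.
- apply: leq_trans le_ts _; apply: uniq_leq_size => // x /xs0P SIx.
  by have : [set` xs] x by rewrite -xsE.
- by right.
Qed.

Lemma enough_points (gamma : config R X) (S : set X) : supported_on gamma S ->
  ((size ts)%:R%:E <= gamma [set: X])%E ->
  exists xs0 : seq X, [/\ uniq xs0, size xs0 = size ts & forall x, x \in xs0 -> S x].
Proof.
move=> gS; have [//|[xs [uxs sxs SE]]] := finite_or_more S (size ts).
rewrite SE in gS; rewrite (supported_mass M gS uxs) lee_fin ler_nat.
by rewrite leqNgt sxs.
Qed.

End PlacePoints.

Section LowDimension.
Context {R : realType} {X : ptopologicalType}.

(** The domain of a chart embeds into a one-point space, so that points are open. *)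
Lemma dim0_point (M : smooth_manifold R 0 X) : connected [set: X] ->
  forall x y : X, x = y.
Proof.
move=> cX x y; have [c Mc cx] := atlas_cover M x.
have E : [set x] = cdom c.
  apply/seteqP; split=> [_ ->//|z cz].
  by rewrite /= -(cmapK cz) -(cmapK cx); congr (cinv c _); apply/rowP => -[].
have : [set x] = [set: X].
  apply: cX; first by exists x.
    by exists (cdom c); [exact: cdom_open|rewrite setTI].
  by exists [set x]; [exact: (manifold_closed1 M)|rewrite setTI].
by move=> /seteqP[_ /(_ y I)] ->.
Qed.

Lemma line_bounded (M : smooth_manifold R 1 X) (c : chart R 1 X) (K : set X) :
  cdom c = setT -> compact K ->
  exists L : R, forall x, K x -> `|line_coord c x| < L.
Proof.
move=> cT cK.
have cc : {within K, continuous (line_coord c)}.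
  apply: continuous_subspaceT => x.
  apply: (@continuous_comp _ _ _ c (fun v : 'rV[R]_1 => v 0 0)).
    by apply: cmap_continuous; rewrite cT.
  exact: coord_continuous.
have [L [_ HL]] := compact_bounded (continuous_compact cc cK).
exists (L + 2) => x Kx; apply: le_lt_trans (HL (L + 1) _ _ _) _.
- by rewrite ltrDl.
- by exists x.
- by rewrite ltrD2l ltr1n.
Qed.

End LowDimension.

Section Reach.
Context {R : realType} {n : nat} {X : ptopologicalType} (M : smooth_manifold R n.+1 X).
Variables (Z : config R X -> Prop) (U : set (config R X)) (gamma0 : config R X).
Hypotheses (oU : open U) (Ug0 : U gamma0) (UZ : forall gamma, U gamma -> Z gamma).

Lemma test_data : exists (fs : seq (cc_fun R X)) (e : R) (K : set X),
  [/\ 0 < e,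
     forall gamma, (forall f, f \in fs -> `|vague_eval gamma0 f - vague_eval gamma f| < e) ->
       U gamma,
     forall f x, f \in fs -> f x != 0 -> K x & compact K].
Proof.
have [fs [e [e0 fsU]]] := vague_basis oU Ug0.
exists fs, e, (\bigcup_(f in [set` fs]) closure [set x | f x != 0]); split=> //.
  by move=> f x ff fx; exists f => //; exact: subset_closure.
exact: cc_supports_compact.
Qed.

End Reach.

Section ReachHigher.
Context {R : realType} {n : nat} {X : ptopologicalType} (M : smooth_manifold R n.+2 X).
Variables (Z : config R X -> Prop) (U : set (config R X)) (gamma0 : config R X).
Hypotheses (oU : open U) (Ug0 : U gamma0) (UZ : forall gamma, U gamma -> Z gamma).
Hypothesis Zinv : forall (V : vector_field M) (psi : R -> homeo X),
  compact (vf_support V) -> is_flow V psi ->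
  forall t gamma, Z (conf_push gamma (psi t)) -> Z gamma.
Hypothesis X_connected : connected [set: X].

(** Here all points of a configuration have to be placed near the atoms of
    [gamma0], so that the total masses must agree. *)
Lemma reach_higher_compact : compact [set: X] -> exists k : nat,
  forall gamma S, supported_on gamma S -> gamma [set: X] = k%:R%:E -> Z gamma.
Proof.
move=> cX; have [fs [e [K [e0 fsU fK cK]]]] := test_data oU Ug0.
have [ts [_ tsE]] := atoms_with_multiplicity M gamma0 cX.
have sts : gamma0 setT = (size ts)%:R%:E.
  have c1 : continuous (fun _ : X => 1 : R) by exact: cst_continuous.
  have k1 : compact (closure [set x : X | (fun=> 1 : R) x != 0]).
    by apply: (subclosed_compact _ cX) => //; exact: closed_closure.
  have := tsE (CcFun c1 k1) (fun _ _ => Logic.I).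
  rewrite /vague_eval Rintegral_cst//= mul1r big_const_seq count_predT iter_addr_0.
  move=> <-; rewrite fineK// ge0_fin_numE ?measure_ge0//; exact: cmeas_compact.
exists (size ts) => gamma S gS gX.
have fS : finite_set S.
  by rewrite -[S]setIT; have [lS _ _] := gS; exact: locally_finite_compact lS cX.
have [xs [uxs SE]] := finite_set_uniq_seq fS.
have sxs : size xs = size ts.
  have gS' := gS; rewrite SE in gS'.
  by have := supported_mass M gS' uxs; rewrite gX => -[] /eqP; rewrite eqr_nat => /eqP.
apply: (_ : all_in Z ([set` xs] `|` set0)); last by rewrite setU0 -SE.
have l0 : locally_finite (set0 : set X) by move=> y; exists setT; split=> //; exact: openT.
apply: (@approximate_config _ _ _ M Z U gamma0 fs e setT set0 setT ts xs) => //.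
- by move=> f _; exact: tsE.
- exact: openT.
- move=> xs1 ys1 u1 u2 s12 _ _.
  by apply: (exchange_higher Zinv) => // x _ [].
- by rewrite sxs.
- by left.
Qed.

(** Only the points in [K] and as many as there are targets are moved; the other
    points stay outside [K], where the test functions vanish. *)
Lemma reach_higher_noncompact : ~ compact [set: X] -> exists k : nat,
  forall gamma S, supported_on gamma S -> (k%:R%:E <= gamma [set: X])%E -> Z gamma.
Proof.
move=> ncX; have [fs [e [K [e0 fsU fK cK]]]] := test_data oU Ug0.
have [ts [tsK tsE]] := atoms_with_multiplicity M gamma0 cK.
exists (size ts) => gamma S gS gX.
have [xs0 [uxs0 sxs0 xs0S]] := enough_points M gS gX.
have [lS _ _] := gS.
have cK' : compact (K `|` [set` xs0]).
  by apply: compactU => //; apply: finite_compact; exact: finite_seq.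
have lF : locally_finite (S `\` (K `|` [set` xs0])).
  by apply: locally_finite_sub lS => x [].
pose I := ~` (S `\` (K `|` [set` xs0])).
have oI : open I by rewrite openC; exact: locally_finite_closed.
have SIE : S `&` I = S `&` (K `|` [set` xs0]).
  apply/seteqP; split=> x [Sx]; last by move=> Kx; split=> // -[_]; apply.
  by move=> nx; split=> //; apply: contrapT => nK; apply: nx.
apply: (place_points M UZ e0 fsU fK cK tsK _ gS oI _ _ _ uxs0) => //.
- by move=> f ff; apply: tsE => x; exact: fK.
- by rewrite SIE; exact: locally_finite_compact.
- by move=> x Kx [_]; apply; left.
- have oK : open (~` K).
    by rewrite openC; apply: compact_closed cK; exact: (manifold_hausdorff M).
  have [x nKx] : exists x, ~ K x.
    apply: contrapT => /forallNP H; apply: ncX.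
    rewrite (_ : setT = K)//; apply/seteqP; split=> // x _; exact: contrapT (H x).
  by have [w [Kw Fw]] := open_avoid M lF oK nKx; exists w.
- by move=> x xxs; split; [exact: xs0S|move=> [_]; apply; right].
- by rewrite sxs0.
- move=> xs ys uxs uys sxy xsI ysI; apply: (exchange_higher Zinv) => //.
  + by apply: locally_finite_sub lS => x [].
  + by move=> x xxs [_]; apply; exact: xsI.
  + by move=> x xxs [_]; apply; exact: ysI.
Qed.

End ReachHigher.

Section ReachLine.
Context {R : realType} {X : ptopologicalType} (M : smooth_manifold R 1 X).
Variables (Z : config R X -> Prop) (U : set (config R X)) (gamma0 : config R X).
Hypotheses (oU : open U) (Ug0 : U gamma0) (UZ : forall gamma, U gamma -> Z gamma).
Hypothesis Zinv : forall (V : vector_field M) (psi : R -> homeo X),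
  compact (vf_support V) -> is_flow V psi ->
  forall t gamma, Z (conf_push gamma (psi t)) -> Z gamma.
Variable c : chart R 1 X.
Hypotheses (cT : cdom c = setT) (ciT : cimg c = setT).

Lemma line_not_compact : ~ compact [set: X].
Proof.
move=> cX; have [L HL] := line_bounded M cT cX.
have := HL (line_pt c L) Logic.I; rewrite line_ptK// ltNge ler_norm//.
Qed.

(** The points that are moved are those in an interval around [K] which contains
    as many of them as there are targets. *)
Lemma reach_line : exists k : nat,
  forall gamma S, supported_on gamma S -> (k%:R%:E <= gamma [set: X])%E -> Z gamma.
Proof.
have [fs [e [K [e0 fsU fK cK]]]] := test_data oU Ug0.
have [ts [tsK tsE]] := atoms_with_multiplicity M gamma0 cK.
exists (size ts) => gamma S gS gX.
have [xs0 [uxs0 sxs0 xs0S]] := enough_points M gS gX.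
have [lS _ _] := gS.
have cK' : compact (K `|` [set` xs0]).
  by apply: compactU => //; apply: finite_compact; exact: finite_seq.
have [L HL] := line_bounded M cT cK'.
have cc : continuous (fun x : X => line_coord c x).
  move=> x; apply: (@continuous_comp _ _ _ c (fun v : 'rV[R]_1 => v 0 0)).
    by apply: cmap_continuous; rewrite cT.
  exact: coord_continuous.
pose I := [set x | - (`|L| + 2) < line_coord c x < `|L| + 2].
have LL := ler_norm L; have L0 := normr_ge0 L.
have KI : K `|` [set` xs0] `<=` I.
  by move=> x /HL; rewrite ltr_norml /I/= => /andP[a b]; apply/andP; split; lra.
have oI : open I.
  rewrite (_ : I = line_coord c @^-1` `]- (`|L| + 2), `|L| + 2[%classic).
    by apply: open_comp; [move=> x _; exact: cc|exact: interval_open].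
  by apply/seteqP; split=> x /=; rewrite in_itv.
apply: (place_points M UZ e0 fsU fK cK tsK _ gS oI _ _ _ uxs0) => //.
- by move=> f ff; apply: tsE => x; exact: fK.
- have cJ : compact (line_pt c @` `[- (`|L| + 2), `|L| + 2]%classic).
    apply: continuous_compact; last exact: segment_compact.
    by apply: continuous_subspaceT; exact: line_pt_continuous.
  apply: sub_finite_set (locally_finite_compact lS cJ).
  move=> x [Sx /= /andP[x1 x2]]; split=> //; exists (line_coord c x).
    by rewrite /= in_itv/= !ltW.
  exact: line_coordK.
- by move=> x Kx; apply: KI; left.
- exists (line_pt c (`|L| + 1)); split.
    by rewrite /I/= line_ptK//; apply/andP; split; lra.
  move=> Kx; have := HL _ (or_introl Kx); rewrite line_ptK// ltr_norml => /andP[_].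
  lra.
- by move=> x xxs; split; [exact: xs0S|apply: KI; right].
- by rewrite sxs0.
- move=> xs ys uxs uys sxy xsI ysI.
  apply: (exchange_line cT ciT Zinv (l := - (`|L| + 2)) (u := `|L| + 2)) => //.
    by apply: locally_finite_sub lS => x [].
  by move=> x Ix [_]; apply.
Qed.

End ReachLine.

(** * Full support *)

Theorem proposition5p6 (R : realType) (n : nat) (X : ptopologicalType)
    (M : smooth_manifold R n X) (g : riemannian_metric M)
    (X_connected : connected [set: X])
    (X_complete : complete_metric g)
    (X_line : n = 1%N -> euclidean g)
    (mu : probability (borel (config R X)) R)
    (mu_simple : {ae mu, forall gamma : config R X,
      forall x : X, gamma [set x] = 0%E \/ gamma [set x] = 1%E})
    (mu_compact : compact [set: X] -> forall k : nat,
      (0 < mu [set gamma : config R X | gamma [set: X] = k%:R%:E])%E)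
    (mu_noncompact : ~ compact [set: X] -> forall k : nat,
      (0 < mu [set gamma : config R X | (k%:R%:E <= gamma [set: X])%E])%E)
    (mu_quasi_invariant :
      forall (V : vector_field M) (psi : R -> homeo X),
        compact (vf_support V) -> is_flow V psi ->
        forall t : R,
          let F : borel (config R X) -> borel (config R X) :=
            fun gamma : config R X => conf_push gamma (psi t) in
          pushforward mu F `<< mu /\ mu `<< pushforward mu F) :
  forall U : set (config R X), open U -> U !=set0 -> (0 < mu U)%E.
Proof.
move=> U oU [gamma0 Ug0]; rewrite lt0e measure_ge0 andbT; apply/eqP => muU0.
pose Z := negligible_point mu.
have UZ gamma : U gamma -> Z gamma by move=> Ug; exists U.
have Zinv (V : vector_field M) (psi : R -> homeo X) :
    compact (vf_support V) -> is_flow V psi ->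
    forall t gamma, Z (conf_push gamma (psi t)) -> Z gamma.
  move=> cV fV t gamma [ O [oO Og O0]].
  have oP := conf_push_open (psi t) oO.
  exists [set gamma : config R X | O (conf_push gamma (psi t))]; split=> //.
  have [dom _] := mu_quasi_invariant V psi cV fV t.
  have nO : mu.-null_set O by apply/measure0_null_setP => //; exact: config_borel_open.
  exact: (dom O nO O (config_borel_open oO) (@subset_refl _ O)).
have null_compact k : compact [set: X] ->
    ~ (forall gamma S, supported_on gamma S -> gamma [set: X] = k%:R%:E -> Z gamma).
  move=> cX H; have := mu_compact cX k.
  rewrite (null_of_negligible_points M mu_simple) ?ltxx//.
  exact: (total_mass_eq_measurable M).
have null_noncompact k : ~ compact [set: X] ->
    ~ (forall gamma S, supported_on gamma S -> (k%:R%:E <= gamma [set: X])%E -> Z gamma).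
  move=> cX H; have := mu_noncompact cX k.
  rewrite (null_of_negligible_points M mu_simple) ?ltxx//.
  exact: (total_mass_measurable M).
case: n M g X_complete X_line mu_quasi_invariant Zinv null_compact null_noncompact
    => [|[|n']] M' g' _ X_line _ Zinv' null_compact' null_noncompact'.
- have cX : compact [set: X].
    by rewrite (_ : setT = [set point : X]); [exact: compact_set1|
      apply/seteqP; split=> // x _; exact: (dim0_point M' X_connected)].
  apply: (null_compact' 2%N cX) => gamma S gS gX; exfalso.
  have [lS S1 S0] := gS; have [Sp|nSp] := pselect (S point).
    have := S1 point Sp; rewrite (_ : [set point] = [set: X]).
      by rewrite gX => -[] /eqP; rewrite -[1]/(1%:R) eqr_nat.
    by apply/seteqP; split=> // x _; exact: (dim0_point M' X_connected).
  move: S0; rewrite (_ : ~` S = [set: X]).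
    by rewrite gX => -[] /eqP; rewrite pnatr_eq0.
  by apply/seteqP; split=> // x _; rewrite (dim0_point M' X_connected x point).
- have [c [_ cT ciT _]] := X_line erefl.
  have [k kP] := reach_line oU Ug0 UZ Zinv' cT ciT.
  exact: (null_noncompact' k (line_not_compact M' cT ciT) kP).
- have [cX|ncX] := pselect (compact [set: X]).
    have [k kP] := reach_higher_compact oU Ug0 UZ Zinv' X_connected cX.
    exact: (null_compact' k cX kP).
  have [k kP] := reach_higher_noncompact oU Ug0 UZ Zinv' X_connected ncX.
  exact: (null_noncompact' k ncX kP).
Qed.
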